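(* There exists a universal constant $C>0$ such that the following holds. Fix a dimension $d$, a confidence parameter $1-\alpha\in(0,1)$, a sample size $n\in\mathbb{N}$ and a contamination parameter $\eta\in[0,1/2)$. Then there is an estimator (i.e. a measurable function) $\widehat{\mathsf E}_\star:(\mathbb{R}^d)^n\to\mathbb{R}^{d\times d}_{\ge 0}$, depending on $\alpha$, $\eta$ and $n$, such that the following is true. Let $X_1,\dots,X_n$ be i.i.d. copies of a random vector $X$ in $\mathbb{R}^d$ with $\mathbb{E}[\|X\|^p]<+\infty$ for some $p\ge 4$, $\mathbb{E}[X]=0$ and non-null covariance matrix $\Sigma=\mathbb{E}[XX^\top]$, and let $Y_1,\dots,Y_n$ be random vectors in $\mathbb{R}^d$ with $\#\{i\in[n]: Y_i\neq X_i\}\le \eta n$. If additionally $\eta\le \frac{1}{C\kappa_4^4}$ and $n\ge C\,(r(\Sigma)+\log(2/\alpha))$, then with probability at least $1-\alpha$, $$\|\widehat{\mathsf E}_\star(Y_1,\dots,Y_n)-\Sigma\|_{\rm op}\le C\kappa_4^2\|\Sigma\|_{\rm op}\left(\sqrt{\frac{r(\Sigma)}{n}}+\sqrt{\frac{\log(2/\alpha)}{n}}\right)+C\kappa_p^2\|\Sigma\|_{\rm op}\,\eta^{1-\frac{2}{p}}.$$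
   Context: $\mathbb{R}^{d\times d}_{\ge 0}$ is the set of symmetric positive semidefinite $d\times d$ real matrices, $\|\cdot\|_{\rm op}$ is the operator norm, $\|\cdot\|$ the Euclidean norm on $\mathbb{R}^d$, and $[n]=\{1,\dots,n\}$. The effective rank is $r(\Sigma)=\mathrm{tr}(\Sigma)/\|\Sigma\|_{\rm op}$. For $q\ge 1$, the moment constant of $X$ is $\kappa_q:=\sup_{v\in\mathbb{R}^d,\ \langle v,\Sigma v\rangle=1}\left(\mathbb{E}[|\langle X,v\rangle|^q]\right)^{1/q}$. The $Y_i$ may depend arbitrarily on the $X_i$, subject only to the stated constraint on the number of differing indices (adversarial contamination). *)

(* Defs.v *)
From HB Require Import structures.
From mathcomp Require Import all_boot all_order all_algebra.
From mathcomp Require Import all_classical all_reals all_analysis.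
Set Implicit Arguments.
Unset Strict Implicit.
Unset Printing Implicit Defensive.
Import Order.TTheory GRing.Theory Num.Theory.
Import numFieldNormedType.Exports.
Local Open Scope classical_set_scope.
Local Open Scope ring_scope.

(* On real matrices (in particular on the column vectors 'cV[R]_d) we use the
   sigma-algebra generated by the entries, i.e. the Borel sigma-algebra. *)
Definition measure_matrix_display : measure_display -> measure_display.
Proof. exact. Qed.

Section measurable_matrix.
Context {d : measure_display} {T : measurableType d} (m n : nat).

Let entry_sets : set (set 'M[T]_(m, n)) :=
  [set A | exists i j, exists2 B : set T,
     measurable B & A = (fun M : 'M[T]_(m, n) => M i j) @^-1` B].

Let matrix_set0 : <<s entry_sets >> set0.
Proof. exact: sigma_algebra0. Qed.

Let matrix_setC A : <<s entry_sets >> A -> <<s entry_sets >> (~` A).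
Proof. exact: sigma_algebraC. Qed.

Let matrix_bigcup (F : (set 'M[T]_(m, n))^nat) :
  (forall k, <<s entry_sets >> (F k)) -> <<s entry_sets >> (\bigcup_k F k).
Proof. exact: sigma_algebra_bigcup. Qed.

HB.instance Definition _ := @isMeasurable.Build (measure_matrix_display d)
  'M[T]_(m, n) <<s entry_sets >> matrix_set0 matrix_setC matrix_bigcup.

End measurable_matrix.

Section linear_algebra.
Context {R : realType}.

Definition inner (d : nat) (u v : 'cV[R]_d) : R := \sum_(i < d) u i 0 * v i 0.

(* The library norm `|u| on matrices is the max-norm, not the Euclidean one. *)
Definition enorm (d : nat) (u : 'cV[R]_d) : R := Num.sqrt (inner u u).

(* Unit ball rather than unit sphere, so that the set is nonempty for d = 0. *)
Definition opnorm (d : nat) (A : 'M[R]_d) : R :=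
  sup [set enorm (A *m v) | v in [set v : 'cV[R]_d | enorm v <= 1]].

Definition psd (d : nat) (A : 'M[R]_d) : Prop :=
  A^T = A /\ forall v : 'cV[R]_d, 0 <= inner v (A *m v).

Definition effective_rank (d : nat) (A : 'M[R]_d) : R := \tr A / opnorm A.

End linear_algebra.

Section random_vectors.
Context {R : realType} {dT : measure_display} {T : measurableType dT}.
Context (P : probability T R).

(* E[X X^T]; fine is harmless when X has finite second moments. *)
Definition second_moment (d : nat) (X : {RV P >-> 'cV[R]_d}) : 'M[R]_d :=
  \matrix_(i, j) fine 'E_P[fun w => X w i 0 * X w j 0].

(* 'N[P]_(q%:E)[f] is (E[|f|^q])^(1/q). The supremum is finite as soon as
   E[||X||^q] is (with q >= 2): X is then almost surely orthogonal to the
   kernel of E[X X^T]. *)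
Definition moment_constant (d : nat) (X : {RV P >-> 'cV[R]_d}) (q : R) : R :=
  fine (ereal_sup
    [set 'N[P]_(q%:E)[(fun w => (inner (X w) v)%:E)]%E
    | v in [set v : 'cV[R]_d | inner v (second_moment X *m v) = 1]]).

Definition mutually_independent (n : nat) (dE : measure_display)
    (E : measurableType dE) (X : 'I_n -> {RV P >-> E}) : Prop :=
  forall (J : {set 'I_n}) (A : 'I_n -> set E),
    (forall i, measurable (A i)) ->
    P (\bigcap_(i in [set` J]) (X i @^-1` A i)) =
    (\prod_(i in J) P (X i @^-1` A i))%E.

Definition iid_copies (n : nat) (dE dT0 : measure_display)
    (E : measurableType dE) (T0 : measurableType dT0)
    (P0 : probability T0 R) (X0 : {RV P0 >-> E})
    (X : 'I_n -> {RV P >-> E}) : Prop :=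
  mutually_independent X /\
  forall i (A : set E), measurable A ->
    distribution P (X i) A = distribution P0 X0 A.

End random_vectors.

(* Main.v *)
(** The estimator trims. For a budget m, let T_m(v) be the smallest value of the
    sum of <Y_i, v>^2 after deleting a constant multiple of m indices. A budget
    passes if the trimmed trace is at most m times T_m(v), up to a constant, in
    some direction v of the unit ball. The least passing budget at least
    eta n + log(2/alpha) + 4 adapts to the effective rank, because a passing budget
    makes T_m bounded by a multiple of n times the operator norm of Sigma, so that
    comparing traces forces m to be at least of order r(Sigma); conversely every
    budget of the order of eta n + r(Sigma) + log(2/alpha) passes when n is large.
    The output is a positive semidefinite rational matrix whose quadratic form is
    nearly closest to T_m / n on the rational points of the unit ball; having
    countable range, the estimator is measurable.

    The uniform bounds over the unit ball come from a PAC-Bayes inequality. Each v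
    is smoothed into a law on a finite set of points, a product of biased signs,
    whose relative entropy with respect to the uniform law is at most beta and
    under which the mean of <x, theta>^2 exceeds <x, v>^2 by about |x|^2 / beta.
    With beta = r(Sigma) + log(2/alpha) + 4 this spares both the dimension and a
    union bound. Only fourth moments enter the two-sided bound; the p-th moment
    controls the mass that deleting eta n indices can remove. *)
Require Import Defs.
From HB Require Import structures.
From mathcomp Require Import all_boot all_order all_algebra.
From mathcomp Require Import all_classical all_reals all_analysis.
From mathcomp Require Import measurable_realfun ring lra.
Import Order.TTheory GRing.Theory Num.Theory.
Import numFieldNormedType.Exports.
Local Open Scope classical_set_scope.
Local Open Scope ring_scope.

(** * Biased sign vectors *)

(** The effective rank, the fourth-moment constant and [p] are unknown to the estimator. Trimmed
    forms decrease in the budget, and this splits the two halves of the error bound: a lower bound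
    proved at one good budget passes to the smaller selected budget for free, whereas the upper
    bound must hold at the selected budget itself, where enough points have to be deleted; this is
    why passing must force a budget to be large. The sample size is only compared to
    [r + log(2/alpha)], without the factor [kappa_4^4]. When this factor spoils the good budget, the
    claimed error is already at least a constant times the operator norm of Sigma, and the crude
    bound on a passing form, or the output 0, is enough. For the two-sided estimate the excess that
    smoothing adds to every form is subtracted before the influence function [ln (1 + u + u^2)] is
    applied; what this function loses is counted by truncated fourth powers, which also count the
    points that the trimming must remove. *)

Fixpoint cube (K : nat) : finType :=
  if K is K'.+1 then (bool * cube K')%type : finType else unit : finType.

Section SignVectors.
Context {R : realType}.
Implicit Types (t y : nat -> R).

Definition sgnb (b : bool) : R := if b then 1 else -1.

(** The product law of independent signs with means [t i]. *)
Fixpoint cube_wt t (K : nat) : cube K -> R :=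
  match K return cube K -> R with
  | 0 => fun=> 1
  | K'.+1 => fun c => (1 + sgnb c.1 * t K') / 2 * cube_wt t K' c.2
  end.

Fixpoint cube_lin y (K : nat) : cube K -> R :=
  match K return cube K -> R with
  | 0 => fun=> 0
  | K'.+1 => fun c => sgnb c.1 * y K' + cube_lin y K' c.2
  end.

Lemma sum_cubeS (V : zmodType) (K : nat) (F : cube K.+1 -> V) :
  \sum_c F c = \sum_(c : cube K) (F (true, c) + F (false, c)).
Proof.
rewrite big_split /=.
transitivity (\sum_(p : bool * cube K) F (p.1, p.2)).
  by apply: eq_bigr => -[].
rewrite -(pair_bigA _ (fun b c => F (b, c))) /=.
by rewrite big_bool.
Qed.

Lemma card_cube K : (#|cube K| = 2 ^ K)%N.
Proof.
by elim: K => [|K IH] /=; rewrite ?card_unit // card_prod card_bool IH expnS.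
Qed.

Lemma cube_wt_ge0 t K c : (forall i, `|t i| <= 1) -> 0 <= cube_wt t K c.
Proof.
move=> t1; elim: K c => [//|K IH] [b c] /=.
rewrite mulr_ge0 // divr_ge0 //; have := t1 K; rewrite ler_norml.
by case: b => /=; lra.
Qed.

Lemma cube_wt_gt0 t K c : (forall i, `|t i| < 1) -> 0 < cube_wt t K c.
Proof.
move=> t1; elim: K c => [//|K IH] [b c] /=.
rewrite mulr_gt0 // divr_gt0 //; have := t1 K; rewrite ltr_norml.
by case: b => /=; lra.
Qed.

Lemma cube_wt_sum t K : \sum_c cube_wt t K c = 1.
Proof.
elim: K => [|K IH]; first by rewrite big_const cardT enumT unlock /= addr0.
rewrite sum_cubeS /= -[RHS]IH; apply: eq_bigr => c _; by field.
Qed.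

Definition cube_mean t y K := \sum_(i < K) y i * t i.

Definition cube_moment t y K k :=
  \sum_c cube_wt t K c * (cube_lin y K c - cube_mean t y K) ^+ k.

Lemma cube_moment0 t y K : cube_moment t y K 0 = 1.
Proof.
by rewrite -(cube_wt_sum t K); apply: eq_bigr => c _; rewrite expr0 mulr1.
Qed.

Lemma cube_moment1 t y K : cube_moment t y K 1 = 0.
Proof.
elim: K => [|K IH].
  by rewrite /cube_moment /cube_mean big1 // => c _; rewrite big_ord0 subrr expr1 mulr0.
rewrite -[RHS]IH /cube_moment sum_cubeS; apply: eq_bigr => c _ /=.
rewrite /cube_mean big_ord_recr /=; by field.
Qed.

Lemma cube_moment2 t y K :
  cube_moment t y K 2 = \sum_(i < K) y i ^+ 2 * (1 - t i ^+ 2).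
Proof.
elim: K => [|K IH].
  rewrite /cube_moment /cube_mean !big_ord0 big1 // => c _.
  by rewrite subr0 expr2 !mulr0.
rewrite big_ord_recr /= -IH.
have -> : y K ^+ 2 * (1 - t K ^+ 2) = y K ^+ 2 * (1 - t K ^+ 2) * cube_moment t y K 0.
  by rewrite cube_moment0 mulr1.
rewrite /cube_moment sum_cubeS mulr_sumr -big_split; apply: eq_bigr => c _ /=.
rewrite /cube_mean big_ord_recr /=; by field.
Qed.

(** Induction on the number of independent signs: in the binomial expansion the term with the third
    moment of the new sign is multiplied by the first central moment of the others, which is 0. The
    constant 3 is that of a Gaussian. *)
Lemma cube_moment4 t y K : (forall i, `|t i| <= 1) ->
  cube_moment t y K 4 <= 3 * (\sum_(i < K) y i ^+ 2) ^+ 2.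
Proof.
move=> t1; elim: K => [|K IH].
  rewrite /cube_moment /cube_mean !big_ord0 big1 ?expr0n /= ?mulr0 // => c _.
  by rewrite subr0 expr0n mulr0.
have -> : cube_moment t y K.+1 4 = cube_moment t y K 4
   + 6 * y K ^+ 2 * (1 - t K ^+ 2) * cube_moment t y K 2
   + (- 8 * y K ^+ 3 * t K * (1 - t K ^+ 2)) * cube_moment t y K 1
   + y K ^+ 4 * (1 - t K ^+ 2) * (1 + 3 * t K ^+ 2) * cube_moment t y K 0.
  rewrite /cube_moment sum_cubeS !mulr_sumr -!big_split; apply: eq_bigr => c _ /=.
  rewrite /cube_mean big_ord_recr /=; by field.
rewrite cube_moment0 cube_moment1 cube_moment2 big_ord_recr /=.
set S := (\sum_(i < K) y i ^+ 2) in IH *.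
have t2 i : 0 <= t i ^+ 2 <= 1.
  apply/andP; split; first exact: sqr_ge0.
  by rewrite -real_normK ?num_real // exprn_ile1.
have tK := t2 K.
set S' := \sum_(i < K) y i ^+ 2 * (1 - t i ^+ 2).
have S'0 : 0 <= S'.
  apply: sumr_ge0 => i _; rewrite mulr_ge0 ?sqr_ge0 // subr_ge0.
  by case/andP: (t2 i).
have S'S : S' <= S.
  by apply: ler_sum => i _; rewrite ler_piMr ?sqr_ge0 // gerBl sqr_ge0.
have y2 : 0 <= y K ^+ 2 by rewrite sqr_ge0.
set Y := y K ^+ 2 in y2 *; set u := t K ^+ 2 in tK *.
have -> : y K ^+ 4 = Y ^+ 2 by rewrite /Y -exprM.
have h1 : Y * (1 - u) * S' <= Y * S.
  by rewrite -mulrA ler_wpM2l // -[leRHS]mul1r ler_pM //; lra.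
have h2 : Y ^+ 2 * ((1 - u) * (1 + 3 * u)) <= Y ^+ 2 * 3.
  by rewrite ler_wpM2l ?sqr_ge0 //; nra.
nra.
Qed.

(** Relative entropy is additive over independent coordinates, and [ln (1 + s) <= s] at [s = t] and
    [s = - t] bounds the share of a sign of mean [t] by [t^2]. Multiplying by the cardinal turns a
    weight into a density with respect to the uniform law. *)
Lemma cube_entropy t K : (forall i, `|t i| < 1) ->
  \sum_c cube_wt t K c * ln (cube_wt t K c * #|cube K|%:R)
    <= \sum_(i < K) t i ^+ 2.
Proof.
move=> t1; elim: K => [|K IH].
  by rewrite big_ord0 big1 // => c _ /=; rewrite card_unit mulr1 ln1 mulr0.
rewrite big_ord_recr /=.
have -> : \sum_(c : cube K.+1) cube_wt t K.+1 c * ln (cube_wt t K.+1 c * #|cube K.+1|%:R)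
  = \sum_c cube_wt t K c * ln (cube_wt t K c * #|cube K|%:R)
    + ((1 + t K) / 2 * ln (1 + t K) + (1 - t K) / 2 * ln (1 - t K))
      * \sum_c cube_wt t K c.
  rewrite sum_cubeS mulr_sumr -big_split; apply: eq_bigr => c _ /=.
  have w0 := @cube_wt_gt0 t K c t1.
  have c0 : 0 < #|cube K|%:R :> R by rewrite ltr0n card_cube expn_gt0.
  have := t1 K; rewrite ltr_norml => tK.
  have e (s : R) : -1 < s -> ln ((1 + s) / 2 * cube_wt t K c * #|cube K.+1|%:R)
      = ln (1 + s) + ln (cube_wt t K c * #|cube K|%:R).
    move=> s1; rewrite -lnM ?posrE ?mulr_gt0 //; last by lra.
    congr ln; rewrite !card_cube expnS natrM; by field.
  rewrite mul1r mulN1r !e; [|lra..].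
  by field.
rewrite cube_wt_sum mulr1 lerD //.
have := t1 K; rewrite ltr_norml => tK.
have h (s : R) : -1 < s -> (1 + s) / 2 * ln (1 + s) <= (1 + s) / 2 * s.
  move=> s1; rewrite ler_wpM2l; [done|lra|].
  by rewrite le_ln1Dx.
have := h (t K); have := h (- t K); nra.
Qed.

End SignVectors.

(** * Smoothing a direction into a law on finitely many points *)

Section Smoothing.
Context {R : realType}.

(* rho v is a law on finitely many points th of R^d, centred at v, with
   covariance about 1/beta, and of relative entropy at most beta with respect
   to the uniform law. *)
Definition smoothing (d : nat) (beta e : R) (Theta : finType)
    (th : Theta -> 'cV[R]_d) (rho : 'cV[R]_d -> Theta -> R) : Prop :=
  forall v, inner v v <= 1 ->
  [/\ forall i, 0 <= rho v i, \sum_i rho v i = 1,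
      \sum_i rho v i * ln (rho v i * #|Theta|%:R) <= beta &
   forall x,
   [/\ \sum_i rho v i * inner x (th i) = inner x v,
      inner x x / beta - e * inner x x
        <= \sum_i rho v i * (inner x (th i) - inner x v) ^+ 2,
      \sum_i rho v i * (inner x (th i) - inner x v) ^+ 2 <= inner x x / beta &
      \sum_i rho v i * (inner x (th i) - inner x v) ^+ 4
        <= 3 * (inner x x / beta) ^+ 2]].

Lemma eq_cube_lin (y y' : nat -> R) K c : (forall i, (i < K)%N -> y i = y' i) ->
  cube_lin y K c = cube_lin y' K c.
Proof.
elim: K c => [//|K IH] [b c] yy' /=; rewrite yy' // IH // => i iK.
by rewrite yy' // ltnW.
Qed.

Lemma cube_lin_sum d (a : 'I_d -> R) (y : 'I_d -> nat -> R) K c :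
  \sum_j a j * cube_lin (y j) K c = cube_lin (fun i => \sum_j a j * y j i) K c.
Proof.
elim: K c => [|K IH] c /=; first by rewrite big1 // => j _; rewrite mulr0.
rewrite -IH mulr_sumr -big_split /=; apply: eq_bigr => j _; ring.
Qed.

Lemma sum_divn d N (F : nat -> R) : (0 < N)%N ->
  \sum_(i < d * N) F (i %/ N)%N = N%:R * \sum_(j < d) F j.
Proof.
move=> N0; elim: d => [|d IH]; first by rewrite !big_ord0 mulr0.
rewrite big_ord_recr /= mulrDr -IH mulSnr.
rewrite -!(big_mkord xpredT (fun i => F (i %/ N)%N)).
rewrite (big_cat_nat (n := (d * N)%N)) ?leq_addr //=; congr (_ + _).
rewrite -{1}[(d * N)%N]add0n big_addn addKn big_mkord.
rewrite (eq_bigr (fun=> F d)) ?sumr_const ?card_ord ?mulr_natl // => i _.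
by rewrite addnC divnMDl // divn_small // addn0.
Qed.

(** The biases of the signs are indexed by all of [nat]; the default 0 keeps those out of range
    below 1 in absolute value. *)
Definition coordn d (v : 'cV[R]_d) (j : nat) : R :=
  if insub j is Some o then v o 0 else 0.

Lemma coordn_ord d (v : 'cV[R]_d) (j : 'I_d) : coordn d v j = v j 0.
Proof. by rewrite /coordn valK. Qed.

Lemma coord_sqr_le d (v : 'cV[R]_d) j : v j 0 ^+ 2 <= inner v v.
Proof.
rewrite /inner (bigD1 j) //= -expr2 lerDl sumr_ge0 // => i _.
by rewrite -expr2 sqr_ge0.
Qed.

Definition sm_point d N (a : R) (c : cube (d * N)) : 'cV[R]_d :=
  \col_(j < d) cube_lin (fun i => a * (i %/ N == j)%N%:R) (d * N) c.

Lemma inner_sm_point d N a c x : (0 < N)%N ->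
  inner x (sm_point d N a c) = cube_lin (fun i => a * coordn d x (i %/ N)%N) (d * N) c.
Proof.
move=> N0; rewrite /inner; under eq_bigr do rewrite mxE.
rewrite cube_lin_sum; apply: eq_cube_lin => i iK.
have iN : (i %/ N < d)%N by rewrite ltn_divLR.
rewrite (bigD1 (Ordinal iN)) //= eqxx big1 ?addr0.
  by rewrite -[(i %/ N)%N]/(nat_of_ord (Ordinal iN)) coordn_ord mulr1 mulrC.
move=> j /eqP jN; case: eqP => [e | _]; last by rewrite !mulr0.
by case: jN; apply: val_inj.
Qed.

(** Coordinate [j] is [a] times a sum of [N] signs of mean [v j 0 * sqrt (beta / N)], a discrete
    substitute for a Gaussian of covariance [1 / beta]. The entropy is at most
    [N * (beta / N) * inner v v], and the variance falls short of [inner x x / beta] by a term of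
    order [1 / N], which [e] absorbs. Taking [N] above [beta] keeps the biases below 1. *)
Lemma smoothing_exists (d : nat) (beta e : R) : 0 < beta -> 0 < e ->
  exists (Theta : finType) (th : Theta -> 'cV[R]_d) (rho : 'cV[R]_d -> Theta -> R),
    (0 < #|Theta|)%N /\ smoothing d beta e Theta th rho.
Proof.
move=> b0 e0; have [N [N0 bN eN]] : exists N, [/\ (0 < N)%N, beta < N%:R & N%:R^-1 <= e].
  pose N := (Num.truncn (beta + e^-1)).+1; exists N.
  have h : beta + e^-1 < N%:R by apply: truncnS_gt.
  have e1 : 0 < e^-1 by rewrite invr_gt0.
  split=> //; first by lra.
  by rewrite -[leRHS]invrK lef_pV2 ?posrE //; lra.
have NR : 0 < N%:R :> R by rewrite ltr0n.
pose a := Num.sqrt (beta * N%:R)^-1; pose t (v : 'cV[R]_d) i := coordn d v (i %/ N)%N * Num.sqrt (beta / N%:R).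
have a2 : a ^+ 2 = (beta * N%:R)^-1 by rewrite sqr_sqrtr // invr_ge0 mulr_ge0 // ltW.
have s2 : Num.sqrt (beta / N%:R) ^+ 2 = beta / N%:R by rewrite sqr_sqrtr // divr_ge0 // ltW.
have asq : a * Num.sqrt (beta / N%:R) = N%:R^-1.
  rewrite -sqrtrM ?invr_ge0 ?mulr_ge0 ?ltW //.
  have -> : (beta * N%:R)^-1 * (beta / N%:R) = N%:R^-1 ^+ 2 :> R by field; rewrite !gt_eqF.
  by rewrite sqrtr_sqr ger0_norm // invr_ge0 ltW.
exists (cube (d * N)), (sm_point d N a), (fun v => cube_wt (t v) (d * N)).
split; first by rewrite card_cube expn_gt0.
move=> v v1.
have c2 j : coordn d v j ^+ 2 <= 1.
  rewrite /coordn; case: insubP => [k _ _ | _]; last by rewrite expr0n.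
  exact: le_trans (coord_sqr_le _ _ _) v1.
have t1 i : `|t v i| < 1.
  rewrite -(@ltr_pXn2r _ 2) ?nnegrE // expr1n real_normK ?num_real // exprMn s2.
  apply: le_lt_trans (_ : beta / N%:R < 1); last by rewrite ltr_pdivrMr // mul1r.
  by rewrite ler_piMl // divr_ge0 // ltW.
have t1' i : `|t v i| <= 1 by exact: ltW.
split.
- by move=> i; apply: cube_wt_ge0.
- exact: cube_wt_sum.
- apply: le_trans (cube_entropy _ _ t1) _.
  rewrite (sum_divn d N (fun j => (coordn d v j * Num.sqrt (beta / N%:R)) ^+ 2)) //.
  under eq_bigr do rewrite coordn_ord exprMn s2.
  rewrite -mulr_suml mulrCA mulrC [N%:R * _]mulrC divfK ?gt_eqF // mulrC.
  have -> : \sum_(j < d) v j 0 ^+ 2 = inner v v by apply: eq_bigr => j _; rewrite expr2.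
  by apply: ler_piMl => //; exact: ltW.
move=> x; pose y i := a * coordn d x (i %/ N)%N.
have meanE : cube_mean (t v) y (d * N) = inner x v.
  rewrite /cube_mean (sum_divn d N (fun j => a * coordn d x j * (coordn d v j * Num.sqrt (beta / N%:R)))) //.
  rewrite mulr_sumr; apply: eq_bigr => j _; rewrite !coordn_ord.
  transitivity (N%:R * (a * Num.sqrt (beta / N%:R)) * (x j 0 * v j 0)); first by ring.
  by rewrite asq divff ?mul1r // gt_eqF.
have momE k : \sum_i cube_wt (t v) (d * N) i * (inner x (sm_point d N a i) - inner x v) ^+ k
   = cube_moment (t v) y (d * N) k.
  by rewrite /cube_moment meanE; apply: eq_bigr => c _; rewrite inner_sm_point.
have y2E : \sum_(i < d * N) y i ^+ 2 = inner x x / beta.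
  rewrite (sum_divn d N (fun j => (a * coordn d x j) ^+ 2)) // mulr_sumr /inner mulr_suml.
  apply: eq_bigr => j _; rewrite coordn_ord exprMn a2; field.
  by rewrite !gt_eqF.
have m2E : \sum_(i < d * N) y i ^+ 2 * (1 - t v i ^+ 2)
    = inner x x / beta - N%:R^-1 * \sum_(j < d) x j 0 ^+ 2 * v j 0 ^+ 2.
  rewrite -y2E; under eq_bigr do rewrite mulrBr mulr1.
  rewrite big_split /= sumrN; congr (_ - _).
  rewrite (sum_divn d N (fun j => (a * coordn d x j) ^+ 2 * (coordn d v j * Num.sqrt (beta / N%:R)) ^+ 2)) //.
  rewrite !mulr_sumr; apply: eq_bigr => j _; rewrite !coordn_ord !exprMn a2 s2; field.
  by rewrite !gt_eqF.
have xv0 : 0 <= \sum_(j < d) x j 0 ^+ 2 * v j 0 ^+ 2.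
  by apply: sumr_ge0 => j _; rewrite mulr_ge0 // sqr_ge0.
split.
- have := cube_moment1 (t v) y (d * N); rewrite -momE => h.
  apply/eqP; rewrite -subr_eq0 -[X in _ - X]mul1r -(cube_wt_sum (t v) (d * N)) mulr_suml -sumrB.
  by rewrite -[eqbRHS]h; apply/eqP/eq_bigr => i _; rewrite expr1 mulrBr.
- rewrite momE cube_moment2 m2E lerB //; apply: ler_pM => //.
  rewrite /inner; apply: ler_sum => j _; rewrite -expr2 ler_piMr ?sqr_ge0 //.
  exact: le_trans (coord_sqr_le _ _ _) v1.
- by rewrite momE cube_moment2 m2E gerBl mulr_ge0 // invr_ge0 ltW.
- by rewrite momE -y2E; apply: cube_moment4.
Qed.

End Smoothing.

(** * Products over independent samples *)

Section IndependentProducts.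
Import HBNNSimple.
Local Open Scope ereal_scope.
Context {R : realType} {dT dE : measure_display} {T : measurableType dT}
  {E : measurableType dE}.
Context (P : probability T R) (Q : probability E R).

(** Passes from indicators to nonnegative functions by monotone approximation with simple functions.
    The weight [W] stands for the factors of a product that stay fixed while one factor is
    replaced. *)
Lemma weighted_integral (W : T -> R) (Y : {RV P >-> E}) (c a : R) (g : E -> \bar R) :
  measurable_fun setT W -> (forall w, (0 <= W w)%R) ->
  (forall A, measurable A -> \int[P]_w ((W w)%:E * (\1_A (Y w))%:E) = c%:E * Q A) ->
  measurable_fun setT g -> (forall x, 0 <= g x) -> \int[Q]_x g x = a%:E ->
  \int[P]_w ((W w)%:E * g (Y w)) = (c * a)%:E.
Proof.
move=> mW W0 H mg g0 ga; have mW' : measurable_fun setT (EFin \o W) by exact/measurable_EFinP.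
pose h := nnsfun_approx measurableT mg.
have mhY k : measurable_fun setT (fun w => (h k (Y w))%:E).
  by apply/measurable_EFinP; apply: measurableT_comp.
have mind k y : measurable_fun setT (fun w => (\1_((h k) @^-1` [set y]) (Y w) : R)).
  have : measurable (Y @^-1` ((h k) @^-1` [set y])) by exact: measurable_funPTI.
  exact: measurable_indic.
have simple k : \int[P]_w ((W w)%:E * (h k (Y w))%:E) = c%:E * \int[Q]_x (h k x)%:E.
  rewrite integralT_nnsfun sintegralE.
  transitivity (\int[P]_w (\sum_(y \in range (h k))
      ((W w)%:E * (y * \1_((h k) @^-1` [set y]) (Y w))%:E))).
    apply: eq_integral => w _; rewrite fimfunE -fsumEFin // ge0_mule_fsumr // => y.
    rewrite lee_fin; case: (boolP (y \in range (h k))) => [|yN].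
      by rewrite inE => -[x _ <-]; rewrite mulr_ge0.
    rewrite indicE memNset ?mulr0 // => /= yE; move: yN; rewrite notin_setE; apply.
    by exists (Y w).
  rewrite ge0_integral_fsum //=.
  - rewrite fsbig_finite // [in RHS]fsbig_finite //= ge0_sume_distrr.
    apply: eq_big_seq => y; rewrite in_fset_set // inE => -[x _ hxy].
    have y0 : (0 <= y)%R by rewrite -hxy.
    under eq_integral do rewrite EFinM muleCA.
    rewrite ge0_integralZl //; last 2 first.
    + by apply: emeasurable_funM => //; apply/measurable_EFinP; exact: mind.
    + by move=> w _; rewrite mule_ge0 ?lee_fin ?indicE.
    + by rewrite H // muleCA.
    + by move=> y _; exact: nnsfun_mulemu_ge0.
  - move=> y; apply: emeasurable_funM => //; apply/measurable_EFinP.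
    by apply: measurable_funM => //; exact: mind.
  - move=> y w _; rewrite mule_ge0 ?lee_fin //.
    case: (boolP (y \in range (h k))) => [|yN].
      by rewrite inE => -[x _ <-]; rewrite mulr_ge0.
    rewrite indicE memNset ?mulr0 // => /= yE; move: yN; rewrite notin_setE; apply.
    by exists (Y w).
have hg x : EFin (h k x) @[k --> \oo] --> g x by apply: cvg_nnsfun_approx.
have hmono x m n : (m <= n)%N -> (h m x <= h n x)%R.
  by move=> mn; exact/lefP/nd_nnsfun_approx.
have lim1 : \int[Q]_x (h k x)%:E @[k --> \oo] --> \int[Q]_x g x.
  rewrite (eq_integral (fun x => limn (fun k => (h k x)%:E))).
    apply: cvg_monotone_convergence => //.
    - by move=> k; apply/measurable_EFinP.
    - by move=> k x _; rewrite lee_fin.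
    - by move=> x _ m n mn; rewrite lee_fin hmono.
  by move=> x _; apply/esym/cvg_lim.
have lim2 : \int[P]_w ((W w)%:E * (h k (Y w))%:E) @[k --> \oo]
    --> \int[P]_w ((W w)%:E * g (Y w)).
  rewrite (eq_integral (fun w => limn (fun k => (W w)%:E * (h k (Y w))%:E))).
    apply: cvg_monotone_convergence => //.
    - by move=> k; apply: emeasurable_funM.
    - by move=> k x _; rewrite mule_ge0 ?lee_fin.
    - by move=> w _ m n mn; apply: lee_wpmul2l; rewrite lee_fin ?W0 ?hmono.
  by move=> w _; apply/esym/cvg_lim => //; apply: cvgeZl.
have lim3 : \int[P]_w ((W w)%:E * (h k (Y w))%:E) @[k --> \oo] --> c%:E * a%:E.
  under eq_fun do rewrite simple.
  by rewrite -ga; apply: cvgeZl.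
by rewrite EFinM; apply: (cvg_unique _ lim2 lim3).
Qed.

(** Indicators are replaced by [g] one index at a time, starting from mutual independence. The sets
    [A] stay universally quantified in the induction, since replacing an index uses the previous
    step for every choice of the set at that index. *)
Lemma integral_prod_iid n (X : 'I_n -> {RV P >-> E}) (g : E -> R) (a : R) :
  mutually_independent X ->
  (forall i A, measurable A -> distribution P (X i) A = Q A) ->
  measurable_fun setT g -> (forall x, (0 <= g x)%R) -> \int[Q]_x (g x)%:E = a%:E ->
  \int[P]_w (\prod_(i < n) g (X i w))%:E = (a ^+ n)%:E.
Proof.
move=> indX lawX mg g0 ga.
pose G (A : 'I_n -> set E) j (i : 'I_n) (w : T) : R :=
  if (i < j)%N then g (X i w) else \1_(A i) (X i w).
have mG A j i : (forall i, measurable (A i)) -> measurable_fun setT (G A j i).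
  move=> mA; have [ij | /negbTE ij] := boolP (i < j)%N; rewrite /G ij.
    by apply: (measurableT_comp mg).
  have : measurable (X i @^-1` (A i)) by exact: measurable_funPTI.
  exact: measurable_indic.
have G0 A j i w : (0 <= G A j i w)%R by rewrite /G; case: ifP => // _; rewrite indicE.
pose q (A : 'I_n -> set E) j (i : 'I_n) : R := if (i < j)%N then a else fine (Q (A i)).
have main j A : (j <= n)%N -> (forall i, measurable (A i)) ->
    \int[P]_w (\prod_i G A j i w)%:E = (\prod_i q A j i)%:E.
  elim: j A => [|j IH] A jn mA.
    transitivity (\int[P]_w (\1_(\bigcap_(i in [set` [set: 'I_n]%SET]) (X i @^-1` A i)) w)%:E).
      apply: eq_integral => w _; congr EFin; rewrite /G /= indicE.
      case: (boolP (w \in _)) => [|].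
        rewrite inE => h; apply: big1 => i _; rewrite indicE mem_set //.
        by apply: h; rewrite /= inE.
      rewrite notin_setE => h; apply/eqP; rewrite prodf_seq_eq0; apply/hasP.
      have [i hi] : exists i, ~ A i (X i w).
        apply: contrapT => hh; apply: h => i _ /=; apply: contrapT => hA.
        by apply: hh; exists i.
      by exists i; [rewrite mem_index_enum | rewrite /= indicE memNset].
    rewrite integral_indic //; last first.
      apply: fin_bigcap_measurable => [|i _]; [exact: finite_finset|exact: measurable_funPTI].
    rewrite setIT; apply: (etrans (indX [set: 'I_n]%SET A mA)).
    transitivity (\prod_(i < n) (q A 0 i)%:E); last by rewrite prodEFin.
    apply: eq_big => [i|i _]; first by rewrite inE.
    rewrite /q /= fineK; first exact: lawX.
    exact: fin_num_measure.
  pose o := Ordinal jn.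
  rewrite (bigD1 o) //= [q A j.+1 o]/q ltnSn mulrC.
  have W0 w : (0 <= \prod_(i | i != o) G A j.+1 i w)%R by apply: prodr_ge0.
  rewrite -(@weighted_integral (fun w => \prod_(i | i != o) G A j.+1 i w)%R (X o)
    (\prod_(i | i != o) q A j.+1 i)%R a (EFin \o g)) //; first last.
  - exact/measurable_EFinP.
  - move=> B mB.
    pose A' i := if i == o then B else A i.
    have mA' i : measurable (A' i) by rewrite /A'; case: ifP.
    have ij i : i != o -> (i < j.+1)%N = (i < j)%N.
      move=> io; rewrite ltnS leq_eqVlt orbC; case: ltnP => //= ji.
      apply/negbTE; apply: contraNN io => /eqP e; apply/eqP/val_inj; exact: e.
    have -> : Q B = (fine (Q B))%:E by rewrite fineK // fin_num_measure.
    rewrite -EFinM [in RHS]mulrC.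
    have <- : (\prod_i q A' j i = fine (Q B) * \prod_(i | i != o) q A j.+1 i)%R.
      rewrite (bigD1 o) //=; congr (_ * _)%R; first by rewrite /q ltnn /A' eqxx.
      by apply: eq_bigr => i io; rewrite /q /A' (negbTE io) ij.
    rewrite -(IH A' (ltnW jn) mA'); apply: eq_integral => w _.
    rewrite [in RHS](bigD1 o) //= [X in (X * _)%R](_ : _ = \1_B (X o w)) //; last first.
      by rewrite /G ltnn /A' eqxx.
    rewrite EFinM muleC; congr (_ * _); congr EFin.
    by apply: eq_bigr => i io; rewrite /G /A' (negbTE io) ij.
  - under eq_fun do rewrite -big_filter.
    by apply: measurable_prod => i _; exact: mG.
  apply: eq_integral => w _; rewrite (bigD1 o) //= [G A j.+1 o w]/G ltnSn.
  by rewrite mulrC EFinM.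
have := main n (fun=> setT) (leqnn n) (fun=> measurableT).
rewrite [X in _ = X%:E -> _](_ : _ = a ^+ n)%R.
  move=> <-; apply: eq_integral => w _; congr EFin; apply: eq_bigr => i _.
  by rewrite /G ltn_ord.
rewrite (eq_bigr (fun=> a)); first by rewrite prodr_const card_ord.
by move=> i _; rewrite /q ltn_ord.
Qed.

End IndependentProducts.

(** * The PAC-Bayes inequality *)

Section HighProbability.
Context {R : realType} {dT : measure_display} {T : measurableType dT}.
Context (P : probability T R).

(** Many events below are intersections over uncountably many directions, so the bound is put on the
    complement of a measurable subset. *)
Definition whp (e : R) (S : set T) : Prop :=
  exists2 H, measurable H & H `<=` S /\ (P (~` H) <= e%:E)%E.

Lemma whp_sub e S S' : S `<=` S' -> whp e S -> whp e S'.
Proof. by move=> SS' [H mH [HS PH]]; exists H => //; split=> // w /HS /SS'. Qed.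

Lemma whp_le e e' S : e <= e' -> whp e S -> whp e' S.
Proof.
by move=> ee' [H mH [HS PH]]; exists H => //; split=> //; apply: le_trans PH _; rewrite lee_fin.
Qed.

Lemma whp_setI e e' S S' : whp e S -> whp e' S' -> whp (e + e') (S `&` S').
Proof.
move=> [H mH [HS PH]] [H' mH' [HS' PH']]; exists (H `&` H'); first exact: measurableI.
split; first by move=> w [/HS ? /HS' ?].
rewrite setCI EFinD; apply: le_trans (leeD PH PH').
by apply: measureU2; exact: measurableC.
Qed.

Lemma whpT : whp 0 setT.
Proof. by exists setT => //; split=> //; rewrite setCT measure0. Qed.

Lemma whp_forall N (e : nat -> R) (S : nat -> set T) :
  (forall m, whp (e m) (S m)) ->
  whp (\sum_(m < N) e m) [set w | forall m, (m < N)%N -> S m w].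
Proof.
move=> h; elim: N => [|N IH].
  by rewrite big_ord0; apply: whp_sub whpT => w _ m.
rewrite big_ord_recr /=; apply: whp_sub (whp_setI _ _ _ _ IH (h N)) => w [h1 h2] m /=.
by rewrite ltnS leq_eqVlt => /predU1P[->//|/h1].
Qed.

End HighProbability.

Section PacBayes.
Context {R : realType}.

(* Jensen's inequality for the logarithm, in the form of the variational
   characterisation of the relative entropy. *)
Lemma gibbs_variational (Theta : finType) (rho L : Theta -> R) :
  (0 < #|Theta|)%N -> (forall i, 0 <= rho i) -> \sum_i rho i = 1 ->
  \sum_i rho i * L i <= ln (\sum_i #|Theta|%:R^-1 * expR (L i))
                        + \sum_i rho i * ln (rho i * #|Theta|%:R).
Proof.
move=> T0 rho0 rho1; set N : R := #|Theta|%:R.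
have N0 : 0 < N by rewrite ltr0n.
set S := \sum_i N^-1 * expR (L i).
have S0 : 0 < S.
  case/card_gt0P: T0 => i _; rewrite /S (bigD1 i) //= ltr_wpDr //.
    by apply: sumr_ge0 => j _; rewrite mulr_ge0 ?invr_ge0 ?ltW ?expR_gt0.
  by rewrite mulr_gt0 ?invr_gt0 ?expR_gt0.
rewrite -subr_le0 opprD addrA -[ln S]mul1r -rho1 mulr_suml -!sumrB.
rewrite [leRHS](_ : 0 = \sum_i (N^-1 * expR (L i) / S - rho i)); last first.
  by rewrite sumrB rho1 -mulr_suml divff ?subrr // gt_eqF.
apply: ler_sum => i _; have := rho0 i; rewrite le_eqVlt => /predU1P[<-|r0].
  by rewrite !mul0r !subr0 !mulr_ge0 ?invr_ge0 ?(ltW S0) ?(ltW N0) ?expR_ge0.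
have rN : 0 < rho i * N by rewrite mulr_gt0.
have -> : N^-1 * expR (L i) / S = rho i * expR (L i - ln (rho i * N) - ln S).
  rewrite !expRD !expRN !lnK ?posrE //; field.
  by rewrite !gt_eqF.
have := expR_ge1Dx (L i - ln (rho i * N) - ln S); nra.
Qed.

Context {dT dE : measure_display} {T : measurableType dT} {E : measurableType dE}.
Context (P : probability T R) (Q : probability E R).

Definition iid_law n (X : 'I_n -> {RV P >-> E}) : Prop :=
  mutually_independent X /\
  forall i A, measurable A -> distribution P (X i) A = Q A.

(** The uniform average over [Theta] of the normalised exponentials has expectation at most 1, so
    Markov's inequality bounds it by [expR t]. On this single event [gibbs_variational] yields the
    inequality for all [rho] at once. *)
Lemma pac_bayes n (X : 'I_n -> {RV P >-> E}) (Theta : finType) (f : Theta -> E -> R)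
    (c : Theta -> R) (t : R) :
  iid_law n X -> (0 < #|Theta|)%N -> (forall i, measurable_fun setT (f i)) ->
  (forall i, \int[Q]_x (expR (f i x))%:E <= (expR (c i))%:E)%E ->
  whp P (expR (- t)) [set w | forall rho : Theta -> R,
    (forall i, 0 <= rho i) -> \sum_i rho i = 1 ->
    \sum_i rho i * (\sum_(j < n) f i (X j w)) <=
      n%:R * (\sum_i rho i * c i) + \sum_i rho i * ln (rho i * #|Theta|%:R) + t].
Proof.
move=> [indX lawX] T0 mf fc.
have N0 : 0 < #|Theta|%:R :> R by rewrite ltr0n.
pose Z i w := expR (\sum_(j < n) f i (X j w) - n%:R * c i).
pose S w := \sum_i #|Theta|%:R^-1 * Z i w.
have mZ i : measurable_fun setT (Z i).
  apply: measurableT_comp => //; apply: measurable_funB => //.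
  by apply: measurable_sum => j; apply: measurableT_comp.
have mS : measurable_fun setT S.
  by apply: measurable_sum => i; apply: measurable_funM.
have Z1 i : (\int[P]_w (Z i w)%:E <= 1)%E.
  set a := fine (\int[Q]_x (expR (f i x))%:E)%E.
  have fin : (\int[Q]_x (expR (f i x))%:E = a%:E)%E.
    rewrite /a fineK // ge0_fin_numE; last by apply: integral_ge0 => x _; rewrite lee_fin expR_ge0.
    by apply: le_lt_trans (fc i) _; rewrite ltry.
  have h : (\int[P]_w (\prod_(j < n) expR (f i (X j w)))%:E = (a ^+ n)%:E)%E.
    apply: (integral_prod_iid P Q n X (fun x => expR (f i x)) a indX lawX _ _ fin).
      exact: measurableT_comp.
    by move=> x; exact: expR_ge0.
  have -> : (\int[P]_w (Z i w)%:E = (expR (c i) ^- n * a ^+ n)%:E)%E.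
    rewrite EFinM -h.
    rewrite -ge0_integralZl //.
    - apply: eq_integral => w _; rewrite -EFinM; congr EFin.
      rewrite /Z expRD mulrC; congr (_ * _); first by rewrite expRN -expRM_natl.
      by rewrite expR_sum.
    - apply/measurable_EFinP; apply: measurable_prod => j _.
      by apply: measurableT_comp => //; apply: measurableT_comp.
    - by move=> w _; rewrite lee_fin prodr_ge0 // => j _; exact: expR_ge0.
  rewrite lee_fin mulrC ler_pdivrMr ?exprn_gt0 ?expR_gt0 // mul1r.
  apply: lerXn2r; rewrite ?nnegrE ?expR_ge0 //.
    by rewrite -lee_fin -fin; apply: integral_ge0 => x _; rewrite lee_fin expR_ge0.
  by rewrite -lee_fin -fin.
have S1 : (\int[P]_w (S w)%:E <= 1)%E.
  under eq_integral do rewrite /S -sumEFin.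
  rewrite ge0_integral_sum //; first last.
  - by move=> i w _; rewrite lee_fin mulr_ge0 ?invr_ge0 ?(ltW N0) // expR_ge0.
  - by move=> i; apply/measurable_EFinP; apply: measurable_funM.
  apply: (@le_trans _ _ (\sum_(i : Theta) (#|Theta|%:R^-1 : R)%:E)%E).
    apply: lee_sum => i _; under eq_integral do rewrite EFinM.
    rewrite ge0_integralZl //; first last.
    - by move=> w _; rewrite lee_fin expR_ge0.
    - exact/measurable_EFinP.
    rewrite -[leRHS]mule1; apply: lee_wpmul2l; last exact: Z1.
    by rewrite lee_fin invr_ge0 ltW.
  by rewrite sumEFin sumr_const -[_ *+ _]mulr_natl divff ?gt_eqF.
have mH : measurable [set w | S w <= expR t].
  have -> : [set w | S w <= expR t] = S @^-1` [set` `]-oo, expR t]].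
    by apply/seteqP; split=> w /=; rewrite in_itv.
  by rewrite -[X in measurable X]setTI; apply: mS.
exists [set w | S w <= expR t] => //; split.
  move=> w Sw rho rho0 rho1.
  have := gibbs_variational Theta rho (fun i => \sum_(j < n) f i (X j w) - n%:R * c i) T0 rho0 rho1.
  have : ln (S w) <= t.
    have S0 : 0 < S w.
      case/card_gt0P: (T0) => i _; rewrite /S (bigD1 i) //= ltr_wpDr //.
        by apply: sumr_ge0 => j _; rewrite mulr_ge0 ?invr_ge0 ?(ltW N0) ?expR_ge0.
      by rewrite mulr_gt0 ?invr_gt0 ?expR_gt0.
    by rewrite -[leRHS]expRK ler_ln ?posrE ?expR_gt0.
  rewrite /S /Z => h1 h2.
  have e : \sum_i rho i * (\sum_(j < n) f i (X j w) - n%:R * c i)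
     = \sum_i rho i * (\sum_(j < n) f i (X j w)) - n%:R * \sum_i rho i * c i.
    by rewrite mulr_sumr -sumrB; apply: eq_bigr => i _; ring.
  by rewrite e in h2; lra.
have mHc : measurable (~` [set w | S w <= expR t]) by exact: measurableC.
have h : ((expR t)%:E * P (~` [set w | (S w <= expR t)%R]) <= \int[P]_w (S w)%:E)%E.
  rewrite -[X in (_ * P X)%E]setIT -(integral_indic _ measurableT mHc).
  have mI : measurable_fun setT (fun w => (\1_(~` [set w | (S w <= expR t)%R]) w : R)%:E).
    by apply/measurable_EFinP; apply: measurable_indic; exact: measurableC.
  rewrite -ge0_integralZl // ?lee_fin ?expR_ge0 //.
  apply: ge0_le_integral => //.
  - exact: emeasurable_funM.
  - exact/measurable_EFinP.
  - move=> w _; rewrite -EFinM lee_fin indicE; case: (boolP (w \in _)) => [|_].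
      by rewrite inE /= mulr1 => /negP; rewrite -ltNge => /ltW.
    rewrite mulr0; apply: sumr_ge0 => i _.
    by rewrite mulr_ge0 ?invr_ge0 ?(ltW N0) ?expR_ge0.
rewrite -(@lee_pmul2l R (expR t)%:E) ?lte_fin ?expR_gt0 //.
by rewrite -EFinM -expRD subrr expR0; apply: le_trans h S1.
Qed.

End PacBayes.

(** * Expectations of functions of moderate growth *)

Section VectorFacts.
Context {R : realType} {d : nat}.
Implicit Types u v w x : 'cV[R]_d.

Lemma innerC u v : inner u v = inner v u.
Proof. by apply: eq_bigr => i _; rewrite mulrC. Qed.

Lemma innerDl u v w : inner (u + v) w = inner u w + inner v w.
Proof. by rewrite -big_split; apply: eq_bigr => i _; rewrite mxE mulrDl. Qed.

Lemma innerZl a u w : inner (a *: u) w = a * inner u w.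
Proof. by rewrite mulr_sumr; apply: eq_bigr => i _; rewrite mxE mulrA. Qed.

Lemma innerNl u w : inner (- u) w = - inner u w.
Proof. by rewrite -scaleN1r innerZl mulN1r. Qed.

Lemma innerBl u v w : inner (u - v) w = inner u w - inner v w.
Proof. by rewrite innerDl innerNl. Qed.

Lemma innerDr u v w : inner w (u + v) = inner w u + inner w v.
Proof. by rewrite innerC innerDl !(innerC w). Qed.

Lemma innerZr a u w : inner w (a *: u) = a * inner w u.
Proof. by rewrite innerC innerZl innerC. Qed.

Lemma innerNr u w : inner w (- u) = - inner w u.
Proof. by rewrite innerC innerNl innerC. Qed.

Lemma innerBr u v w : inner w (u - v) = inner w u - inner w v.
Proof. by rewrite innerDr innerNr. Qed.

Lemma inner0l u : inner 0 u = 0.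
Proof. by rewrite -(scale0r 0) innerZl mul0r. Qed.

Lemma inner0r u : inner u 0 = 0.
Proof. by rewrite innerC inner0l. Qed.

Lemma inner_ge0 u : 0 <= inner u u.
Proof. by apply: sumr_ge0 => i _; rewrite -expr2 sqr_ge0. Qed.

Lemma inner_eq0 u : inner u u = 0 -> u = 0.
Proof.
move=> /eqP; rewrite psumr_eq0 => [/allP h|i _]; last by rewrite -expr2 sqr_ge0.
apply/colP => i; rewrite mxE; apply/eqP; have := h i (mem_index_enum i).
by rewrite /= -expr2 sqrf_eq0.
Qed.

Lemma inner_sqr_le u v : inner u v ^+ 2 <= inner u u * inner v v.
Proof.
have [/inner_eq0 ->|v0] := eqVneq (inner v v) 0.
  by rewrite !inner0r expr0n mulr0.
have vp : 0 < inner v v by rewrite lt_def v0 inner_ge0.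
have := inner_ge0 (inner v v *: u - inner u v *: v).
rewrite !innerBl !innerZl !innerBr !innerZr (innerC v u) => h.
have : 0 <= inner v v * (inner u u * inner v v - inner u v ^+ 2) by move: h; lra.
by rewrite pmulr_rge0 // subr_ge0.
Qed.

Lemma inner_delta u i : inner u (delta_mx i 0) = u i 0.
Proof.
rewrite /inner (bigD1 i) //= mxE !eqxx mulr1 big1 ?addr0 // => j ji.
by rewrite mxE (negbTE ji) mulr0.
Qed.

Lemma enorm_sqr u : enorm u ^+ 2 = inner u u.
Proof. by rewrite sqr_sqrtr // inner_ge0. Qed.

Lemma enorm_ge0 u : 0 <= enorm u.
Proof. exact: sqrtr_ge0. Qed.

Lemma enorm_le1 u : (enorm u <= 1) = (inner u u <= 1).
Proof. by rewrite -(@ler_pXn2r _ 2) ?nnegrE ?enorm_ge0 // enorm_sqr expr1n. Qed.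

End VectorFacts.

Section Law.
Context {R : realType} {d : nat}.
Implicit Types (g h : 'cV[R]_d -> R).

Lemma measurable_coord m k (i : 'I_m) (j : 'I_k) :
  measurable_fun setT (fun M : 'M[R]_(m, k) => M i j).
Proof.
move=> _ B mB; rewrite setTI; apply: sub_sigma_algebra.
by exists i, j, B.
Qed.

Lemma measurable_inner v : measurable_fun setT (fun x : 'cV[R]_d => inner x v).
Proof.
apply: measurable_sum => i; apply: measurable_funM => //.
exact: measurable_coord.
Qed.

Lemma measurable_inner2 : measurable_fun setT (fun x : 'cV[R]_d => inner x x).
Proof. by apply: measurable_sum => i; apply: measurable_funM; exact: measurable_coord. Qed.

(** Quartic growth is what a finite fourth moment integrates. The class is stable under the
    operations used below, so integrability is settled once. *)
Definition mgrowth g : Prop :=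
  measurable_fun setT g /\ exists c, forall x, `|g x| <= c * (1 + inner x x ^+ 2).

Lemma mgrowthD g h : mgrowth g -> mgrowth h -> mgrowth (fun x => g x + h x).
Proof.
move=> [mg [a ag]] [mh [b bh]]; split; first exact: measurable_funD.
exists (a + b) => x; rewrite mulrDl; apply: le_trans (ler_normD _ _) _.
exact: lerD.
Qed.

Lemma mgrowthZ c g : mgrowth g -> mgrowth (fun x => c * g x).
Proof.
move=> [mg [a ag]]; split; first exact: measurable_funM.
by exists (`|c| * a) => x; rewrite normrM -mulrA ler_wpM2l.
Qed.

Lemma mgrowthN g : mgrowth g -> mgrowth (fun x => - g x).
Proof.
move=> [mg [a ag]]; split; first exact: measurable_funN.
by exists a => x; rewrite normrN.
Qed.

Lemma mgrowthB g h : mgrowth g -> mgrowth h -> mgrowth (fun x => g x - h x).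
Proof. by move=> mg mh; apply: mgrowthD => //; exact: mgrowthN. Qed.

Lemma mgrowth_cst c : mgrowth (fun=> c).
Proof.
split; first exact: measurable_cst.
by exists `|c| => x; rewrite ler_peMr // lerDl sqr_ge0.
Qed.

Lemma mgrowth_sum (I : finType) (G : I -> 'cV[R]_d -> R) :
  (forall i, mgrowth (G i)) -> mgrowth (fun x => \sum_i G i x).
Proof.
move=> mG; split; first by apply: measurable_sum => i; case: (mG i).
have /choice[c hc] : forall i, exists c, forall x, `|G i x| <= c * (1 + inner x x ^+ 2).
  by move=> i; case: (mG i).
exists (\sum_i c i) => x; rewrite mulr_suml; apply: le_trans (ler_norm_sum _ _ _) _.
by apply: ler_sum => i _; exact: hc.
Qed.

Lemma mgrowth_le g h : measurable_fun setT g -> (forall x, `|g x| <= h x) ->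
  mgrowth h -> mgrowth g.
Proof.
move=> mg gh [mh [c hc]]; split=> //; exists c => x.
apply: le_trans (gh x) _; apply: le_trans (hc x); exact: ler_norm.
Qed.

Lemma mgrowth_norm2 : mgrowth (fun x => inner x x).
Proof.
split; first exact: measurable_inner2.
exists 1 => x; rewrite ger0_norm ?inner_ge0 // mul1r.
have := inner_ge0 x; nra.
Qed.

Lemma mgrowth_norm4 : mgrowth (fun x => inner x x ^+ 2).
Proof.
split; first by apply: measurable_funX; exact: measurable_inner2.
by exists 1 => x; rewrite ger0_norm ?sqr_ge0 // mul1r lerDr.
Qed.

Lemma mgrowth_inner2 v : mgrowth (fun x => inner x v ^+ 2).
Proof.
apply: (@mgrowth_le _ (fun x => inner v v * inner x x)).
- by apply: measurable_funX; exact: measurable_inner.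
- by move=> x; rewrite ger0_norm ?sqr_ge0 // mulrC inner_sqr_le.
- by apply: mgrowthZ; exact: mgrowth_norm2.
Qed.

Lemma mgrowth_inner4 v : mgrowth (fun x => inner x v ^+ 4).
Proof.
apply: (@mgrowth_le _ (fun x => inner v v ^+ 2 * inner x x ^+ 2)).
- by apply: measurable_funX; exact: measurable_inner.
- move=> x; rewrite (_ : 4 = 2 * 2)%N // exprM ger0_norm ?sqr_ge0 // -exprMn.
  rewrite lerXn2r ?nnegrE ?sqr_ge0 ?mulr_ge0 ?inner_ge0 //.
  by rewrite mulrC inner_sqr_le.
- by apply: mgrowthZ; exact: mgrowth_norm4.
Qed.

Lemma mgrowth_mul g h : mgrowth (fun x => g x ^+ 2) -> mgrowth (fun x => h x ^+ 2) ->
  measurable_fun setT g -> measurable_fun setT h -> mgrowth (fun x => g x * h x).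
Proof.
move=> g2 h2 mg mh; apply: (@mgrowth_le _ (fun x => g x ^+ 2 + h x ^+ 2)).
- exact: measurable_funM.
- move=> x; rewrite ler_norml; apply/andP; split.
    by have := sqr_ge0 (g x + h x); have := sqr_ge0 (g x); have := sqr_ge0 (h x); nra.
  by have := sqr_ge0 (g x - h x); have := sqr_ge0 (g x); have := sqr_ge0 (h x); nra.
- exact: mgrowthD.
Qed.

Lemma mgrowth_bounded g c : measurable_fun setT g -> (forall x, `|g x| <= c) -> mgrowth g.
Proof. by move=> mg gc; apply: (mgrowth_le _ (fun=> c)) => //; exact: mgrowth_cst. Qed.

Context (Q : probability 'cV[R]_d R).
Definition fourth_moment_finite : Prop :=
  (\int[Q]_x (inner x x ^+ 2)%:E < +oo)%E.
Hypothesis Q4 : fourth_moment_finite.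

Definition Ex g : R := \int[Q]_x g x.

Lemma growth_integrable : Q.-integrable setT (EFin \o (fun x : 'cV[R]_d => 1 + inner x x ^+ 2)).
Proof.
have m4 : measurable_fun setT (fun x : 'cV[R]_d => inner x x ^+ 2).
  by apply: measurable_funX; exact: measurable_inner2.
have -> : (EFin \o (fun x : 'cV[R]_d => 1 + inner x x ^+ 2))
   = (cst 1%:E \+ (fun x => (inner x x ^+ 2)%:E))%E.
  by apply/funext => x.
apply: integrableD => //.
  by apply: finite_measure_integrable_cst.
apply/integrableP; split; first exact/measurable_EFinP.
rewrite (eq_integral (fun x : 'cV[R]_d => (inner x x ^+ 2)%:E)) //.
by move=> x _; rewrite /= ger0_norm // sqr_ge0.
Qed.

Lemma mgrowth_integrable g : mgrowth g -> Q.-integrable setT (EFin \o g).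
Proof.
move=> [mg [c gc]].
apply: (@le_integrable _ _ _ Q setT measurableT _ (EFin \o (fun x => c * (1 + inner x x ^+ 2)))).
- exact/measurable_EFinP.
- move=> x _; rewrite /= lee_fin; apply: le_trans (gc x) _; exact: ler_norm.
- have -> : EFin \o (fun x : 'cV[R]_d => c * (1 + inner x x ^+ 2)) =
    (fun x => c%:E * (EFin \o (fun x : 'cV[R]_d => (1 + inner x x ^+ 2)%R)) x)%E.
    by apply/funext => x.
  by apply: integrableZl => //; exact: growth_integrable.
Qed.

Lemma ExD g h : mgrowth g -> mgrowth h -> Ex (fun x => g x + h x) = Ex g + Ex h.
Proof. by move=> mg mh; apply: RintegralD => //; exact: mgrowth_integrable. Qed.

Lemma ExZ c g : mgrowth g -> Ex (fun x => c * g x) = c * Ex g.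
Proof. by move=> mg; apply: RintegralZl => //; exact: mgrowth_integrable. Qed.

Lemma ExB g h : mgrowth g -> mgrowth h -> Ex (fun x => g x - h x) = Ex g - Ex h.
Proof. by move=> mg mh; apply: RintegralB => //; exact: mgrowth_integrable. Qed.

Lemma Ex_cst c : Ex (fun=> c) = c.
Proof.
rewrite /Ex Rintegral_cst //.
by rewrite [X in c * fine X](_ : _ = 1%E) ?mulr1 //; exact: probability_setT.
Qed.

Lemma Ex_le g h : mgrowth g -> mgrowth h -> (forall x, g x <= h x) -> Ex g <= Ex h.
Proof. by move=> mg mh gh; apply: le_Rintegral => //; exact: mgrowth_integrable. Qed.

Lemma Ex_ge0 g : (forall x, 0 <= g x) -> 0 <= Ex g.
Proof. by move=> g0; apply: Rintegral_ge0. Qed.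

Lemma Ex_sum (I : finType) (G : I -> 'cV[R]_d -> R) :
  (forall i, mgrowth (G i)) -> Ex (fun x => \sum_i G i x) = \sum_i Ex (G i).
Proof.
move=> mG.
suff h r : mgrowth (fun x => \sum_(i <- r) G i x) /\
    Ex (fun x => \sum_(i <- r) G i x) = \sum_(i <- r) Ex (G i) by case: (h (index_enum I)).
elim: r => [|i r [IH1 IH2]].
  rewrite big_nil (_ : (fun x => _) = (fun=> 0)); last by apply/funext => x; rewrite big_nil.
  by rewrite Ex_cst; split=> //; exact: mgrowth_cst.
rewrite big_cons (_ : (fun x => _) = (fun x => G i x + \sum_(j <- r) G j x)); last first.
  by apply/funext => x; rewrite big_cons.
by rewrite ExD // IH2; split=> //; exact: mgrowthD.
Qed.

Lemma Ex_EFin g : mgrowth g -> (\int[Q]_x (g x)%:E)%E = (Ex g)%:E.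
Proof.
move=> mg; rewrite /Ex /Rintegral fineK //.
by apply: integrable_fin_num => //; exact: mgrowth_integrable.
Qed.

End Law.

(** * Uniform concentration over the unit ball *)

Section Elementary.
Context {R : realType}.

Lemma expR_le_chord (u : R) : 0 <= u <= 1 -> expR u <= 1 + 3 * u.
Proof.
move=> u01; have h := expR_ge1Dx (- (u / 2)); have p := expR_gt0 (- (u / 2)).
have e : expR u * expR (- (u / 2)) ^+ 2 = 1.
  by rewrite -expRM_natl -expRD -[RHS]expR0; congr expR; field.
have h2 : (1 - u / 2) ^+ 2 <= expR (- (u / 2)) ^+ 2 by rewrite lerXn2r ?nnegrE; lra.
have h3 : 1 <= (1 + 3 * u) * (1 - u / 2) ^+ 2.
  have : 0 <= u * (1 - u) * (2 - 3 / 4 * u) by rewrite !mulr_ge0 //; lra.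
  by lra.
have h4 : 0 < expR (- (u / 2)) ^+ 2 by rewrite exprn_gt0.
rewrite -(ler_pM2r h4) e; apply: le_trans h3 _; rewrite ler_wpM2l //; lra.
Qed.

Lemma expRN_le_chord (u : R) : 0 <= u <= 1 -> expR (- u) <= 1 - u / 2.
Proof.
move=> u01; have h := expR_ge1Dx u; have p := expR_gt0 u.
rewrite expRN -[leLHS]mul1r ler_pdivrMr //; nra.
Qed.

(** From [1 - u + u^2 <= expR (- u + u^2)] and [(1 + u + u^2) (1 - u + u^2) = 1 + u^2 + u^4 >= 1].
    This is an influence function in the style of Catoni: its exponential is a quadratic polynomial,
    so that two moments of [u], hence four of the data, control the exponential moment. *)
Lemma ln_quadratic_ge (u : R) : u - u ^+ 2 <= ln (1 + u + u ^+ 2).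
Proof.
have p : 0 < 1 + u + u ^+ 2 by have := sqr_ge0 (u + 1 / 2); lra.
have q : 0 < 1 - u + u ^+ 2 by have := sqr_ge0 (u - 1 / 2); lra.
rewrite -[leLHS]expRK ler_ln ?posrE ?expR_gt0 //.
have := expR_ge1Dx (- (u - u ^+ 2)); rewrite expRN => h.
have h2 : expR (u - u ^+ 2) <= (1 - u + u ^+ 2)^-1.
  rewrite -[leLHS]invrK lef_pV2 ?posrE ?invr_gt0 ?expR_gt0 //; lra.
apply: le_trans h2 _; rewrite -[leLHS]mul1r ler_pdivrMr //.
have := sqr_ge0 u; have := sqr_ge0 (u ^+ 2); lra.
Qed.

Lemma ln_quadratic_geN1 (u : R) : - 1 <= ln (1 + u + u ^+ 2).
Proof.
have p : 3 / 4 <= 1 + u + u ^+ 2 by have := sqr_ge0 (u + 1 / 2); lra.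
have e : expR (- 1) <= 3 / 4 :> R.
  by have := @expRN_le_chord 1 _; rewrite ler01 lexx => /(_ isT); lra.
rewrite -[leLHS]expRK ler_ln ?posrE ?expR_gt0 //; lra.
Qed.

(* Only directions theta with |theta - v| small compared to |v|, tested
   against x, count; all others are absorbed by the last term. *)
Lemma smoothing_majorant (d : nat) (beta e : R) (Theta : finType)
    (th : Theta -> 'cV[R]_d) (rho : 'cV[R]_d -> Theta -> R) (psi : R -> R)
    (G : pred Theta) (v x : 'cV[R]_d) :
  0 < beta -> smoothing d beta e Theta th rho -> inner v v <= 1 ->
  (forall u, 0 <= u -> 0 <= psi u) -> (forall u u' : R, 0 <= u <= u' -> psi u <= psi u') ->
  7 / 8 <= \sum_i rho v i * (G i)%:R ->
  psi (inner x v ^+ 2) <=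
    2 * (\sum_i rho v i * ((G i)%:R * psi (4 * inner x (th i) ^+ 2)))
    + psi (16 * (inner x x / beta)).
Proof.
move=> b0 sm v1 psi0 psim hG; have [rho0 rho1 _ /(_ x)[mean1 _ var _]] := sm v v1.
have S0 : 0 <= \sum_i rho v i * ((G i)%:R * psi (4 * inner x (th i) ^+ 2)).
  by apply: sumr_ge0 => i _; rewrite !mulr_ge0 // psi0 // mulr_ge0 // sqr_ge0.
set a := inner x v in mean1 var *; set bb := inner x x / beta in var *.
have bb0 : 0 <= bb by rewrite divr_ge0 ?inner_ge0 // ltW.
have [ab|ab] := leP (a ^+ 2) (16 * bb).
  have := psi0 _ (sqr_ge0 a); have := psi0 (16 * bb); rewrite mulr_ge0 // => /(_ isT).
  by have := psim (a ^+ 2) (16 * bb); rewrite sqr_ge0 ab => /(_ isT); lra.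
have a2 : 0 < a ^+ 2 by lra.
have : \sum_i rho v i * (psi (a ^+ 2) * ((G i)%:R - 4 * (inner x (th i) - a) ^+ 2 / a ^+ 2))
   <= \sum_i rho v i * ((G i)%:R * psi (4 * inner x (th i) ^+ 2)).
  apply: ler_sum => i _; rewrite ler_wpM2l //.
  have [far|near_] := leP (a ^+ 2) (4 * (inner x (th i) - a) ^+ 2).
    apply: (@le_trans _ _ 0); last by rewrite mulr_ge0 // psi0 // mulr_ge0 // sqr_ge0.
    rewrite mulr_ge0_le0 ?psi0 ?sqr_ge0 // subr_le0; apply: (@le_trans _ _ 1); first by case: (G i).
    by rewrite ler_pdivlMr // mul1r.
  have m : psi (a ^+ 2) <= psi (4 * inner x (th i) ^+ 2).
    apply: psim; rewrite sqr_ge0 /=.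
    set y := inner x (th i) in near_ *.
    have /ler_normlP[] : `|2 * (y - a)| <= `|a|.
      rewrite -(@ler_pXn2r _ 2) ?nnegrE // !real_normK ?num_real //.
      by rewrite exprMn; lra.
    case: (lerP 0 a) => sa; [rewrite ger0_norm // | rewrite ltr0_norm //]; nra.
  have := psi0 _ (sqr_ge0 a); set q := 4 * (inner x (th i) - a) ^+ 2 / a ^+ 2.
  have q0 : 0 <= q.
    by apply: divr_ge0; [apply: mulr_ge0 => //; exact: sqr_ge0 | exact: sqr_ge0].
  by case: (G i) => /=; nra.
have -> : \sum_i rho v i * (psi (a ^+ 2) * ((G i)%:R - 4 * (inner x (th i) - a) ^+ 2 / a ^+ 2))
  = psi (a ^+ 2) * (\sum_i rho v i * (G i)%:R
      - 4 / a ^+ 2 * \sum_i rho v i * (inner x (th i) - a) ^+ 2).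
  by rewrite mulr_sumr -sumrB mulr_sumr; apply: eq_bigr => i _; ring.
set V := \sum_i rho v i * (inner x (th i) - a) ^+ 2 in var *.
(* Chebyshev's inequality: far directions have mass at most 1/4, so at least [7/8 - 1/4 >= 1/2]
   remains in [G], whence the factor 2 in the conclusion. *)
have : 4 / a ^+ 2 * V <= 1 / 4.
  by rewrite mulrAC ler_pdivrMr //; lra.
have := psi0 _ (sqr_ge0 a); have := psi0 (16 * bb); rewrite mulr_ge0 // => /(_ isT); nra.
Qed.

End Elementary.

Section Concentration.
Context {R : realType} {d : nat} {dT : measure_display} {T : measurableType dT}.
Context (P : probability T R) (Q : probability 'cV[R]_d R).
Context (n : nat) (X : 'I_n -> {RV P >-> 'cV[R]_d}).
Hypothesis Q4 : fourth_moment_finite Q.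
Hypothesis iidX : iid_law P Q n X.
Local Notation Ex := (Ex Q).

Lemma mgrowth01 (f : 'cV[R]_d -> R) : measurable_fun setT f ->
  (forall x, 0 <= f x <= 1) -> mgrowth f.
Proof.
move=> mf f01; apply: (mgrowth_bounded _ 1) => // x.
by have := f01 x => /andP[f0 f1]; rewrite ger0_norm.
Qed.

(** For values in [[0, 1]] the chord bound on the exponential makes the estimate multiplicative in
    the mean; 3 is the slope of that chord bound. *)
Lemma pac_bayes_bounded (Theta : finType) (f : Theta -> 'cV[R]_d -> R) (t : R) :
  (0 < #|Theta|)%N -> (forall i, measurable_fun setT (f i)) ->
  (forall i x, 0 <= f i x <= 1) ->
  whp P (expR (- t)) [set w | forall rho : Theta -> R,
    (forall i, 0 <= rho i) -> \sum_i rho i = 1 ->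
    \sum_i rho i * (\sum_(j < n) f i (X j w)) <=
      3 * n%:R * (\sum_i rho i * Ex (f i))
        + \sum_i rho i * ln (rho i * #|Theta|%:R) + t].
Proof.
move=> T0 mf f01.
apply: whp_sub (pac_bayes P Q n X Theta f (fun i => 3 * Ex (f i)) t iidX T0 mf _).
  move=> w h rho r0 r1; apply: le_trans (h rho r0 r1) _.
  rewrite lerD2r lerD2r -mulrA [leRHS]mulrCA ler_wpM2l // mulr_sumr.
  by apply: ler_sum => i _; rewrite mulrCA.
move=> i; have gf : mgrowth (f i) by apply: mgrowth01.
apply: (@le_trans _ _ (\int[Q]_x (1 + 3 * f i x)%:E)%E).
  apply: ge0_le_integral => //.
  - by apply/measurable_EFinP; apply: measurableT_comp.
  - by apply/measurable_EFinP; apply: measurable_funD => //; apply: measurable_funM.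
  - by move=> x _; rewrite lee_fin expR_le_chord.
have g3 : mgrowth (fun x => 3 * f i x) by exact: mgrowthZ.
rewrite Ex_EFin //; last by apply: mgrowthD => //; exact: mgrowth_cst.
rewrite lee_fin ExD // ?Ex_cst ?ExZ // ?expR_ge1Dx //; exact: mgrowth_cst.
Qed.

Lemma sum_unit (g : unit -> R) : \sum_i g i = g tt.
Proof. by rewrite (bigD1 tt) //= big1 ?addr0 // => -[]. Qed.

(** With a one-point [Theta] the entropy vanishes, and the PAC-Bayes inequality is a Chernoff
    bound. *)
Lemma chernoff_upper (f : 'cV[R]_d -> R) (t : R) :
  measurable_fun setT f -> (forall x, 0 <= f x <= 1) ->
  whp P (expR (- t)) [set w | \sum_(j < n) f (X j w) <= 3 * n%:R * Ex f + t].
Proof.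
move=> mf f01.
apply: whp_sub (pac_bayes_bounded unit (fun=> f) t _ (fun=> mf) (fun=> f01)); last by rewrite card_unit.
move=> w /(_ (fun=> 1)) /=; rewrite !sum_unit card_unit !mul1r ln1 addr0; exact.
Qed.

Lemma chernoff_lower (f : 'cV[R]_d -> R) (t : R) :
  measurable_fun setT f -> (forall x, 0 <= f x <= 1) ->
  whp P (expR (- t)) [set w | n%:R * Ex f <= 2 * \sum_(j < n) f (X j w) + 2 * t].
Proof.
move=> mf f01; have gf : mgrowth f by apply: mgrowth01.
apply: whp_sub (pac_bayes P Q n X unit (fun _ x => - f x) (fun=> - (Ex f / 2)) t iidX _ _ _).
- move=> w /(_ (fun=> 1)) /=; rewrite !sum_unit card_unit !mul1r ln1 addr0 => h.
  have : \sum_(j < n) - f (X j w) <= n%:R * - (Ex f / 2) + t.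
    exact: h.
  by rewrite sumrN; clear; set A := \sum_(j < n) _; set B := n%:R; lra.
- by rewrite card_unit.
- by move=> _; exact: measurable_funN.
move=> _.
apply: (@le_trans _ _ (\int[Q]_x (1 + - 2^-1 * f x)%:E)%E).
  apply: ge0_le_integral => //.
  - by apply/measurable_EFinP; apply: measurableT_comp => //; exact: measurable_funN.
  - by apply/measurable_EFinP; apply: measurable_funD => //; apply: measurable_funM.
  - by move=> x _; rewrite lee_fin; apply: le_trans (expRN_le_chord _ (f01 x)) _; lra.
have g2 : mgrowth (fun x => - 2^-1 * f x) by exact: mgrowthZ.
rewrite Ex_EFin //; last by apply: mgrowthD => //; exact: mgrowth_cst.
rewrite lee_fin ExD // ?Ex_cst ?ExZ //; last exact: mgrowth_cst.
by rewrite mulNr [X in 1 - X]mulrC; exact: expR_ge1Dx.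
Qed.

Context (s K : R).
Hypotheses (s0 : 0 < s) (K0 : 0 <= K).
Hypothesis second_le : forall v, Ex (fun x => inner x v ^+ 2) <= s * inner v v.
Hypothesis fourth_le : forall v,
  Ex (fun x => inner x v ^+ 4) <= K * Ex (fun x => inner x v ^+ 2) ^+ 2.
Let tr := Ex (fun x => inner x x).
Hypothesis norm4_le : Ex (fun x => inner x x ^+ 2) <= K * tr ^+ 2.

Section Averages.
Context (beta e : R) (Theta : finType) (th : Theta -> 'cV[R]_d)
  (rho : 'cV[R]_d -> Theta -> R).
Hypotheses (b0 : 0 < beta) (sm : smoothing d beta e Theta th rho).
Context (v : 'cV[R]_d).
Hypothesis v1 : inner v v <= 1.

Lemma smoothing_avg (x : 'cV[R]_d) :
  \sum_i rho v i * inner x (th i) ^+ 2 =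
  inner x v ^+ 2 + \sum_i rho v i * (inner x (th i) - inner x v) ^+ 2.
Proof.
have [_ r1 _ /(_ x)[m _ _ _]] := sm v v1.
have E (a : R) : \sum_i rho v i * (inner x (th i) - a) ^+ 2
   = \sum_i rho v i * inner x (th i) ^+ 2
     - 2 * a * (\sum_i rho v i * inner x (th i)) + a ^+ 2 * \sum_i rho v i.
  by rewrite !mulr_sumr -sumrB -big_split; apply: eq_bigr => i _ /=; ring.
rewrite E m r1; ring.
Qed.

Lemma smoothing_avg2_le (x : 'cV[R]_d) :
  \sum_i rho v i * inner x (th i) ^+ 2 <= inner x v ^+ 2 + inner x x / beta.
Proof. by rewrite smoothing_avg lerD2l; have [_ _ _ /(_ x)[]] := sm v v1. Qed.

Lemma smoothing_avg2_ge (x : 'cV[R]_d) :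
  inner x v ^+ 2 + inner x x / beta - e * inner x x
    <= \sum_i rho v i * inner x (th i) ^+ 2.
Proof. by rewrite smoothing_avg -addrA lerD2l; have [_ _ _ /(_ x)[]] := sm v v1. Qed.

(** With [y = inner x (th i)], [a = inner x v] and [b = inner x x / beta]:
    [(y^2 - b)^2 <= 2 y^4 + 2 b^2] and [y^4 <= 8 a^4 + 8 (y - a)^4]. The last term averages to at
    most [3 b^2] before its coefficient, so that [50 = 2 + 16 * 3]. *)
Lemma smoothing_avg4_le (x : 'cV[R]_d) :
  \sum_i rho v i * (inner x (th i) ^+ 2 - inner x x / beta) ^+ 2
    <= 16 * inner x v ^+ 4 + 50 * (inner x x / beta) ^+ 2.
Proof.
have [r0 r1 _ /(_ x)[_ _ _ m4]] := sm v v1.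
set bb := inner x x / beta in m4 *; set a := inner x v in m4 *.
apply: (@le_trans _ _ (\sum_i (16 * a ^+ 4 + 2 * bb ^+ 2) * rho v i
   + 16 * \sum_i rho v i * (inner x (th i) - a) ^+ 4)); last first.
  by rewrite -mulr_sumr r1; lra.
rewrite mulr_sumr -big_split; apply: ler_sum => i _ /=.
have -> : (16 * a ^+ 4 + 2 * bb ^+ 2) * rho v i + 16 * (rho v i * (inner x (th i) - a) ^+ 4)
   = rho v i * (16 * a ^+ 4 + 2 * bb ^+ 2 + 16 * (inner x (th i) - a) ^+ 4) by ring.
rewrite ler_wpM2l //; set y := inner x (th i).
have h1 : (y ^+ 2 - bb) ^+ 2 <= 2 * y ^+ 4 + 2 * bb ^+ 2.
  have := sqr_ge0 (y ^+ 2 + bb); rewrite !sqrrD !sqrrN -!exprM /=; lra.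
have h2 : y ^+ 4 <= 8 * a ^+ 4 + 8 * (y - a) ^+ 4.
  have e1 : y ^+ 2 <= 2 * a ^+ 2 + 2 * (y - a) ^+ 2 by have := sqr_ge0 (y - 2 * a); lra.
  have e2 : (y ^+ 2) ^+ 2 <= (2 * a ^+ 2 + 2 * (y - a) ^+ 2) ^+ 2.
    by rewrite lerXn2r ?nnegrE ?sqr_ge0 // addr_ge0 // mulr_ge0 // sqr_ge0.
  rewrite (_ : 4 = 2 * 2)%N // !exprM.
  set A := a ^+ 2 in e2 *; set Z := (y - a) ^+ 2 in e2 *.
  have := sqr_ge0 (A - Z); lra.
lra.
Qed.

Lemma Ex_smoothing2 : tr <= beta * s ->
  \sum_i rho v i * Ex (fun x => inner x (th i) ^+ 2) <= 2 * s.
Proof.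
move=> trb.
have -> : \sum_i rho v i * Ex (fun x => inner x (th i) ^+ 2)
    = Ex (fun x => \sum_i rho v i * inner x (th i) ^+ 2).
  rewrite Ex_sum //; last by move=> i; apply: mgrowthZ; exact: mgrowth_inner2.
  by apply: eq_bigr => i _; rewrite ExZ //; exact: mgrowth_inner2.
have gn : mgrowth (fun x : 'cV[R]_d => beta^-1 * inner x x).
  by apply: mgrowthZ; exact: mgrowth_norm2.
apply: (@le_trans _ _ (Ex (fun x => inner x v ^+ 2 + beta^-1 * inner x x))).
  apply: Ex_le => //.
  - by apply: mgrowth_sum => i; apply: mgrowthZ; exact: mgrowth_inner2.
  - by apply: mgrowthD => //; exact: mgrowth_inner2.
  - by move=> x; rewrite [_ * inner x x]mulrC; exact: smoothing_avg2_le.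
rewrite ExD //; last exact: mgrowth_inner2.
rewrite ExZ //; last exact: mgrowth_norm2.
have h1 : Ex (fun x => inner x v ^+ 2) <= s.
  by apply: le_trans (second_le v) _; rewrite ler_piMr // ltW.
have h2 : beta^-1 * Ex (fun x => inner x x) <= s by rewrite mulrC ler_pdivrMr // mulrC.
lra.
Qed.

End Averages.

(** Smoothed directions may leave the unit ball, so [D1] is required only for directions of variance
    at most [16 s]. The mean variance under [rho v] is at most [2 s], hence by Markov's inequality
    these directions have mass at least 7/8, as [smoothing_majorant] demands. *)
Lemma one_sided_uniform (beta t D1 D2 : R) (psi : R -> R) :
  0 < beta -> tr <= beta * s ->
  measurable_fun setT psi -> (forall u, 0 <= u -> 0 <= psi u <= 1) ->
  (forall u u' : R, 0 <= u <= u' -> psi u <= psi u') -> 0 <= D1 ->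
  (forall th, Ex (fun x => inner x th ^+ 2) <= 16 * s ->
     Ex (fun x => psi (4 * inner x th ^+ 2)) <= D1) ->
  Ex (fun x => psi (16 * (inner x x / beta))) <= D2 ->
  whp P (expR (- t) + expR (- t)) [set w | forall v, inner v v <= 1 ->
    \sum_(j < n) psi (inner (X j w) v ^+ 2) <=
      6 * n%:R * D1 + 2 * (beta + t) + 3 * n%:R * D2 + t].
Proof.
move=> b0 trb mpsi psi01 psim D10 hD1 hD2.
have [Th [th [rho [T0 sm]]]] := @smoothing_exists R d beta 1 b0 ltr01.
pose G : pred Th := fun i => Ex (fun x => inner x (th i) ^+ 2) <= 16 * s.
pose f i x := (G i)%:R * psi (4 * inner x (th i) ^+ 2).
have psi0 u : 0 <= u -> 0 <= psi u by move=> /psi01/andP[].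
have mf i : measurable_fun setT (f i).
  apply: measurable_funM => //; apply: measurableT_comp => //.
  by apply: measurable_funM => //; apply: measurable_funX; exact: measurable_inner.
have f01 i x : 0 <= f i x <= 1.
  by rewrite /f; case: (G i); rewrite ?mul1r ?mul0r ?lexx ?ler01 // psi01 // mulr_ge0 // sqr_ge0.
have m16 : measurable_fun setT (fun x : 'cV[R]_d => psi (16 * (inner x x / beta))).
  apply: measurableT_comp => //; apply: measurable_funM => //.
  by apply: measurable_funM => //; exact: measurable_inner2.
have h16 (x : 'cV[R]_d) : 0 <= psi (16 * (inner x x / beta)) <= 1.
  by rewrite psi01 // mulr_ge0 // divr_ge0 ?inner_ge0 // ltW.
apply: whp_sub (whp_setI _ _ _ _ _ (pac_bayes_bounded Th f t T0 mf f01)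
   (chernoff_upper _ t m16 h16)).
move=> w [h1 h2] v v1; have [r0 r1 KL _] := sm v v1.
have GG : 7 / 8 <= \sum_i rho v i * (G i)%:R.
  have h : \sum_i rho v i * (1 - (G i)%:R) <= 1 / 8.
    apply: (@le_trans _ _ ((16 * s)^-1 * \sum_i rho v i * Ex (fun x => inner x (th i) ^+ 2))).
      rewrite mulr_sumr; apply: ler_sum => i _; rewrite mulrCA ler_wpM2l //.
      case: (boolP (G i)); rewrite /G -?ltNge => hi /=; last first.
        by rewrite subr0 mulrC ler_pdivlMr ?mul1r ?mulr_gt0 // ltW.
      rewrite subrr mulr_ge0 ?invr_ge0 ?mulr_ge0 ?(ltW s0) //; apply: Ex_ge0 => // x.
      exact: sqr_ge0.
    have := Ex_smoothing2 _ _ _ _ _ b0 sm v v1 trb.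
    set A := \sum_i _ => hA; rewrite mulrC ler_pdivrMr ?mulr_gt0 //; lra.
  have e : \sum_i rho v i * (1 - (G i)%:R) = 1 - \sum_i rho v i * (G i)%:R.
    by rewrite -[X in _ = X - _]r1 -sumrB; apply: eq_bigr => i _; ring.
  lra.
apply: (@le_trans _ _ (\sum_(j < n) (2 * (\sum_i rho v i * f i (X j w))
    + psi (16 * (inner (X j w) (X j w) / beta))))).
  by apply: ler_sum => j _; exact: (smoothing_majorant d beta 1 Th th rho psi G).
rewrite big_split /= -mulr_sumr exchange_big /=.
have -> : \sum_i \sum_(j < n) rho v i * f i (X j w) = \sum_i rho v i * \sum_(j < n) f i (X j w).
  by apply: eq_bigr => i _; rewrite mulr_sumr.
have := h1 _ r0 r1; set A := \sum_i rho v i * \sum_(j < n) _ => hA.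
have hE : \sum_i rho v i * Ex (f i) <= D1.
  rewrite -[leRHS]mul1r -r1 mulr_suml; apply: ler_sum => i _; rewrite ler_wpM2l //.
  rewrite /f; case: (boolP (G i)) => Gi; last first.
    by rewrite (_ : (fun x => _) = (fun=> 0)) ?Ex_cst //; apply/funext => x; rewrite mul0r.
  rewrite (_ : (fun x => _) = (fun x => psi (4 * inner x (th i) ^+ 2))); first exact: hD1.
  by apply/funext => x; rewrite mul1r.
have hE2 : 3 * n%:R * (\sum_i rho v i * Ex (f i)) <= 3 * n%:R * D1.
  by rewrite ler_wpM2l.
have hD3 : 3 * n%:R * Ex (fun x => psi (16 * (inner x x / beta))) <= 3 * n%:R * D2.
  by rewrite ler_wpM2l.
move: h2 => /= h2.
lra.
Qed.

Lemma measurable_trunc (B : R) : measurable_fun setT (fun u : R => Num.min u B).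
Proof. exact: measurable_minr. Qed.

Lemma min_mul_le (c b B : R) : 1 <= c -> 0 <= B -> Num.min (c * b) B <= c * Num.min b B.
Proof.
move=> c1 B0; rewrite [Num.min b B]minEle; case: (leP b B) => _; first by rewrite ge_min lexx.
by rewrite ge_min ler_peMl ?orbT.
Qed.

(** Serves every budget, in particular those below the effective rank, so [beta] is not compared to
    [tr / s]. No direction is discarded; the truncated means are bounded after averaging over
    [rho v], and the truncated mean of [inner x x / beta] takes the place of a bound by [s]. *)
Lemma truncated_uniform (beta t B : R) : 0 < beta -> 0 < B ->
  whp P (expR (- t) + expR (- t)) [set w | forall v, inner v v <= 1 ->
    \sum_(j < n) Num.min (inner (X j w) v ^+ 2) B <=
      96 * n%:R * (s + Ex (fun x => Num.min (inner x x / beta) B))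
      + B * (2 * beta + 18 * t)].
Proof.
move=> b0 B0; have [Th [th [rho [T0 sm]]]] := @smoothing_exists R d beta 1 b0 ltr01.
pose psi (u : R) : R := Num.min u B / B.
have psi01 (u : R) : 0 <= u -> 0 <= psi u <= 1.
  move=> u0; rewrite /psi divr_ge0 ?le_min ?u0 ?(ltW B0) //=.
  by rewrite ler_pdivrMr // mul1r ge_min lexx orbT.
have psim (u u' : R) : 0 <= u <= u' -> psi u <= psi u'.
  by move=> /andP[_ uu']; rewrite /psi ler_wpM2r ?invr_ge0 ?(ltW B0) // le_min2.
pose f i (x : 'cV[R]_d) : R := psi (4 * inner x (th i) ^+ 2).
have mpsi : measurable_fun setT psi by apply: measurable_funM => //; exact: measurable_trunc.
have mf i : measurable_fun setT (f i).
  apply: measurableT_comp => //.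
  by apply: measurable_funM => //; apply: measurable_funX; exact: measurable_inner.
have f01 i x : 0 <= f i x <= 1 by rewrite psi01 // mulr_ge0 // sqr_ge0.
pose g (x : 'cV[R]_d) : R := psi (inner x x / beta).
have mb : measurable_fun setT (fun x : 'cV[R]_d => inner x x / beta).
  by apply: measurable_funM => //; exact: measurable_inner2.
have bb0 (x : 'cV[R]_d) : 0 <= inner x x / beta by rewrite divr_ge0 ?inner_ge0 // ltW.
have mg : measurable_fun setT g by exact: measurableT_comp.
have g01 x : 0 <= g x <= 1 by rewrite psi01.
apply: whp_sub (whp_setI _ _ _ _ _ (pac_bayes_bounded Th f t T0 mf f01)
   (chernoff_upper g t mg g01)).
move=> w [h1 /= h2] v v1; have [r0 r1 KL _] := sm v v1.
have Bpsi (u : R) : Num.min u B = B * psi u by rewrite /psi mulrC divfK ?gt_eqF.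
have gg : mgrowth (fun x : 'cV[R]_d => Num.min (inner x x / beta) B).
  apply: (mgrowth_bounded _ B); first by exact: (measurableT_comp (measurable_trunc B) mb).
  move=> x; rewrite ger0_norm; first by rewrite ge_min lexx orbT.
  by rewrite le_min bb0 ltW.
have EgE : Ex g = B^-1 * Ex (fun x => Num.min (inner x x / beta) B).
  by rewrite -ExZ //; congr Ex; apply/funext => x; rewrite /g /psi mulrC.
set phi := Ex (fun x => Num.min _ B) in EgE *.
have hE : \sum_i rho v i * Ex (f i) <= 8 * B^-1 * (s + phi).
  have gf i : mgrowth (f i) by apply: mgrowth01.
  have -> : \sum_i rho v i * Ex (f i) = Ex (fun x => \sum_i rho v i * f i x).
    rewrite Ex_sum //; last by move=> i; exact: mgrowthZ.
    by apply: eq_bigr => i _; rewrite ExZ.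
  apply: (@le_trans _ _ (Ex (fun x => 8 * B^-1 * (inner x v ^+ 2 + Num.min (inner x x / beta) B)))).
    apply: Ex_le => //.
    - by apply: mgrowth_sum => i; exact: mgrowthZ.
    - by apply: mgrowthZ; apply: mgrowthD => //; exact: mgrowth_inner2.
    move=> x; have [_ _ _ /(_ x)[_ _ var _]] := sm v v1.
    apply: (@le_trans _ _ (\sum_i rho v i *
        (B^-1 * (8 * inner x v ^+ 2 + Num.min (8 * (inner x (th i) - inner x v) ^+ 2) B)))).
      apply: ler_sum => i _; rewrite ler_wpM2l // /f /psi mulrC ler_wpM2l ?invr_ge0 ?(ltW B0) //.
      set a := inner x v; set y := inner x (th i).
      have hy : 4 * y ^+ 2 <= 8 * a ^+ 2 + 8 * (y - a) ^+ 2.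
        by have := sqr_ge0 (y - 2 * a); lra.
      have a0 := sqr_ge0 a.
      rewrite -lerBlDl le_min; apply/andP; split.
        by rewrite lerBlDl ge_min hy.
      by rewrite lerBlDl ge_min (_ : B <= _) ?orbT //; lra.
    have -> : \sum_i rho v i * (B^-1 * (8 * inner x v ^+ 2
          + Num.min (8 * (inner x (th i) - inner x v) ^+ 2) B))
       = B^-1 * (8 * inner x v ^+ 2
          + \sum_i rho v i * Num.min (8 * (inner x (th i) - inner x v) ^+ 2) B).
      have E (c : R) (F : Th -> R) : \sum_i rho v i * (B^-1 * (c + F i)) =
          B^-1 * (c + \sum_i rho v i * F i).
        rewrite mulrDr -[X in X + _]mulr1 -r1 !mulr_sumr -big_split.
        by apply: eq_bigr => i _ /=; ring.
      exact: E.
    rewrite [8 * B^-1]mulrC -[leRHS]mulrA ler_wpM2l ?invr_ge0 ?(ltW B0) // mulrDr lerD2l.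
    apply: (@le_trans _ _ (Num.min (8 * (inner x x / beta)) B)).
      rewrite le_min; apply/andP; split.
        apply: (@le_trans _ _ (8 * \sum_i rho v i * (inner x (th i) - inner x v) ^+ 2)).
          have E (F : Th -> R) : \sum_i rho v i * Num.min (8 * F i) B <= 8 * \sum_i rho v i * F i.
            by rewrite mulr_sumr; apply: ler_sum => i _; rewrite mulrCA ler_wpM2l // ge_min lexx.
          exact: E.
        by rewrite ler_wpM2l.
      have E (F : Th -> R) : \sum_i rho v i * Num.min (F i) B <= B.
        rewrite -[leRHS]mul1r -r1 mulr_suml; apply: ler_sum => i _.
        by rewrite ler_wpM2l // ge_min lexx orbT.
      exact: E.
    by rewrite min_mul_le // ?(ltW B0) // ler1n.
  have gv := mgrowth_inner2 v; have gs := mgrowthD _ _ gv gg.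
  rewrite ExZ // ExD //; rewrite ler_wpM2l ?mulr_ge0 ?invr_ge0 ?(ltW B0) // lerD2r.
  by apply: le_trans (second_le v) _; rewrite ler_piMr // ltW.
have GG : 7 / 8 <= \sum_i rho v i * (predT i : bool)%:R.
  by under eq_bigr do rewrite mulr1; rewrite r1; lra.
have psi0 (u : R) : 0 <= u -> 0 <= psi u by move=> /psi01/andP[].
have maj j : psi (inner (X j w) v ^+ 2) <= 2 * (\sum_i rho v i * f i (X j w)) + 16 * g (X j w).
  apply: le_trans (smoothing_majorant d beta 1 Th th rho psi predT v (X j w) b0 sm v1 psi0 psim GG) _.
  apply: lerD; first by under eq_bigr do rewrite mul1r.
  rewrite /g /psi [leRHS]mulrA ler_wpM2r ?invr_ge0 ?(ltW B0) //.
  by rewrite min_mul_le // ?(ltW B0) // ler1n.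
have : \sum_(j < n) psi (inner (X j w) v ^+ 2) <=
    2 * (\sum_i rho v i * \sum_(j < n) f i (X j w)) + 16 * \sum_(j < n) g (X j w).
  apply: le_trans (ler_sum _ (fun j _ => maj j)) _.
  rewrite big_split /= -!mulr_sumr exchange_big /=.
  by under eq_bigr do rewrite -mulr_sumr.
have := h1 _ r0 r1; set A := \sum_i rho v i * \sum_(j < n) _ => hA.
set Gs := \sum_(j < n) g _ in h2 *; rewrite EgE in h2.
set Sp := \sum_(j < n) psi _ => hS.
have -> : \sum_(j < n) Num.min (inner (X j w) v ^+ 2) B = B * Sp.
  rewrite /Sp; have E (F : 'I_n -> R) : \sum_(j < n) Num.min (F j) B = B * \sum_(j < n) psi (F j).
    by rewrite mulr_sumr; apply: eq_bigr => j _; rewrite Bpsi.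
  exact: E.
have n0 : 0 <= n%:R :> R by [].
have hE2 : 3 * n%:R * (\sum_i rho v i * Ex (f i)) <= 3 * n%:R * (8 * B^-1 * (s + phi)).
  by rewrite ler_wpM2l // mulr_ge0.
have phi0 : 0 <= phi by apply: Ex_ge0 => // x; rewrite le_min bb0 ltW.
(* The coefficient of [phi] is [2 * 3 * 8] from the smoothed forms plus [16 * 3] from the norms;
   that of [t] is [2 + 16]. *)
have step : Sp <= 96 * n%:R * (B^-1 * (s + phi)) + 2 * beta + 18 * t.
  have : n%:R * (B^-1 * s) >= 0 by rewrite !mulr_ge0 ?invr_ge0 // ltW.
  lra.
apply: (@le_trans _ _ (B * (96 * n%:R * (B^-1 * (s + phi)) + 2 * beta + 18 * t))).
  by rewrite ler_wpM2l // ltW.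
have -> : B * (96 * n%:R * (B^-1 * (s + phi)) + 2 * beta + 18 * t) =
   B * B^-1 * (96 * n%:R * (s + phi)) + B * (2 * beta + 18 * t) by ring.
by rewrite divff ?gt_eqF // mul1r.
Qed.

Section TwoSided.
Context (beta t lambda : R).
Hypotheses (b1 : 1 <= beta) (tb : t <= beta) (trb : tr <= beta * s)
  (n0 : (0 < n)%N) (lam0 : 0 < lambda) (lams : lambda * s <= 1)
  (lamK : n%:R * (lambda ^+ 2 * (K * s ^+ 2)) <= beta).

Definition well_sized (v x : 'cV[R]_d) : bool :=
  (lambda * inner x v ^+ 2 <= 1) && (lambda * (inner x x / beta) <= 1).

Definition trunc4 (u : R) : R := Num.min ((lambda * u) ^+ 2) 1.

(** On well-sized points it dominates the quadratic loss of the influence function; on all others it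
    is at least 1, so its sum also bounds their number. *)
Definition remainder4 (v x : 'cV[R]_d) : R :=
  trunc4 (inner x v ^+ 2) + trunc4 (inner x x / beta).

Lemma trunc4_01 u : 0 <= trunc4 u <= 1.
Proof. by rewrite /trunc4 le_min sqr_ge0 ler01 ge_min lexx orbT. Qed.

Lemma trunc4_homo (u u' : R) : 0 <= u <= u' -> trunc4 u <= trunc4 u'.
Proof.
move=> /andP[u0 uu']; apply: le_min2 => //; rewrite lerXn2r ?nnegrE ?mulr_ge0 ?(ltW lam0) //.
  exact: le_trans uu'.
by rewrite ler_wpM2l // ltW.
Qed.

Lemma measurable_trunc4 : measurable_fun setT trunc4.
Proof.
apply: (measurableT_comp (measurable_trunc 1)).
by apply: measurable_funX; exact: measurable_funM.
Qed.

Let b0 : 0 < beta := lt_le_trans ltr01 b1.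
Let bb0 (x : 'cV[R]_d) : 0 <= inner x x / beta.
Proof. by rewrite divr_ge0 ?inner_ge0 // ltW. Qed.

Let Ks0 : 0 <= K * s ^+ 2.
Proof. by rewrite mulr_ge0 // sqr_ge0. Qed.

Let tr_ge0 : 0 <= tr.
Proof. by apply: Ex_ge0 => x; exact: inner_ge0. Qed.

Let norm4_beta : Ex (fun x => (inner x x / beta) ^+ 2) <= K * s ^+ 2.
Proof.
have -> : (fun x : 'cV[R]_d => (inner x x / beta) ^+ 2) = (fun x => beta^-1 ^+ 2 * inner x x ^+ 2).
  by apply/funext => x; rewrite exprMn mulrC.
rewrite ExZ //; last exact: mgrowth_norm4.
apply: (@le_trans _ _ (beta^-1 ^+ 2 * (K * tr ^+ 2))).
  by rewrite ler_wpM2l // sqr_ge0.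
rewrite mulrCA -exprMn; apply: ler_wpM2l => //.
have h : beta^-1 * tr <= s by rewrite mulrC ler_pdivrMr // mulrC.
by rewrite lerXn2r ?nnegrE ?mulr_ge0 ?invr_ge0 ?(ltW b0) ?(ltW s0).
Qed.

Let second_le1 v : inner v v <= 1 -> Ex (fun x => inner x v ^+ 2) <= s.
Proof. by move=> v1; apply: le_trans (second_le v) _; rewrite ler_piMr // ltW. Qed.

Let fourth_le1 v : inner v v <= 1 -> Ex (fun x => inner x v ^+ 4) <= K * s ^+ 2.
Proof.
move=> v1; apply: le_trans (fourth_le v) _; rewrite ler_wpM2l //.
have h : 0 <= Ex (fun x => inner x v ^+ 2) by apply: Ex_ge0 => // x; exact: sqr_ge0.
by rewrite lerXn2r ?nnegrE ?(ltW s0) // second_le1.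
Qed.

(** Each truncated fourth power has mean at most a multiple of [lambda^2 K s^2], and [lamK] bounds
    [n] times this by [beta]. The factor [64 * 64] is [4^2 * 16^2], from the factor 4 in the
    majorant and the variance bound [16 s]. The total [6 * 64^2 + 3 * 256 + 3 + 6] is below
    [130 * 200]. *)
Lemma remainder4_uniform : whp P (3 * expR (- t)) [set w | forall v, inner v v <= 1 ->
  \sum_(j < n) remainder4 v (X j w) <= 130 * 200 * beta].
Proof.
have lk0 : 0 <= lambda ^+ 2 * (K * s ^+ 2) by rewrite mulr_ge0 // sqr_ge0.
have mt4 := measurable_trunc4.
have bound c (g : 'cV[R]_d -> R) D : 0 <= c -> (forall x, 0 <= g x) ->
    measurable_fun setT g -> mgrowth (fun x => g x ^+ 2) ->
    Ex (fun x => g x ^+ 2) <= D -> 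
    Ex (fun x => trunc4 (c * g x)) <= (lambda * c) ^+ 2 * D.
  move=> c0 g0 mg mg2 gD.
  apply: (@le_trans _ _ (Ex (fun x => (lambda * c) ^+ 2 * g x ^+ 2))).
    apply: Ex_le => //; last 2 first.
    - exact: mgrowthZ.
    - by move=> x; rewrite /trunc4 mulrA exprMn ge_min lexx.
    apply: mgrowth01; last by move=> x; exact: trunc4_01.
    by apply: measurableT_comp => //; exact: measurable_funM.
  by rewrite ExZ // ler_wpM2l // sqr_ge0.
have mb : measurable_fun setT (fun x : 'cV[R]_d => inner x x / beta).
  by apply: measurable_funM => //; exact: measurable_inner2.
have gb : mgrowth (fun x : 'cV[R]_d => (inner x x / beta) ^+ 2).
  have -> : (fun x : 'cV[R]_d => (inner x x / beta) ^+ 2) = (fun x => beta^-1 ^+ 2 * inner x x ^+ 2).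
    by apply/funext => x; rewrite exprMn mulrC.
  by apply: mgrowthZ; exact: mgrowth_norm4.
have D1 th : Ex (fun x => inner x th ^+ 2) <= 16 * s ->
    Ex (fun x => trunc4 (4 * inner x th ^+ 2)) <= 64 * 64 * (lambda ^+ 2 * (K * s ^+ 2)).
  move=> hth; apply: le_trans (bound 4 (fun x => inner x th ^+ 2) (K * (16 * s) ^+ 2) _ _ _ _ _) _ => //.
  - by move=> x; exact: sqr_ge0.
  - by apply: measurable_funX; exact: measurable_inner.
  - rewrite (_ : (fun x => _) = (fun x => inner x th ^+ 4)); first exact: mgrowth_inner4.
    by apply/funext => x; rewrite -exprM.
  - rewrite (_ : (fun x => _) = (fun x => inner x th ^+ 4)); last first.
      by apply/funext => x; rewrite -exprM.
    apply: le_trans (fourth_le th) _; rewrite ler_wpM2l //.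
    have h : 0 <= Ex (fun x => inner x th ^+ 2) by apply: Ex_ge0 => // x; exact: sqr_ge0.
    by rewrite lerXn2r ?nnegrE ?mulr_ge0 ?(ltW s0).
  by rewrite le_eqVlt; apply/orP; left; apply/eqP; ring.
have D2 : Ex (fun x => trunc4 (16 * (inner x x / beta))) <= 256 * (lambda ^+ 2 * (K * s ^+ 2)).
  apply: le_trans (bound 16 (fun x => inner x x / beta) (K * s ^+ 2) _ _ _ _ _) _ => //.
  by rewrite le_eqVlt; apply/orP; left; apply/eqP; ring.
have D3 : Ex (fun x => trunc4 (inner x x / beta)) <= lambda ^+ 2 * (K * s ^+ 2).
  have := bound 1 (fun x => inner x x / beta) (K * s ^+ 2) ler01 bb0 mb gb norm4_beta.
  by rewrite mulr1; under eq_fun do rewrite mul1r.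
have m3 : measurable_fun setT (fun x : 'cV[R]_d => trunc4 (inner x x / beta)).
  exact: measurableT_comp.
apply: whp_le (_ : expR (- t) + expR (- t) + expR (- t) <= _) _; first by lra.
apply: whp_sub (whp_setI _ _ _ _ _
  (one_sided_uniform beta t (64 * 64 * (lambda ^+ 2 * (K * s ^+ 2))) (256 * (lambda ^+ 2 * (K * s ^+ 2)))
    trunc4 b0 trb mt4 (fun u _ => trunc4_01 u) trunc4_homo _ D1 D2)
  (chernoff_upper _ t m3 (fun x => trunc4_01 _))); last by rewrite mulr_ge0.
move=> w [h1 /= h2] v v1; have := h1 v v1.
rewrite /remainder4 big_split /=.
set A := \sum_(j < n) trunc4 (inner _ v ^+ 2) => hA.
have hD3 : 3 * n%:R * Ex (fun x => trunc4 (inner x x / beta)) <= 3 * n%:R * (lambda ^+ 2 * (K * s ^+ 2)).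
  by rewrite ler_wpM2l.
have lK := lamK; set L := lambda ^+ 2 * (K * s ^+ 2) in lK hA hD3 *.
set Z := \sum_(j < n) trunc4 (_ / beta) in h2 *.
have b1' := b1; have tb' := tb; move: (3 * n%:R * Ex _) hD3 h2 => W hD3 h2; move: lK hA hD3; lra.
Qed.

Let gb2 : mgrowth (fun x : 'cV[R]_d => (inner x x / beta) ^+ 2).
Proof.
have -> : (fun x : 'cV[R]_d => (inner x x / beta) ^+ 2) = (fun x => beta^-1 ^+ 2 * inner x x ^+ 2).
  by apply/funext => x; rewrite exprMn mulrC.
by apply: mgrowthZ; exact: mgrowth_norm4.
Qed.

Let dev2 u : mgrowth (fun x : 'cV[R]_d => (inner x u ^+ 2 - inner x x / beta) ^+ 2).
Proof.
apply: (@mgrowth_le _ _ _ (fun x : 'cV[R]_d => 2 * inner x u ^+ 4 + 2 * (inner x x / beta) ^+ 2)).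
- apply: measurable_funX; apply: measurable_funB; first by apply: measurable_funX; exact: measurable_inner.
  by apply: measurable_funM => //; exact: measurable_inner2.
- move=> x; rewrite ger0_norm ?sqr_ge0 //; set y := inner x u; set b := _ / beta.
  by have := sqr_ge0 (y ^+ 2 + b); rewrite !sqrrD !sqrrN -!exprM /=; lra.
- apply: mgrowthD; apply: mgrowthZ; last exact: gb2.
  exact: mgrowth_inner4.
Qed.

Let avg4_bound (e : R) (Th : finType) (th : Th -> 'cV[R]_d) rho v :
  smoothing d beta e Th th rho -> inner v v <= 1 ->
  \sum_i rho v i * Ex (fun x => (inner x (th i) ^+ 2 - inner x x / beta) ^+ 2)
    <= 66 * (K * s ^+ 2).
Proof.
move=> sm v1; have [r0 r1 _ _] := sm v v1.
have gb := gb2; have gd i := dev2 (th i).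
have -> : \sum_i rho v i * Ex (fun x => (inner x (th i) ^+ 2 - inner x x / beta) ^+ 2)
   = Ex (fun x => \sum_i rho v i * (inner x (th i) ^+ 2 - inner x x / beta) ^+ 2).
  rewrite Ex_sum //; last by move=> i; exact: mgrowthZ.
  by apply: eq_bigr => i _; rewrite ExZ.
have g16 : mgrowth (fun x => 16 * inner x v ^+ 4) by apply: mgrowthZ; exact: mgrowth_inner4.
have g50 : mgrowth (fun x : 'cV[R]_d => 50 * (inner x x / beta) ^+ 2) by exact: mgrowthZ.
apply: (@le_trans _ _ (Ex (fun x => 16 * inner x v ^+ 4 + 50 * (inner x x / beta) ^+ 2))).
  apply: Ex_le => //; first by apply: mgrowth_sum => i; exact: mgrowthZ.
    exact: mgrowthD.
  by move=> x; exact: (smoothing_avg4_le beta e Th th rho sm v v1).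
rewrite ExD // !ExZ //; last exact: mgrowth_inner4.
by have := fourth_le1 v v1; have := norm4_beta; lra.
Qed.

(** Subtracting [inner x x / beta] removes the smoothing excess from the mean, up to [e * tr]. *)
Let avg2_exp (e : R) (Th : finType) (th : Th -> 'cV[R]_d) rho v :
  smoothing d beta e Th th rho -> inner v v <= 1 -> 0 <= e ->
  Ex (fun x => inner x v ^+ 2) - e * tr <=
  \sum_i rho v i * Ex (fun x => inner x (th i) ^+ 2 - inner x x / beta)
    <= Ex (fun x => inner x v ^+ 2).
Proof.
move=> sm v1 e0; have [r0 r1 _ _] := sm v v1.
have gb : mgrowth (fun x : 'cV[R]_d => inner x x / beta).
  under eq_fun do rewrite mulrC.
  by apply: mgrowthZ; exact: mgrowth_norm2.
have gd i : mgrowth (fun x => inner x (th i) ^+ 2 - inner x x / beta).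
  by apply: mgrowthB => //; exact: mgrowth_inner2.
have gs : mgrowth (fun x => \sum_i rho v i * (inner x (th i) ^+ 2 - inner x x / beta)).
  by apply: mgrowth_sum => i; exact: mgrowthZ.
have sumE (x : 'cV[R]_d) : \sum_i rho v i * (inner x (th i) ^+ 2 - inner x x / beta)
   = \sum_i rho v i * inner x (th i) ^+ 2 - inner x x / beta.
  move: (inner x x / beta) => b.
  rewrite -[X in _ = _ - X]mul1r -r1 mulr_suml -sumrB.
  by apply: eq_bigr => i _; rewrite mulrBr.
have -> : \sum_i rho v i * Ex (fun x => inner x (th i) ^+ 2 - inner x x / beta)
   = Ex (fun x => \sum_i rho v i * (inner x (th i) ^+ 2 - inner x x / beta)).
  rewrite Ex_sum //; last by move=> i; exact: mgrowthZ.
  by apply: eq_bigr => i _; rewrite ExZ.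
have gv := mgrowth_inner2 v; have gn := @mgrowth_norm2 R d.
apply/andP; split; last first.
  apply: Ex_le => // x; rewrite sumE.
  by have := smoothing_avg2_le beta e Th th rho sm v v1 x; lra.
rewrite /tr -ExZ // -ExB //; last exact: mgrowthZ.
apply: Ex_le => //; first by apply: mgrowthB => //; exact: mgrowthZ.
move=> x; rewrite sumE.
by have := smoothing_avg2_ge beta e Th th rho sm v v1 x; lra.
Qed.

(** The exponential of the influence function at [w_ i] has mean exactly [1 + E w + E w^2], which
    feeds the PAC-Bayes inequality. Conversely its average over [rho v] is at least the signed form
    minus 50 remainders: on well-sized points by [u - u^2 <= ln (1 + u + u^2)], elsewhere because
    the logarithm is at least -1 and the remainder at least 1. *)
Lemma two_sided_sign (sigma : R) : sigma = 1 \/ sigma = -1 ->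
  whp P (expR (- t)) [set w | forall v, inner v v <= 1 ->
  sigma * lambda * (\sum_(j < n) (well_sized v (X j w))%:R * inner (X j w) v ^+ 2) <=
   n%:R * (sigma * lambda * Ex (fun x => inner x v ^+ 2)) + 70 * beta
     + 50 * \sum_(j < n) remainder4 v (X j w)].
Proof.
move=> hsigma; have s2 : sigma ^+ 2 = 1 by case: hsigma => ->; rewrite ?sqrrN expr1n.
have nR : 0 < n%:R :> R by rewrite ltr0n.
(* With this slack the variance defect of the smoothing costs only [n * e * beta = 1] over the whole
   sample. *)
pose e := (beta * n%:R)^-1; have e0 : 0 < e by rewrite invr_gt0 mulr_gt0.
have eb : n%:R * (e * beta) = 1 by rewrite /e; field; rewrite !gt_eqF.
have [Th [th [rho [T0 sm]]]] := @smoothing_exists R d beta e b0 e0.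
pose w_ i (x : 'cV[R]_d) : R := sigma * lambda * (inner x (th i) ^+ 2 - inner x x / beta).
pose f i (x : 'cV[R]_d) : R := ln (1 + w_ i x + w_ i x ^+ 2).
have mw i : measurable_fun setT (w_ i).
  apply: measurable_funM => //; apply: measurable_funB.
    by apply: measurable_funX; exact: measurable_inner.
  by apply: measurable_funM => //; exact: measurable_inner2.
have mw2 i : measurable_fun setT (fun x => 1 + w_ i x + w_ i x ^+ 2).
  by apply: measurable_funD; [exact: measurable_funD | exact: measurable_funX].
have mf i : measurable_fun setT (f i).
  by apply: (measurableT_comp (@measurable_ln R)).
have gb : mgrowth (fun x : 'cV[R]_d => inner x x / beta).
  under eq_fun do rewrite mulrC.
  by apply: mgrowthZ; exact: mgrowth_norm2.
have gd i : mgrowth (fun x => inner x (th i) ^+ 2 - inner x x / beta).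
  by apply: mgrowthB => //; exact: mgrowth_inner2.
have gw i : mgrowth (w_ i) by exact: mgrowthZ.
have gd2 i : mgrowth (fun x => (inner x (th i) ^+ 2 - inner x x / beta) ^+ 2).
  exact: dev2.
have w2E i : (fun x => w_ i x ^+ 2) =
    (fun x => lambda ^+ 2 * (inner x (th i) ^+ 2 - inner x x / beta) ^+ 2).
  by apply/funext => x; rewrite /w_ !exprMn s2 mul1r.
have gw2 i : mgrowth (fun x => w_ i x ^+ 2) by rewrite w2E; exact: mgrowthZ.
have g1 : mgrowth (fun _ : 'cV[R]_d => 1 : R) by exact: mgrowth_cst.
pose c i := Ex (w_ i) + Ex (fun x => w_ i x ^+ 2).
apply: whp_sub (pac_bayes P Q n X Th f c t iidX T0 mf _); last first.
  move=> i.
  have -> : (\int[Q]_x (expR (f i x))%:E = \int[Q]_x (1 + w_ i x + w_ i x ^+ 2)%:E)%E.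
    apply: eq_integral => x _; congr EFin; rewrite /f lnK // posrE.
    by have := sqr_ge0 (w_ i x + 1 / 2); lra.
  rewrite Ex_EFin //; last by apply: mgrowthD => //; exact: mgrowthD.
  rewrite lee_fin !ExD //; last exact: mgrowthD.
  by rewrite Ex_cst -addrA; exact: expR_ge1Dx.
move=> w h v v1; have [r0 r1 KL smx] := sm v v1.
have := h _ r0 r1.
set q := Ex (fun x => inner x v ^+ 2).
have cE : \sum_i rho v i * c i <= sigma * lambda * q + lambda * e * tr
     + 66 * (lambda ^+ 2 * (K * s ^+ 2)).
  have -> : \sum_i rho v i * c i = 
     sigma * lambda * \sum_i rho v i * Ex (fun x => inner x (th i) ^+ 2 - inner x x / beta)
     + lambda ^+ 2 * \sum_i rho v i * Ex (fun x => (inner x (th i) ^+ 2 - inner x x / beta) ^+ 2).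
    rewrite !mulr_sumr -big_split; apply: eq_bigr => i _ /=.
    by rewrite /c w2E !ExZ //; ring.
  have := avg4_bound e Th th rho v sm v1; set M4 := \sum_i _ => hM4.
  have h4 : lambda ^+ 2 * M4 <= lambda ^+ 2 * (66 * (K * s ^+ 2)) by rewrite ler_wpM2l ?sqr_ge0.
  have /andP[] := avg2_exp e Th th rho v sm v1 (ltW e0); rewrite -/q.
  set M2 := \sum_i _ => m1 m2.
  have h2 : sigma * lambda * M2 <= sigma * lambda * q + lambda * e * tr.
    have : 0 <= lambda * (e * tr) by rewrite !mulr_ge0 ?(ltW lam0) // ltW.
    case: hsigma => ->; rewrite ?mul1r ?mulN1r ?mulNr.
      have : lambda * M2 <= lambda * q by rewrite ler_wpM2l // ltW.
      lra.
    have : lambda * (q - e * tr) <= lambda * M2 by rewrite ler_wpM2l // ltW.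
    lra.
  lra.
have nc : n%:R * (\sum_i rho v i * c i) <= n%:R * (sigma * lambda * q) + 67 * beta.
  have ets : n%:R * (lambda * e * tr) <= beta.
    apply: (@le_trans _ _ (n%:R * (lambda * e * (beta * s)))).
      by rewrite ler_wpM2l // ler_wpM2l // mulr_ge0 ?(ltW lam0) // ltW.
    have -> : n%:R * (lambda * e * (beta * s)) = n%:R * (e * beta) * (lambda * s) by ring.
    by rewrite eb mul1r; apply: le_trans lams b1.
  apply: (@le_trans _ _ (n%:R * (sigma * lambda * q + lambda * e * tr
     + 66 * (lambda ^+ 2 * (K * s ^+ 2))))); first by rewrite ler_wpM2l.
  by have lK := lamK; move: lK; set L := lambda ^+ 2 * (K * s ^+ 2) => lK; lra.
set LHS := \sum_i rho v i * \sum_(j < n) _ => hL.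
have low j : sigma * lambda * ((well_sized v (X j w))%:R * inner (X j w) v ^+ 2)
    - e * beta - 50 * remainder4 v (X j w) <= \sum_i rho v i * f i (X j w).
  set x := X j w; have eb0 : 0 <= e * beta by rewrite mulr_ge0 // ltW.
  case: (boolP (well_sized v x)) => [/andP[g_a g_b]|bad]; last first.
    rewrite mul0r mulr0.
    have R1 : 1 <= remainder4 v x.
      have big u : 0 <= u -> ~~ (lambda * u <= 1) -> trunc4 u = 1.
        move=> u0; rewrite -ltNge => lu; apply/min_idPr; apply: exprn_ege1; exact: ltW.
      rewrite /remainder4; move: bad; rewrite negb_and => /orP[b|b].
        by rewrite big ?sqr_ge0 // lerDl; case/andP: (trunc4_01 (inner x x / beta)).
      by rewrite [X in _ + X]big // lerDr; case/andP: (trunc4_01 (inner x v ^+ 2)).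
    apply: (@le_trans _ _ (- 1)); first lra.
    have -> : -1 = \sum_i rho v i * (-1) by rewrite -mulr_suml r1 mul1r.
    by apply: ler_sum => i _; rewrite ler_wpM2l //; exact: ln_quadratic_geN1.
  rewrite mul1r.
  apply: (@le_trans _ _ (\sum_i rho v i * (w_ i x - w_ i x ^+ 2))); last first.
    by apply: ler_sum => i _; rewrite ler_wpM2l //; exact: ln_quadratic_ge.
  have -> : \sum_i rho v i * (w_ i x - w_ i x ^+ 2) =
      sigma * lambda * (\sum_i rho v i * inner x (th i) ^+ 2 - inner x x / beta)
      - lambda ^+ 2 * \sum_i rho v i * (inner x (th i) ^+ 2 - inner x x / beta) ^+ 2.
    rewrite /w_; have E (b : R) (F : Th -> R) :
      \sum_i rho v i * (sigma * lambda * (F i - b) - (sigma * lambda * (F i - b)) ^+ 2)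
      = sigma * lambda * (\sum_i rho v i * F i - b) - lambda ^+ 2 * \sum_i rho v i * (F i - b) ^+ 2.
      rewrite -[X in sigma * lambda * (_ - X)]mul1r -r1 mulr_suml -sumrB !mulr_sumr -sumrB.
      apply: eq_bigr => i _; rewrite !exprMn s2; ring.
    exact: E.
  have h4 := smoothing_avg4_le beta e Th th rho sm v v1 x.
  have hle := smoothing_avg2_le beta e Th th rho sm v v1 x.
  have hge := smoothing_avg2_ge beta e Th th rho sm v v1 x.
  set A4 := \sum_i rho v i * (_ - _) ^+ 2 in h4 *.
  set A2 := \sum_i rho v i * inner x (th i) ^+ 2 in hle hge *.
  have l2 : 0 <= lambda ^+ 2 by rewrite sqr_ge0.
  have h4' : lambda ^+ 2 * A4 <= lambda ^+ 2 * (16 * inner x v ^+ 4 + 50 * (inner x x / beta) ^+ 2).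
    by rewrite ler_wpM2l.
  have small u : 0 <= u -> lambda * u <= 1 -> trunc4 u = lambda ^+ 2 * u ^+ 2.
    by move=> u0 lu; rewrite -exprMn; apply/min_idPl; rewrite exprn_ile1 // mulr_ge0 // ltW.
  have := bb0 x; rewrite /remainder4 !small ?sqr_ge0 //.
  move: hle hge h4' g_a g_b.
  have -> : e * inner x x = e * beta * (inner x x / beta) by field; rewrite gt_eqF.
  rewrite (_ : inner x v ^+ 4 = (inner x v ^+ 2) ^+ 2); last by rewrite -exprM.
  set a2 := inner x v ^+ 2; set b := inner x x / beta => hle hge h4' g_a g_b b_ge0.
  have a2_ge0 : 0 <= a2 by rewrite sqr_ge0.
  have eA : 0 <= e * beta * (lambda * b) <= e * beta.
    have e_b : 0 <= e * beta by rewrite mulr_ge0 // ltW.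
    have l_b : 0 <= lambda * b by rewrite mulr_ge0 // ltW.
    by rewrite (mulr_ge0 e_b l_b) ler_piMr.
  have q2 : sigma * lambda * a2 - e * beta <= sigma * lambda * (A2 - b).
    case: hsigma => ->; rewrite ?mul1r ?mulN1r ?mulNr.
      have : lambda * (a2 - e * beta * b) <= lambda * (A2 - b) by rewrite ler_wpM2l ?(ltW lam0) //; lra.
      lra.
    have : lambda * (A2 - b) <= lambda * a2 by rewrite ler_wpM2l ?(ltW lam0) //; lra.
    lra.
  have : 0 <= lambda ^+ 2 * a2 ^+ 2 by rewrite mulr_ge0 ?sqr_ge0.
  lra.
have LHSE : LHS = \sum_(j < n) \sum_i rho v i * f i (X j w).
  by rewrite exchange_big /=; apply: eq_bigr => i _; rewrite mulr_sumr.
have : \sum_(j < n) (sigma * lambda * ((well_sized v (X j w))%:R * inner (X j w) v ^+ 2)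
    - e * beta - 50 * remainder4 v (X j w)) <= LHS.
  by rewrite LHSE; apply: ler_sum => j _; exact: low.
have sumE (F G : 'I_n -> R) : \sum_(j < n) (sigma * lambda * F j - e * beta - 50 * G j)
    = sigma * lambda * \sum_(j < n) F j - n%:R * (e * beta) - 50 * \sum_(j < n) G j.
  by rewrite !sumrB sumr_const card_ord -!mulr_sumr -[_ *+ n]mulr_natl.
rewrite sumE eb.
set G := \sum_(j < n) _%:R * _; set Rm := \sum_(j < n) remainder4 _ _ => hG.
(* The 70 is 67 from the means plus one [beta] each for the entropy, for [t] and for the variance
   defect. *)
have b1' := b1; have tb' := tb; move: hL nc KL hG.
set A1 := n%:R * \sum_i _; set A2 := \sum_i rho v i * ln _; set A3 := n%:R * (_ * q).
set A4 := sigma * lambda * G; lra.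
Qed.

Lemma two_sided_uniform : whp P (5 * expR (- t)) [set w | forall v, inner v v <= 1 ->
  \sum_(j < n) remainder4 v (X j w) <= 130 * 200 * beta /\
  `| lambda * (\sum_(j < n) (well_sized v (X j w))%:R * inner (X j w) v ^+ 2)
     - n%:R * (lambda * Ex (fun x => inner x v ^+ 2)) | <= (70 + 50 * (130 * 200)) * beta].
Proof.
apply: whp_le (_ : 3 * expR (- t) + (expR (- t) + expR (- t)) <= _) _; first by lra.
apply: whp_sub (whp_setI _ _ _ _ _ remainder4_uniform
  (whp_setI _ _ _ _ _ (two_sided_sign 1 (or_introl erefl)) (two_sided_sign (-1) (or_intror erefl)))).
move=> w [h1 [/= h2 h3]] v v1; have r := h1 v v1; split=> //.
have := h2 v v1; have := h3 v v1; rewrite !mulN1r !mul1r !mulNr.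
move: r; set Rm := \sum_(j < n) remainder4 _ _; set G := lambda * \sum_(j < n) _.
rewrite mulrN; set q := n%:R * _ => r hm hp.
rewrite ler_norml; apply/andP; split; lra.
Qed.

End TwoSided.

(** Capping at [B] before measuring the excess over [B'] puts the summands in [[0, B]], so the
    bounded one-sided estimate applies after division by [B]. In the application [B] is [lambda^-1],
    and [B'] is a level above which the moments leave little mass. *)
Lemma tail_uniform (beta t B B' D : R) :
  0 < beta -> tr <= beta * s -> 0 < B -> 0 <= B' -> 0 <= D ->
  (forall th, Ex (fun x => inner x th ^+ 2) <= 16 * s ->
     Ex (fun x => Num.max (4 * inner x th ^+ 2 - B') 0) <= D) ->
  Ex (fun x => Num.max (16 * (inner x x / beta) - B') 0) <= D ->
  whp P (expR (- t) + expR (- t)) [set w | forall v, inner v v <= 1 ->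
    \sum_(j < n) Num.max (Num.min (inner (X j w) v ^+ 2) B - B') 0 <=
      9 * n%:R * D + B * (2 * beta + 3 * t)].
Proof.
move=> b0 trb B0 B'0 D0 hD1 hD2.
pose psi (u : R) : R := Num.max (Num.min u B - B') 0 / B.
have mpsi : measurable_fun setT psi.
  apply: measurable_funM => //; apply: measurable_maxr => //.
  by apply: measurable_funB => //; exact: measurable_trunc.
have psi01 u : 0 <= u -> 0 <= psi u <= 1.
  move=> u0; rewrite /psi divr_ge0 ?le_max ?lexx ?orbT ?(ltW B0) //=.
  rewrite ler_pdivrMr // mul1r ge_max (ltW B0) andbT.
  have : Num.min u B <= B by rewrite ge_min lexx orbT.
  lra.
have psim (u u' : R) : 0 <= u <= u' -> psi u <= psi u'.
  move=> /andP[_ uu']; rewrite /psi ler_wpM2r ?invr_ge0 ?(ltW B0) //.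
  by apply: le_max2 => //; rewrite lerD2r le_min2.
have le_psi (g : 'cV[R]_d -> R) : measurable_fun setT g -> (forall x, 0 <= g x) -> mgrowth g ->
    Ex (fun x => Num.max (g x - B') 0) <= D -> Ex (fun x => psi (g x)) <= D / B.
  move=> mg g0 gg gD.
  have gm : mgrowth (fun x => Num.max (g x - B') 0).
    apply: (mgrowth_le _ g) => //.
      by apply: measurable_maxr => //; exact: measurable_funB.
    move=> x; rewrite ger0_norm ?le_max ?lexx ?orbT // ge_max g0 andbT; lra.
  apply: (@le_trans _ _ (Ex (fun x => B^-1 * Num.max (g x - B') 0))).
    apply: Ex_le => //; last 2 first.
    - exact: mgrowthZ.
    - move=> x; rewrite /psi mulrC ler_wpM2l ?invr_ge0 ?(ltW B0) //.
      by apply: le_max2 => //; rewrite lerD2r ge_min lexx.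
    by apply: mgrowth01 => [|x]; [exact: measurableT_comp | exact: psi01].
  by rewrite ExZ // mulrC ler_wpM2r // invr_ge0 ltW.
have h1 th : Ex (fun x => inner x th ^+ 2) <= 16 * s ->
    Ex (fun x => psi (4 * inner x th ^+ 2)) <= D / B.
  move=> hth; apply: le_psi; last exact: hD1.
  - by apply: measurable_funM => //; apply: measurable_funX; exact: measurable_inner.
  - by move=> x; rewrite mulr_ge0 // sqr_ge0.
  - by apply: mgrowthZ; exact: mgrowth_inner2.
have h2 : Ex (fun x => psi (16 * (inner x x / beta))) <= D / B.
  apply: le_psi; last exact: hD2.
  - by apply: measurable_funM => //; apply: measurable_funM => //; exact: measurable_inner2.
  - by move=> x; rewrite mulr_ge0 // divr_ge0 ?inner_ge0 // ltW.
  - apply: mgrowthZ; under eq_fun do rewrite mulrC.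
    by apply: mgrowthZ; exact: mgrowth_norm2.
have DB0 : 0 <= D / B by rewrite divr_ge0 // ltW.
apply: whp_sub (one_sided_uniform beta t _ _ psi b0 trb mpsi psi01 psim DB0 h1 h2).
move=> w h v v1; have := h v v1.
have E (F : 'I_n -> R) : \sum_(j < n) Num.max (Num.min (F j) B - B') 0
    = B * \sum_(j < n) psi (F j).
  by rewrite mulr_sumr; apply: eq_bigr => j _; rewrite /psi mulrC divfK // gt_eqF.
rewrite E; set A := \sum_(j < n) psi _ => hA.
apply: (@le_trans _ _ (B * (6 * n%:R * (D / B) + 2 * (beta + t) + 3 * n%:R * (D / B) + t))).
  by rewrite ler_wpM2l // ltW.
have -> : B * (6 * n%:R * (D / B) + 2 * (beta + t) + 3 * n%:R * (D / B) + t) =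
   9 * n%:R * (B / B) * D + B * (2 * beta + 3 * t) by ring.
by rewrite divff ?gt_eqF // mulr1.
Qed.

End Concentration.

(** * Trimmed sums *)

Section TrimmedSums.
Context {R : realType} {n : nat}.
Implicit Types (z g : 'I_n -> R) (S : {set 'I_n}).

(** The initial value of the minimum is the term of the full index set, which is always among the
    candidates. *)
Definition trim (k : nat) z : R :=
  \big[Num.min/(\sum_i z i)]_(S : {set 'I_n} | (#|~: S| <= k)%N) \sum_(i in S) z i.

Lemma trim_le k z S : (#|~: S| <= k)%N -> trim k z <= \sum_(i in S) z i.
Proof. by move=> Sk; apply: bigmin_le_cond. Qed.

Lemma trim_ge k z u : (forall S, (#|~: S| <= k)%N -> u <= \sum_(i in S) z i) ->
  u <= trim k z.
Proof.
move=> h; rewrite /trim; elim/big_rec : _ => [|S x Sk ux]; last by rewrite le_min h.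
have := h [set: 'I_n]%SET; rewrite finset.setCT cards0 => /(_ isT).
by under eq_bigl do rewrite inE.
Qed.

Lemma trim_mono k k' z : (k <= k')%N -> trim k' z <= trim k z.
Proof. by move=> kk; apply: trim_ge => S Sk; apply: trim_le; exact: leq_trans kk. Qed.

Lemma trim_ge0 k z : (forall i, 0 <= z i) -> 0 <= trim k z.
Proof. by move=> z0; apply: trim_ge => S _; apply: sumr_ge0. Qed.

Lemma trim_le_select k z (W : pred 'I_n) : (#|[set i | ~~ W i]%SET| <= k)%N ->
  trim k z <= \sum_i (W i)%:R * z i.
Proof.
move=> Wk; have -> : \sum_i (W i)%:R * z i = \sum_(i in [set i | W i]%SET) z i.
  rewrite [RHS]big_mkcond; apply: eq_bigr => i _; rewrite inE.
  by case: (W i); rewrite ?mul1r ?mul0r.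
apply: trim_le; rewrite (_ : ~: _ = [set i | ~~ W i]%SET) //.
by apply/setP => i; rewrite !inE.
Qed.

Lemma card_le_sum (W : pred 'I_n) (F : 'I_n -> R) : (forall i, 0 <= F i) ->
  (forall i, W i -> 1 <= F i) -> #|[set i | W i]%SET|%:R <= \sum_i F i.
Proof.
move=> F0 WF; rewrite -sum1_card natr_sum big_mkcond; apply: ler_sum => i _.
by rewrite inE; case: ifP => // /WF.
Qed.

(** The capped sum leaves room for at most [k] indices with [z i > B]; deleting exactly these leaves
    a sum below the capped one. *)
Lemma trim_le_min k z B : (forall i, 0 <= z i) -> 0 < B ->
  \sum_i Num.min (z i) B <= k%:R * B -> trim k z <= \sum_i Num.min (z i) B.
Proof.
move=> z0 B0 h; pose W : pred 'I_n := fun i => z i <= B.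
apply: (@le_trans _ _ (\sum_i (W i)%:R * z i)).
  apply: trim_le_select.
  rewrite -(ler_nat R); apply: (@le_trans _ _ (\sum_i Num.min (z i) B / B)).
    apply: card_le_sum => i; first by rewrite divr_ge0 ?le_min ?z0 ?ltW.
    by rewrite /W -ltNge => /ltW Bz; rewrite ler_pdivlMr // mul1r le_min Bz lexx.
  by rewrite -mulr_suml ler_pdivrMr.
apply: ler_sum => i _; rewrite /W; case: (leP (z i) B) => [zB|_]; first by rewrite mul1r.
by rewrite mul0r ltW.
Qed.

(** A deleted index removes at most [B] plus the excess of [g i] over [B]. *)
Lemma trim_ge_excess k z g B : (forall i, 0 <= g i <= z i) -> 0 <= B ->
  \sum_i g i - k%:R * B - \sum_i Num.max (g i - B) 0 <= trim k z.
Proof.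
move=> gz B0; apply: trim_ge => S Sk.
apply: (@le_trans _ _ (\sum_(i in S) g i)); last first.
  by apply: ler_sum => i _; case/andP: (gz i).
rewrite [X in X - _ - _](bigID (mem S)) /= -!addrA gerDl.
have h1 : \sum_(i | i \notin S) g i <= \sum_(i | i \notin S) (B + Num.max (g i - B) 0).
  by apply: ler_sum => i _; rewrite -lerBlDl le_max lexx.
have h2 : \sum_(i | i \notin S) (B + Num.max (g i - B) 0) =
    #|~: S|%:R * B + \sum_(i | i \notin S) Num.max (g i - B) 0.
  rewrite big_split /= sumr_const mulr_natl; congr (_ *+ _ + _).
  by apply: eq_card => i; rewrite !inE.
have h3 : \sum_(i | i \notin S) Num.max (g i - B) 0 <= \sum_i Num.max (g i - B) 0.
  rewrite [leRHS](bigID (mem S)) /= lerDr; apply: sumr_ge0 => i _.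
  by rewrite le_max lexx orbT.
have h4 : #|~: S|%:R * B <= k%:R * B by rewrite ler_wpM2r // ler_nat.
lra.
Qed.

(** The additional budget deletes the indices where the families disagree; what remains is part of a
    trimmed sum of [z']. *)
Lemma trim_perturb k h z z' : (forall i, 0 <= z' i) ->
  (#|[set i | z i != z' i]%SET| <= h)%N -> trim (k + h) z <= trim k z'.
Proof.
move=> z0 hh; apply: trim_ge => S Sk.
set H := [set i | z i != z' i]%SET in hh *.
apply: (@le_trans _ _ (\sum_(i in S :\: H) z i)).
  apply: trim_le; rewrite finset.setCD; apply: leq_trans (leq_card_setU _ _) _.
  exact: leq_add.
rewrite [leRHS](bigID (mem H)) /= ler_wpDl ?sumr_ge0 //.
rewrite le_eqVlt; apply/orP; left; apply/eqP.
apply: eq_big => [i|i]; first by rewrite !inE andbC.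
by rewrite !inE => /andP[/negPn/eqP].
Qed.

Lemma measurable_trim (dT : measure_display) (T : measurableType dT) k (Z : 'I_n -> T -> R) :
  (forall i, measurable_fun setT (Z i)) -> measurable_fun setT (fun w => trim k (Z^~ w)).
Proof.
move=> mZ; rewrite /trim.
have m (s : seq {set 'I_n}) : measurable_fun setT (fun w =>
    \big[Num.min/(\sum_i Z i w)]_(S <- s | (#|~: S| <= k)%N) \sum_(i in S) Z i w).
  elim: s => [|S s IH].
    by under eq_fun do rewrite big_nil; apply: measurable_sum.
  under eq_fun do rewrite big_cons.
  have [_|_] := boolP (#|~: S| <= k)%N; last exact: IH.
  apply: measurable_minr => //.
  under eq_fun do rewrite -big_filter.
  exact: measurable_sum.
exact: m.
Qed.

End TrimmedSums.

(** * Trimmed quadratic forms of a contaminated sample *)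

Section TrimmedForms.
Context {R : realType} {d n : nat}.
Implicit Types (x y : 'I_n -> 'cV[R]_d) (v : 'cV[R]_d).

Definition trim_form k y v : R := trim k (fun i => inner (y i) v ^+ 2).
Definition trim_norm k y : R := trim k (fun i => inner (y i) (y i)).
Definition differ x y : nat := #|[set i | y i != x i]%SET|.

Lemma trim_form_ge0 k y v : 0 <= trim_form k y v.
Proof. by apply: trim_ge0 => i; exact: sqr_ge0. Qed.

Lemma trim_form_perturb k h x y v : (differ x y <= h)%N ->
  trim_form (k + h) y v <= trim_form k x v /\ trim_form (k + h) x v <= trim_form k y v.
Proof.
move=> hh; split; apply: trim_perturb => [i|]; rewrite ?sqr_ge0 //.
  apply: leq_trans hh; apply: subset_leq_card; apply/fintype.subsetP => i; rewrite !inE.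
  by apply: contraNneq => ->.
apply: leq_trans hh; apply: subset_leq_card; apply/fintype.subsetP => i; rewrite !inE.
by apply: contraNneq => ->.
Qed.

Lemma trim_norm_perturb k h x y : (differ x y <= h)%N ->
  trim_norm (k + h) y <= trim_norm k x /\ trim_norm (k + h) x <= trim_norm k y.
Proof.
move=> hh; split; apply: trim_perturb => [i|]; rewrite ?inner_ge0 //.
  apply: leq_trans hh; apply: subset_leq_card; apply/fintype.subsetP => i; rewrite !inE.
  by apply: contraNneq => ->.
apply: leq_trans hh; apply: subset_leq_card; apply/fintype.subsetP => i; rewrite !inE.
by apply: contraNneq => ->.
Qed.

Context (kap : nat).
Hypothesis kap_large : 78 * 1000 + 1 <= kap%:R :> R.

(* A budget m passes when the trimmed trace is at most m times the trimmed
   operator norm, up to a constant; m then behaves like an upper bound for the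
   effective rank. *)
Definition passes_at (m : nat) y v : Prop :=
  trim_norm (5 * m) y <= m%:R / (16 * 100) * trim_form (kap * m) y v.

(** Everything is measured in units of [B m]. Truncation at [B] bounds each form by [96 * 120 + 20]
    units; through the passing direction the truncated trace divided by [m] is at most 13.3 units,
    hence [n (phi - s)] is below 29. As [n phi] is at least 60 units, [n s] exceeds 31 of them, and
    the first bound becomes one by [385 n s]. *)
Lemma passes_bound x y (m h : nat) (B s phi : R) v0 :
  (differ x y <= h)%N -> (h <= m)%N -> (0 < m)%N -> 0 < B ->
  (forall v, inner v v <= 1 ->
     \sum_i Num.min (inner (x i) v ^+ 2) B <= 96 * n%:R * phi + B * (2 * m%:R + 18 * m%:R)) ->
  n%:R * (phi - s) <= 2 * (\sum_i Num.min (inner (x i) (x i) / m%:R) B) + 2 * m%:R * B ->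
  60 * (B * m%:R) <= n%:R * phi <= 120 * (B * m%:R) ->
  inner v0 v0 <= 1 -> passes_at m y v0 ->
  forall v, inner v v <= 1 -> trim_form (kap * m) y v <= 385 * (n%:R * s).
Proof.
move=> xy hm m0 B0 hA hN /andP[phi1 phi2] v01 pass.
have mR : 1 <= m%:R :> R by rewrite ler1n.
have Bm0 : 0 < B * m%:R by rewrite mulr_gt0 // ltr0n.
have xym : (differ x y <= m)%N by exact: leq_trans hm.
have kapm : (kap * m = (kap - 1) * m + m)%N.
  by rewrite -mulSnr -subSn ?subSS ?subn0 // lt0n -(eqr_nat R); apply/eqP => k0; move: kap_large; rewrite k0; lra.
have kap1 : (kap - 1)%:R = kap%:R - 1 :> R.
  by rewrite natrB // lt0n -(eqr_nat R); apply/eqP => k0; move: kap_large; rewrite k0; lra.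
have up v : inner v v <= 1 -> trim_form (kap * m) y v <= (115 * 100 + 40) * (B * m%:R).
  move=> v1; rewrite kapm; have [h1 _] := trim_form_perturb ((kap - 1) * m) m x y v xym.
  apply: le_trans h1 _; have := hA v v1 => hAv.
  apply: (@le_trans _ _ (\sum_i Num.min (inner (x i) v ^+ 2) B)); last lra.
  apply: trim_le_min => //; first by move=> i; exact: sqr_ge0.
  rewrite natrM kap1 mulrAC [B * _]mulrC in Bm0 hAv *.
  have := kap_large => kl.
  have : (78 * 1000) * (m%:R * B) <= (kap%:R - 1) * (m%:R * B) by rewrite ler_wpM2r ?(ltW Bm0) //; lra.
  lra.
have low : m%:R * (\sum_i Num.min (inner (x i) (x i) / m%:R) B) - 6 * m%:R * (m%:R * B)
    <= trim_norm (5 * m) y.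
  have [_ h2] := trim_norm_perturb (5 * m) m x y xym.
  apply: le_trans h2.
  have e i : Num.min (inner (x i) (x i)) (m%:R * B) = m%:R * Num.min (inner (x i) (x i) / m%:R) B.
    rewrite minr_pMr ?ltW ?ltr0n // mulrCA divff ?mulr1 //.
    by rewrite pnatr_eq0 -lt0n.
  have mB0 : 0 <= m%:R * B by rewrite mulr_ge0 // ltW.
  have := trim_ge_excess (5 * m + m) (fun i => inner (x i) (x i))
    (fun i => Num.min (inner (x i) (x i)) (m%:R * B)) (m%:R * B) _ mB0.
  rewrite [X in _ - X <= _]big1 ?subr0; last first.
    by move=> i _; apply/max_idPr; rewrite subr_le0 ge_min lexx orbT.
  under eq_bigr do rewrite e.
  rewrite -mulr_sumr natrD natrM => hx; apply: le_trans (hx _); last first.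
    by move=> i; rewrite le_min inner_ge0 mB0 ge_min lexx.
  by rewrite lerD2l lerN2; lra.
have hp := up v0 v01.
set Sm := \sum_i Num.min (_ / _) B in hN low.
have key : Sm - 6 * (m%:R * B) <= (115 * 100 + 40) / (16 * 100) * (B * m%:R).
  have : m%:R * (Sm - 6 * (m%:R * B)) <= m%:R * ((115 * 100 + 40) / (16 * 100) * (B * m%:R)).
    apply: (@le_trans _ _ (trim_norm (5 * m) y)); first by lra.
    apply: le_trans pass _.
    have : m%:R / (16 * 100) * trim_form (kap * m) y v0 <= m%:R / (16 * 100) * ((115 * 100 + 40) * (B * m%:R)).
      by rewrite ler_wpM2l // divr_ge0.
    lra.
  by rewrite ler_pM2l // ltr0n.
move=> v v1; apply: le_trans (up v v1) _.
lra.
Qed.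

End TrimmedForms.

(** A substitute for continuity: [B] lies above half the supremum of the levels with
    [c * B <= phi B], so the inequality fails at [2 * B], and monotonicity of [phi] carries the
    resulting upper bound back to [B]. *)
Lemma exists_balanced_level (R : realType) (phi : R -> R) (s M c : R) :
  0 < s -> 0 < c -> (forall B, 0 < B -> s <= phi B <= M) ->
  (forall B B', 0 < B -> B <= B' -> phi B <= phi B') ->
  exists B, [/\ 0 < B, c * B <= phi B & phi B <= 2 * (c * B)].
Proof.
move=> s0 c0 phiM phim.
pose S := [set B : R | 0 < B /\ c * B <= phi B].
have sc : 0 < s / c by rewrite divr_gt0.
have S0 : S (s / c).
  by split=> //; rewrite mulrC divfK ?gt_eqF //; case/andP: (phiM _ sc).
have Sub : has_ubound S.
  exists (M / c) => B [B0 cB]; rewrite ler_pdivlMr // mulrC.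
  by apply: le_trans cB _; case/andP: (phiM _ B0).
have supS : has_sup S by split=> //; exists (s / c).
have sup0 : 0 < sup S by apply: lt_le_trans sc _; exact: ub_le_sup.
have sup2 : 0 < sup S / 2 by rewrite divr_gt0.
have [B [B0 cB] hB] := @sup_adherent R S _ sup2 supS.
exists B; split=> //.
have [h|h] := leP (phi (2 * B)) (2 * (c * B)).
  by apply: le_trans h; apply: phim => //; lra.
have B20 : 0 < 2 * B by lra.
have : 2 * B <= sup S by apply: ub_le_sup => //; split=> //; lra.
lra.
Qed.

(** * Deterministic analysis of the least passing budget *)

Section Selection.
Context {R : realType} {d n : nat} (kap : nat) (cb ct cr : R).
Hypotheses (cb_large : 256 * 100 <= cb) (ct0 : 0 <= ct) (cr0 : 0 <= cr)
  (kap_ge : 3 * cr + 1 <= kap%:R).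
Context (D : set 'cV[R]_d) (x y : 'I_n -> 'cV[R]_d) (q : 'cV[R]_d -> R).
Context (s tr K eta l lambda eps B4 Bp delta4 deltap : R) (h : nat).

(** [ct] comes from the two-sided estimate, [14 = 9 + 5] from the tail estimate, and the rest from
    deleting [(kap + 1) m] indices at the good budget. *)
Definition C_lower : R := ct + 14 + (kap%:R + 1) * (2 * cb).
(** The factor is [260 = 4 * 65]: with [eps <= c s] and [delta4 <= 64 c s] the lower bound loses at
    most [s / 4]. *)
Definition c_regime : R := (260 * C_lower)^-1.
(** The second term serves the small samples, where [s] is at most [eps / c_regime] and a passing
    form is at most [385 n s]. *)
Definition C_select : R := C_lower + 385 / c_regime.

Definition admissible (m : nat) : Prop := eta * n%:R + l <= m%:R.
Definition passes (m : nat) : Prop := exists2 v, D v & passes_at kap m y v.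

Let b := tr / s + l.

Definition good_budget : nat := (Num.truncn (cb * (eta * n%:R + b))).+1.

Hypotheses (n0 : (0 < n)%N) (s0 : 0 < s) (tr0 : 0 < tr) (K1 : 1 <= K) (eta0 : 0 <= eta)
  (l1 : 1 <= l) (lam0 : 0 < lambda) (eps0 : 0 < eps).
(* lambda^-1 is the truncation level and eps the resulting error. *)
Hypothesis lam_eps : b = n%:R * (lambda * eps).
Hypothesis epsE : eps ^+ 2 * n%:R = s ^+ 2 * (K * b).
Hypotheses (Dle : forall v, D v -> inner v v <= 1) (Dhalf : exists2 v, D v & s / 2 <= q v).
Hypothesis qs : forall v, inner v v <= 1 -> 0 <= q v <= s.
Hypotheses (xy : (differ x y <= h)%N) (h_eta : h%:R <= eta * n%:R).
Hypothesis eta_small : K * eta <= c_regime ^+ 2.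
Hypotheses (B40 : 0 <= B4) (Bp0 : 0 <= Bp) (d40 : 0 <= delta4) (dp0 : 0 <= deltap)
  (B4eta : eta * B4 <= delta4) (Bpeta : eta * Bp <= deltap)
  (d4small : delta4 ^+ 2 <= 64 ^+ 2 * (s ^+ 2 * (K * eta))).
Hypothesis passing : forall m, admissible m -> (m < n)%N -> passes m ->
  forall v, inner v v <= 1 -> trim_form (kap * m) y v <= 385 * (n%:R * s).
Hypothesis two_sided : forall v, inner v v <= 1 ->
  \sum_(j < n) remainder4 b lambda v (x j) <= cr * b /\
  `| lambda * (\sum_(j < n) (well_sized b lambda v (x j))%:R * inner (x j) v ^+ 2)
     - n%:R * (lambda * q v) | <= ct * b.
Hypothesis tail4 : forall v, inner v v <= 1 ->
  \sum_(j < n) Num.max (Num.min (inner (x j) v ^+ 2) lambda^-1 - B4) 0 <=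
      9 * n%:R * delta4 + lambda^-1 * (5 * b).
Hypothesis tailp : forall v, inner v v <= 1 ->
  \sum_(j < n) Num.max (Num.min (inner (x j) v ^+ 2) lambda^-1 - Bp) 0 <=
      9 * n%:R * deltap + lambda^-1 * (5 * b).
Let M := n%:R * tr / good_budget%:R.
Hypothesis norm_upper : \sum_j Num.min (inner (x j) (x j)) M <= 4 * (n%:R * tr).
Hypothesis norm_lower : n%:R * tr / 2 <=
  2 * (\sum_j Num.min (inner (x j) (x j)) (2 * K * tr)) + 4 * (l * K * tr).

Let nR : 0 < n%:R :> R. Proof. by rewrite ltr0n. Qed.
Let b1 : 1 <= b. Proof. by rewrite /b; have : 0 < tr / s by [rewrite divr_gt0]; move: l1; lra. Qed.
Let bl : l <= b. Proof. by rewrite /b lerDr divr_ge0 // ltW. Qed.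
Let br : tr / s <= b. Proof. by rewrite /b lerDl; apply: le_trans l1. Qed.

Let blam : lambda^-1 * b = n%:R * eps.
Proof. by rewrite lam_eps; field; rewrite gt_eqF. Qed.

Let etan0 : 0 <= eta * n%:R. Proof. by rewrite mulr_ge0. Qed.

Let cb0 : 0 < cb. Proof. by apply: lt_le_trans cb_large; lra. Qed.

Let cbb (u : R) : 0 <= u -> u <= cb * u.
Proof.
move=> u0; apply: ler_peMl => //; apply: le_trans cb_large; lra.
Qed.

Let etanb : 1 <= eta * n%:R + b.
Proof. by have := b1; have := etan0; lra. Qed.

Lemma good_budget_gt : cb * (eta * n%:R + b) < good_budget%:R.
Proof. exact: truncnS_gt. Qed.

Lemma good_budget_le : good_budget%:R <= 2 * cb * (eta * n%:R + b).
Proof.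
rewrite /good_budget -natr1.
have h0 : 0 <= cb * (eta * n%:R + b).
  apply: mulr_ge0; first exact: ltW.
  exact: le_trans ler01 etanb.
have /andP[+ _] := truncn_itv h0; have := cbb _ (le_trans ler01 etanb); have := etanb.
move: (_ + b) ((Num.truncn _)%:R) => u v; lra.
Qed.

Lemma good_budget_admissible : admissible good_budget.
Proof.
apply: le_trans (ltW good_budget_gt); apply: le_trans (cbb _ (le_trans ler01 etanb)).
by rewrite lerD2l bl.
Qed.

Lemma differ_admissible m : admissible m -> (h <= m)%N.
Proof.
by rewrite /admissible => am; rewrite -(ler_nat R); apply: le_trans h_eta _; move: l1 am; lra.
Qed.

(** Contamination is absorbed by [m] further deletions, and each of the [(kap + 1) m] deletions
    costs at most [B'] apart from the tail. The minimum [B'] of [B] and [lambda^-1] serves both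
    parts of the budget: [eta * n * B' <= n * delta] and [b * B' <= n * eps]. *)
Lemma trim_form_lower_gen v m B delta : inner v v <= 1 -> (h <= m)%N -> 0 <= B ->
  m%:R <= 2 * cb * (eta * n%:R + b) -> eta * B <= delta -> 0 <= delta ->
  \sum_(j < n) Num.max (Num.min (inner (x j) v ^+ 2) lambda^-1 - B) 0 <=
      9 * n%:R * delta + lambda^-1 * (5 * b) ->
  n%:R * q v - n%:R * (C_lower * (eps + delta)) <= trim_form (kap * m) y v.
Proof.
move=> v1 hm B0 m_le etaB delta0 tail.
have li0 : 0 < lambda^-1 by rewrite invr_gt0.
pose B' := Num.min B lambda^-1.
have B'0 : 0 <= B' by rewrite le_min B0 ltW.
have B'B : B' <= B by rewrite ge_min lexx.
have B'l : B' <= lambda^-1 by rewrite ge_min lexx orbT.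
have xym : (differ x y <= m)%N by exact: leq_trans hm.
have [_ h2] := trim_form_perturb (kap * m) m x y v xym.
apply: le_trans h2.
pose g j := (well_sized b lambda v (x j))%:R * inner (x j) v ^+ 2.
have g01 j : 0 <= g j <= inner (x j) v ^+ 2.
  rewrite /g; case: (well_sized _ _ _ _); rewrite ?mul1r ?mul0r ?lexx ?sqr_ge0 //.
have gmin j : g j <= Num.min (inner (x j) v ^+ 2) lambda^-1.
  rewrite le_min; case/andP: (g01 j) => _ -> /=.
  rewrite /g; case: (boolP (well_sized _ _ _ _)) => [/andP[w1 _]|_]; last by rewrite mul0r ltW.
  by rewrite mul1r -[leRHS]mul1r ler_pdivlMr // mulrC.
have tail' : \sum_j Num.max (g j - B') 0 <= 9 * n%:R * delta + lambda^-1 * (5 * b).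
  rewrite /B'; case: (leP B lambda^-1) => hB.
    apply: le_trans tail; apply: ler_sum => j _; apply: le_max2 => //.
    by rewrite lerD2r.
  rewrite big1; first by rewrite addr_ge0 ?mulr_ge0 ?(ltW li0) // (le_trans ler01).
  move=> j _; apply/max_idPr; rewrite subr_le0; apply: le_trans (gmin j) _.
  by rewrite ge_min lexx orbT.
apply: le_trans (trim_ge_excess _ _ g B' g01 B'0).
have [_ /ler_normlP[t1 _]] := two_sided v v1.
have low : n%:R * q v - ct * (n%:R * eps) <= \sum_j g j.
  rewrite -blam -(ler_pM2l lam0).
  have -> : lambda * (n%:R * q v - ct * (lambda^-1 * b)) =
     n%:R * (lambda * q v) - ct * b by field; rewrite gt_eqF.
  rewrite /g; move: t1; set G := lambda * _; lra.
have cap : (kap * m + m)%:R * B' <= (kap%:R + 1) * (2 * cb) * (n%:R * (eps + delta)).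
  rewrite natrD natrM.
  have -> : (kap%:R * m%:R + m%:R) * B' = (kap%:R + 1) * (m%:R * B') by ring.
  rewrite -mulrA; apply: ler_wpM2l; first exact: addr_ge0.
  apply: (@le_trans _ _ (2 * cb * (eta * n%:R + b) * B')); first by rewrite ler_wpM2r.
  have -> : 2 * cb * (eta * n%:R + b) * B' = 2 * cb * (n%:R * (eta * B') + b * B') by ring.
  apply: ler_wpM2l; first by rewrite mulr_ge0 // ltW.
  rewrite mulrDr addrC; apply: lerD.
    by rewrite -blam mulrC ler_wpM2r // (le_trans ler01 b1).
  by apply: ler_wpM2l => //; apply: le_trans etaB; exact: ler_wpM2l.
have -> : n%:R * (C_lower * (eps + delta)) =
  (ct + 14) * (n%:R * (eps + delta))
   + (kap%:R + 1) * (2 * cb) * (n%:R * (eps + delta)) by rewrite /C_lower; ring.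
have e5 : lambda^-1 * (5 * b) = 5 * (n%:R * eps) by rewrite -blam; ring.
rewrite e5 -[9 * _ * _]mulrA in tail'.
have nd : 0 <= n%:R * delta by rewrite mulr_ge0.
have ne : 0 <= n%:R * eps by rewrite mulr_ge0 // ltW.
have : 0 <= ct * (n%:R * delta) by exact: mulr_ge0.
move: tail' low cap; rewrite !mulrDr.
move: (\sum_j Num.max _ _) (\sum_j g j) (_%:R * B')
  (_ * (2 * cb) * _) (_ * (2 * cb) * _) => t G c e2 e3.
move: (n%:R * delta) nd (n%:R * eps) ne => nd nd0 ne ne0; lra.
Qed.

Let cR := c_regime.

Let kap0 : 0 <= (kap%:R : R). Proof. by []. Qed.

Let C_lower_ge : 2 * cb <= C_lower.
Proof.
have cb2 : 0 <= 2 * cb by rewrite mulr_ge0 // ltW.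
have -> : C_lower = ct + 14 + kap%:R * (2 * cb) + 2 * cb by rewrite /C_lower; ring.
by rewrite lerDr; apply: addr_ge0; [exact: addr_ge0 | exact: mulr_ge0].
Qed.

Let C_lower_gt0 : 0 < C_lower.
Proof. by apply: lt_le_trans C_lower_ge; rewrite mulr_gt0. Qed.

Let cR0 : 0 < cR.
Proof.
rewrite /cR /c_regime invr_gt0; move: C_lower C_lower_gt0 => C C0.
by rewrite mulr_gt0 ?ltr0n.
Qed.

Let cR_eq : C_lower * (260 * cR) = 1.
Proof.
rewrite /cR /c_regime; move: C_lower C_lower_gt0 => C C0.
by field; rewrite gt_eqF.
Qed.

Let cR_small : 2 * cb * (260 * cR) <= 1.
Proof.
rewrite -[leRHS]cR_eq; have := C_lower_ge; have := cR0; move: C_lower cR => C c c0 CC.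
have c1 : 0 <= 260 * c by rewrite mulr_ge0 ?ler0n // ltW.
exact: ler_wpM2r c1 _ _ CC.
Qed.

Let good := K * b <= cR ^+ 2 * n%:R.

Let K0 : 0 < K := lt_le_trans ltr01 K1.

Let mstar0 : 0 < good_budget%:R :> R. Proof. by rewrite ltr0n. Qed.

Lemma good_eps : good -> eps <= cR * s.
Proof.
move=> g; rewrite -(@ler_pXn2r _ 2) ?nnegrE ?mulr_ge0 ?(ltW cR0) ?(ltW s0) ?(ltW eps0) //.
rewrite -(ler_pM2r nR) epsE exprMn.
have -> : cR ^+ 2 * s ^+ 2 * n%:R = s ^+ 2 * (cR ^+ 2 * n%:R) by ring.
by rewrite ler_wpM2l // sqr_ge0.
Qed.

Lemma delta4_le : delta4 <= 64 * (cR * s).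
Proof.
rewrite -(@ler_pXn2r _ 2) ?nnegrE ?mulr_ge0 ?(ltW cR0) ?(ltW s0) //.
apply: le_trans d4small _.
have -> : (64 * (cR * s)) ^+ 2 = 64 ^+ 2 * (s ^+ 2 * cR ^+ 2) by ring.
by rewrite ler_wpM2l // ler_wpM2l // sqr_ge0.
Qed.

Lemma good_error : good -> C_lower * (eps + delta4) <= s / 4.
Proof.
move=> g; have e := good_eps g; have e4 := delta4_le.
apply: (@le_trans _ _ (C_lower * (65 * (cR * s)))); first by rewrite ler_pM2l //; lra.
have -> : C_lower * (65 * (cR * s)) = C_lower * (260 * cR) * (s / 4) by field.
by rewrite cR_eq mul1r.
Qed.

(** [112 = 8 * 14]: with norms capped at [2 K tr], deleting [6 m] indices costs [12 m K tr], the
    lower estimate of the trace another [2 m K tr], and together they must stay below [n tr / 8]. *)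
Lemma good_budget_small : good -> 112 * (good_budget%:R * K) <= n%:R.
Proof.
move=> g.
apply: (@le_trans _ _ (112 * (2 * cb * (eta * n%:R + b) * K))).
  by rewrite ler_wpM2l // ler_wpM2r ?(ltW K0) // good_budget_le.
have e1 : K * eta * n%:R <= cR ^+ 2 * n%:R by rewrite ler_wpM2r.
have c1 : cR <= 1.
  have h1 : cR <= cb * cR by apply: cbb; exact: ltW.
  have := cR_small; have := cR0; lra.
have c2 : 448 * (cb * (cR * cR)) <= 1.
  have h1 : cb * (cR * cR) <= cb * (cR * 1).
    by rewrite !ler_wpM2l // ltW.
  have h2 : 0 <= cb * cR by rewrite mulr_ge0 // ltW.
  have := cR_small; lra.
apply: (@le_trans _ _ (448 * (cb * (cR * cR)) * n%:R)); last by rewrite ler_piMl.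
have h1 : 2 * cb * (K * eta * n%:R + K * b) <= 2 * cb * (cR ^+ 2 * n%:R + cR ^+ 2 * n%:R).
  by apply: ler_wpM2l; [rewrite mulr_ge0 // ltW | exact: lerD].
lra.
Qed.

Lemma good_budget_lt : good -> (good_budget < n)%N.
Proof.
move=> g; have := good_budget_small g; rewrite -(ltr_nat R).
have : good_budget%:R <= good_budget%:R * K by rewrite ler_peMr // ltW.
have := mstar0; lra.
Qed.

(** The trimmed trace is at most [4 n tr], and in a direction where [q] is at least [s / 2] the
    trimmed form is at least [n s / 4]. Passing thus reduces to [m s >= 16 * 1600 * tr], which is
    the lower bound imposed on [cb]. *)
Lemma good_passes : good -> passes good_budget.
Proof.
move=> g; have hm : (h <= good_budget)%N by apply: differ_admissible good_budget_admissible.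
have [v Dv hv] := Dhalf; exists v => //; have v1 := Dle v Dv.
have low := trim_form_lower_gen v good_budget B4 delta4 v1 hm B40 good_budget_le B4eta d40 (tail4 v v1).
have low' : n%:R * (s / 4) <= trim_form (kap * good_budget) y v.
  apply: le_trans low; rewrite -mulrBr ler_wpM2l //.
  have := good_error g; lra.
have xym : (differ x y <= good_budget)%N by exact: leq_trans hm.
have up : trim_norm (5 * good_budget) y <= 4 * (n%:R * tr).
  have [h1 _] := trim_norm_perturb (4 * good_budget) good_budget x y xym.
  rewrite (_ : 5 * good_budget = 4 * good_budget + good_budget)%N; last by rewrite mulSnr.
  apply: le_trans h1 _; apply: le_trans norm_upper.
  have M0 : 0 < M by rewrite /M divr_gt0 ?mulr_gt0.
  apply: trim_le_min => // [i|]; first exact: inner_ge0.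
  apply: le_trans norm_upper _; rewrite natrM -mulrA ler_wpM2l // /M mulrCA divff ?mulr1 //.
  by rewrite gt_eqF.
apply: le_trans up _.
have key : 256 * 100 * (tr / s) <= good_budget%:R.
  apply: le_trans (ltW good_budget_gt); apply: ler_pM cb_large _.
  - by rewrite mulr_ge0 ?ler0n.
  - by rewrite divr_ge0 // ltW.
  - by apply: le_trans br _; rewrite lerDr.
have key2 : 256 * 100 * tr <= good_budget%:R * s.
  have -> : 256 * 100 * tr = 256 * 100 * (tr / s) * s by field; rewrite gt_eqF.
  by apply: ler_wpM2r => //; exact: ltW.
apply: (@le_trans _ _ (good_budget%:R / (16 * 100) * (n%:R * (s / 4)))); last first.
  by rewrite ler_wpM2l // divr_ge0.
have : n%:R * (256 * 100 * tr) <= n%:R * (good_budget%:R * s) by rewrite ler_wpM2l.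
lra.
Qed.

(** After trimming at the good budget at least [n tr / 8] of the trace is left, and trimming at [m]
    leaves no less. The passing inequality and the bound [385 n s] then give [tr / s <= 2 m], while
    admissibility gives [l <= m]. *)
Lemma budget_ge m : good -> admissible m -> (m < n)%N -> passes m -> (m <= good_budget)%N ->
  b <= 3 * m%:R.
Proof.
move=> g am mn pm mm; have [v0 Dv0 pass0] := pm.
have hm : (h <= good_budget)%N by apply: differ_admissible good_budget_admissible.
have xym : (differ x y <= good_budget)%N by exact: leq_trans hm.
have low : n%:R * tr / 8 <= trim_norm (5 * good_budget) y.
  have [_ h1] := trim_norm_perturb (5 * good_budget) good_budget x y xym.
  apply: le_trans h1.
  have M0 : 0 <= 2 * K * tr by rewrite mulr_ge0 ?mulr_ge0 // ltW.
  have := trim_ge_excess (5 * good_budget + good_budget) (fun i => inner (x i) (x i))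
    (fun i => Num.min (inner (x i) (x i)) (2 * K * tr)) (2 * K * tr) _ M0.
  rewrite [X in _ - X <= _]big1 ?subr0; last first.
    by move=> i _; apply/max_idPr; rewrite subr_le0 ge_min lexx orbT.
  move=> hx; apply: le_trans (hx _); last first.
    by move=> i; rewrite le_min inner_ge0 M0 ge_min lexx.
  have gs := good_budget_small g.
  have gs2 : 112 * (good_budget%:R * K) * tr <= n%:R * tr by rewrite ler_wpM2r // ltW.
  have lm : l * (K * tr) <= good_budget%:R * (K * tr).
    rewrite ler_wpM2r ?mulr_ge0 ?(ltW K0) ?(ltW tr0) //.
    apply: le_trans bl _; apply: le_trans (ltW good_budget_gt).
    by apply: le_trans (cbb _ (le_trans ler01 etanb)); rewrite lerDr.
  have := norm_lower; rewrite natrD natrM.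
  set Sm := \sum_j Num.min _ _; lra.
have mono : trim_norm (5 * good_budget) y <= trim_norm (5 * m) y.
  by apply: trim_mono; rewrite leq_mul2l.
have up := passing m am mn pm v0 (Dle v0 Dv0).
have pass1 : n%:R * tr / 8 <= m%:R / (16 * 100) * (385 * (n%:R * s)).
  apply: le_trans low _; apply: le_trans mono _; apply: le_trans pass0 _.
  by rewrite ler_wpM2l // divr_ge0.
have trm : tr <= 2 * (m%:R * s).
  rewrite -(ler_pM2l nR).
  have : 0 <= n%:R * (m%:R * s) by rewrite !mulr_ge0 // ltW.
  lra.
have trs : tr / s <= 2 * m%:R by rewrite ler_pdivrMr // -mulrA.
have lm : l <= m%:R by apply: le_trans am; rewrite lerDr.
by rewrite /b; lra.
Qed.

(** The ill-sized points can all be deleted: they number at most [cr * b <= 3 * cr * m], which fits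
    into the [(kap - 1) m] deletions left once [m] are reserved for contamination. The kept points
    give the truncated form of the two-sided estimate. *)
Lemma good_upper m v : good -> admissible m -> (m < n)%N -> passes m -> (m <= good_budget)%N ->
  inner v v <= 1 -> trim_form (kap * m) y v <= n%:R * q v + ct * (n%:R * eps).
Proof.
move=> g am mn pm mm v1; have b3 := budget_ge m g am mn pm mm.
have xym : (differ x y <= m)%N by apply: leq_trans xy (differ_admissible m am).
have k0 : (0 < kap)%N.
  rewrite lt0n -(eqr_nat R); apply/eqP => k0.
  by have := kap_ge; have := cr0; rewrite k0; lra.
have kapm : (kap * m = (kap - 1) * m + m)%N by rewrite -mulSnr -subSn ?subSS ?subn0.
have [t1 /ler_normlP[_ t2]] := two_sided v v1.
rewrite kapm; have [h1 _] := trim_form_perturb ((kap - 1) * m) m x y v xym.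
apply: le_trans h1 _.
apply: (@le_trans _ _ (\sum_(j < n) (well_sized b lambda v (x j))%:R * inner (x j) v ^+ 2)).
  apply: trim_le_select; rewrite -(ler_nat R).
  apply: (@le_trans _ _ (\sum_(j < n) remainder4 b lambda v (x j))).
    apply: card_le_sum => j.
      rewrite /remainder4 /trunc4 addr_ge0 // le_min sqr_ge0 ler01 //.
    have big u : ~~ (lambda * u <= 1) -> trunc4 lambda u = 1.
      by rewrite -ltNge => lu; apply/min_idPr; apply: exprn_ege1; exact: ltW.
    have tr_ge u : 0 <= trunc4 lambda u by rewrite le_min sqr_ge0 ler01.
    rewrite /well_sized negb_and => /orP[bad|bad]; rewrite /remainder4.
      by rewrite big // lerDl.
    by rewrite [X in _ + X]big // lerDr.
  apply: le_trans t1 _; rewrite natrM natrB // mulr1n.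
  have kl := kap_ge.
  apply: (@le_trans _ _ (cr * (3 * m%:R))); first exact: ler_wpM2l.
  have : (3 * cr) * m%:R <= (kap%:R - 1) * m%:R by apply: ler_wpM2r => //; lra.
  lra.
rewrite -(ler_pM2l lam0) mulrDr -blam.
have -> : lambda * (ct * (lambda^-1 * b)) = ct * b by field; rewrite gt_eqF.
have -> : lambda * (n%:R * q v) = n%:R * (lambda * q v) by ring.
move: t2; set G := lambda * _; lra.
Qed.

Lemma bad_regime : ~ good -> s <= cR^-1 * eps.
Proof.
move=> /negP; rewrite -ltNge => g.
rewrite mulrC ler_pdivlMr // -(@ler_pXn2r _ 2) ?nnegrE ?mulr_ge0 ?(ltW cR0) ?(ltW s0) ?(ltW eps0) //.
rewrite -(ler_pM2r nR) epsE exprMn -mulrA ler_pM2l ?exprn_gt0 //.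
exact: ltW.
Qed.

Lemma C_select_ge : C_lower <= C_select /\ 385 * cR^-1 <= C_select.
Proof.
have := C_lower_gt0; have := cR0; rewrite /C_select -/cR; move: C_lower cR => C c c0 C0.
split; first by rewrite lerDl (divr_ge0 (ler0n _ _) (ltW c0)).
by rewrite lerDr (ltW C0).
Qed.

Lemma selected_error m v : admissible m -> (m < n)%N -> passes m ->
  (forall m', (m' < m)%N -> admissible m' -> ~ passes m') ->
  inner v v <= 1 ->
  `| trim_form (kap * m) y v - n%:R * q v | <= n%:R * (C_select * (eps + deltap)).
Proof.
move=> am mn pm minm v1; have [Cs1 Cs2] := C_select_ge.
have ed : 0 <= eps + deltap by rewrite addr_ge0 // ltW.
rewrite ler_norml.
have [g|g] := pselect good.
  have mm : (m <= good_budget)%N.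
    rewrite leqNgt; apply/negP => lt; apply: (minm _ lt good_budget_admissible).
    exact: good_passes.
  have up := good_upper m v g am mn pm mm v1.
  have hm : (h <= good_budget)%N by apply: differ_admissible good_budget_admissible.
  have low := trim_form_lower_gen v good_budget Bp deltap v1 hm Bp0 good_budget_le Bpeta dp0 (tailp v v1).
  have mono : trim_form (kap * good_budget) y v <= trim_form (kap * m) y v.
    by apply: trim_mono; rewrite leq_mul2l mm orbT.
  have c1 : n%:R * (C_lower * (eps + deltap)) <= n%:R * (C_select * (eps + deltap)).
    by rewrite ler_wpM2l // ler_wpM2r.
  have c2 : ct * (n%:R * eps) <= n%:R * (C_lower * (eps + deltap)).
    rewrite mulrCA ler_wpM2l //; apply: ler_pM; rewrite ?(ltW eps0) ?lerDl //.
    rewrite /C_lower -addrA lerDl addr_ge0 // mulr_ge0 ?addr_ge0 // mulr_ge0 //; exact: ltW.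
  by apply/andP; split; move: up low mono c1 c2; set a := trim_form _ _ _; lra.
(* Small samples: the trimmed form and [n q] both lie between 0 and [385 n s], and so does the
   distance between them. *)
have sb := bad_regime g.
have up := passing m am mn pm v v1; have t0 := trim_form_ge0 (kap * m) y v.
have /andP[q0 qls] := qs v v1.
have nq : n%:R * q v <= n%:R * s by rewrite ler_wpM2l.
have nq0 : 0 <= n%:R * q v by rewrite mulr_ge0.
have c1 : 385 * (n%:R * s) <= n%:R * (C_select * (eps + deltap)).
  have := sb; have := Cs2; have : 0 <= cR^-1 by rewrite invr_ge0 ltW.
  move: (cR^-1) C_select => c C c0' cC sc.
  rewrite mulrCA; apply: ler_wpM2l => //; apply: (@le_trans _ _ (385 * (c * eps))).
    exact: ler_wpM2l (ler0n _ _) _ _ sc.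
  rewrite mulrA; apply: ler_pM cC _; last by rewrite lerDl.
  - exact: mulr_ge0 (ler0n _ _) c0'.
  - exact: ltW.
have ns0 : 0 <= n%:R * s by rewrite mulr_ge0 // ltW.
by apply/andP; split; lra.
Qed.

(** If nothing passes, neither does the good budget, so the sample is small and the whole operator
    norm is within the allowed error; the output 0 is then acceptable. *)
Lemma none_selected : (forall m, (m < n)%N -> admissible m -> ~ passes m) ->
  s <= C_select * eps.
Proof.
move=> nopass; have [Cs1 Cs2] := C_select_ge.
have [g|g] := pselect good.
  by case: (nopass _ (good_budget_lt g) good_budget_admissible); exact: good_passes.
apply: le_trans (bad_regime g) _; rewrite ler_wpM2r ?(ltW eps0) //.
apply: le_trans Cs2; have : 0 < cR^-1 by rewrite invr_gt0.
lra.
Qed.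

End Selection.

(** * Quadratic forms and the operator norm *)

Section QuadraticForms.
Context {R : realType} {d : nat}.
Implicit Types (u v w : 'cV[R]_d) (M S : 'M[R]_d).

Lemma inner_mulmx u M v : inner u (M *m v) = \sum_i \sum_j u i 0 * M i j * v j 0.
Proof.
apply: eq_bigr => i _; rewrite mxE mulr_sumr.
by apply: eq_bigr => j _; rewrite mulrA.
Qed.

Lemma inner_mulmx_sym u M v : M^T = M -> inner u (M *m v) = inner v (M *m u).
Proof.
move=> MT; rewrite !inner_mulmx exchange_big; apply: eq_bigr => i _; apply: eq_bigr => j _ /=.
have -> : M j i = M i j by rewrite -[in LHS]MT mxE.
ring.
Qed.

Lemma opnorm_set_bounded M :
  has_ubound [set enorm (M *m v) | v in [set v : 'cV[R]_d | enorm v <= 1]].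
Proof.
exists (Num.sqrt (\sum_i inner (row i M)^T (row i M)^T)) => _ [v /= v1 <-].
apply: ler_wsqrtr; apply: ler_sum => i _.
have -> : (M *m v) i 0 = inner (row i M)^T v.
  by rewrite mxE; apply: eq_bigr => j _; rewrite !mxE.
rewrite -expr2; apply: le_trans (inner_sqr_le _ _) _.
by rewrite ler_piMr ?inner_ge0 // -enorm_le1.
Qed.

Lemma opnorm_ge M v : enorm v <= 1 -> enorm (M *m v) <= opnorm M.
Proof. by move=> v1; apply: (ub_le_sup (opnorm_set_bounded M)); exists v. Qed.

Lemma opnorm_ge0 M : 0 <= opnorm M.
Proof.
apply: le_trans (opnorm_ge M 0 _); first exact: enorm_ge0.
by rewrite enorm_le1 inner0l ler01.
Qed.

(** For symmetric [M] the bilinear form is a difference of two values of the quadratic form; the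
    parallelogram identity bounds their total, with the normalised image of [v] as second vector. *)
Lemma opnorm_le_form M c : M^T = M -> 0 <= c ->
  (forall v, inner v v <= 1 -> `|inner v (M *m v)| <= c) -> opnorm M <= c.
Proof.
move=> MT c0 hc; apply: ge_sup.
  by exists (enorm (M *m 0)), 0 => //=; rewrite enorm_le1 inner0l ler01.
have scaled w : `|inner w (M *m w)| <= c * inner w w.
  have [/inner_eq0 ->|w0] := eqVneq (inner w w) 0.
    by rewrite mulmx0 !inner0l normr0 mulr0.
  have wp : 0 < inner w w by rewrite lt_def w0 inner_ge0.
  have e2 : enorm w ^+ 2 = inner w w := enorm_sqr w.
  have e0 : 0 < enorm w by rewrite sqrtr_gt0.
  have := hc ((enorm w)^-1 *: w); rewrite -scalemxAr !innerZl !innerZr !mulrA -expr2.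
  rewrite exprVn e2 mulVf // lexx => /(_ isT).
  by rewrite normrM ger0_norm ?invr_ge0 ?inner_ge0 // mulrC ler_pdivrMr.
move=> _ [v /= v1 <-]; rewrite enorm_le1 in v1.
have [e0|e0] := eqVneq (enorm (M *m v)) 0; first by rewrite e0.
have ep : 0 < enorm (M *m v) by rewrite lt_def e0 enorm_ge0.
pose u := (enorm (M *m v))^-1 *: (M *m v).
have uu : inner u u = 1.
  by rewrite innerZl innerZr mulrA -expr2 exprVn enorm_sqr mulVf // -enorm_sqr expf_neq0.
have uM : inner u (M *m v) = enorm (M *m v).
  by rewrite innerZl -enorm_sqr expr2 mulrA mulVf ?mul1r.
rewrite -uM.
(* polarisation *)
have pol : 4 * inner u (M *m v) = inner (u + v) (M *m (u + v)) - inner (u - v) (M *m (u - v)).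
  rewrite mulmxDr mulmxBr !(innerDl, innerDr, innerNl, innerNr) (inner_mulmx_sym v M u MT).
  ring.
have h1 := scaled (u + v); have h2 := scaled (u - v).
have par : inner (u + v) (u + v) + inner (u - v) (u - v) = 2 * inner u u + 2 * inner v v.
  by rewrite !(innerDl, innerDr, innerNl, innerNr); ring.
have h3 : 4 * inner u (M *m v) <= c * (inner (u + v) (u + v) + inner (u - v) (u - v)).
  rewrite pol mulrDr; apply: lerD; first exact: le_trans (ler_norm _) h1.
  by apply: le_trans h2; rewrite -normrN ler_norm.
rewrite par uu in h3.
have h4 : c * (2 * 1 + 2 * inner v v) <= c * 4 by rewrite ler_wpM2l //; lra.
lra.
Qed.

Lemma enormZ (a : R) v : 0 <= a -> enorm (a *: v) = a * enorm v.
Proof.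
move=> a0; rewrite /enorm innerZl innerZr mulrA -expr2 sqrtrM ?sqr_ge0 //.
by rewrite sqrtr_sqr ger0_norm.
Qed.

Lemma form_le_opnorm M v : inner v (M *m v) <= opnorm M * inner v v.
Proof.
have [/inner_eq0 ->|v0] := eqVneq (inner v v) 0; first by rewrite mulmx0 !inner0l mulr0.
have vp : 0 < inner v v by rewrite lt_def v0 inner_ge0.
have ep : 0 < enorm v by rewrite sqrtr_gt0.
have h : enorm (M *m v) <= opnorm M * enorm v.
  have := opnorm_ge M ((enorm v)^-1 *: v); rewrite -scalemxAr enorm_le1.
  rewrite innerZl innerZr mulrA -expr2 exprVn enorm_sqr mulVf // lexx => /(_ isT) h.
  rewrite -ler_pdivrMr // mulrC; apply: le_trans h.
  by rewrite enormZ // invr_ge0 ltW.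
apply: (@le_trans _ _ (enorm v * enorm (M *m v))).
  apply: le_trans (ler_norm _) _; rewrite -(@ler_pXn2r _ 2) ?nnegrE ?mulr_ge0 ?enorm_ge0 //.
  by rewrite real_normK ?num_real // exprMn !enorm_sqr inner_sqr_le.
by rewrite -enorm_sqr expr2 mulrA mulrC ler_wpM2r // ltW.
Qed.

Lemma opnorm_gt0 M : M != 0 -> 0 < opnorm M.
Proof.
move=> M0; rewrite lt_def opnorm_ge0 andbT; apply: contra_neq M0 => op0.
apply/matrixP => i j; rewrite mxE.
have h : enorm (M *m delta_mx j 0) <= 0.
  by rewrite -op0; apply: opnorm_ge; rewrite enorm_le1 inner_delta mxE !eqxx.
have /inner_eq0/colP/(_ i) : inner (M *m delta_mx j 0) (M *m delta_mx j 0) = 0.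
  by rewrite -enorm_sqr (_ : enorm _ = 0) ?expr0n //; apply/eqP; rewrite eq_le h enorm_ge0.
rewrite !mxE (bigD1 j) //= mxE !eqxx mulr1 big1 ?addr0 // => k kj.
by rewrite mxE (negbTE kj) mulr0.
Qed.

Lemma form_near_opnorm M : psd M -> M != 0 ->
  exists2 v, inner v v <= 1 & 3 / 4 * opnorm M <= inner v (M *m v).
Proof.
move=> [MT M0] Mn; have op0 := opnorm_gt0 M Mn; apply: contrapT => nex.
have : opnorm M <= 3 / 4 * opnorm M; last lra.
apply: opnorm_le_form => //; first by rewrite mulr_ge0 // ltW.
move=> v v1; rewrite ger0_norm //; case: (leP (inner v (M *m v)) (3 / 4 * opnorm M)) => // /ltW h.
by case: nex; exists v.
Qed.

End QuadraticForms.

(** * Rational approximation of directions and of positive semidefinite matrices *)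

Section Rational.
Context {R : realType} {d : nat}.
Implicit Types (u v w : 'cV[R]_d) (M S : 'M[R]_d).

Definition ratmx m k (Z : 'M[int]_(m, k) * nat) : 'M[R]_(m, k) :=
  (Z.2.+1%:R)^-1 *: map_mx (fun z : int => z%:~R) Z.1.

(** Rounding towards zero never increases an absolute value, so a rounded vector stays in the unit
    ball. *)
Definition round0 (N : nat) (a : R) : int :=
  if 0 <= a then Num.floor (N.+1%:R * a) else - Num.floor (- (N.+1%:R * a)).

Lemma round0P (N : nat) (a : R) :
  `|(round0 N a)%:~R / N.+1%:R| <= `|a| /\ `|(round0 N a)%:~R / N.+1%:R - a| <= N.+1%:R^-1.
Proof.
have N0 : 0 < N.+1%:R :> R by rewrite ltr0n.
have pos (b : R) : 0 <= b -> let f : R := (Num.floor (N.+1%:R * b))%:~R / N.+1%:R in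
    [/\ 0 <= f, f <= b & b - N.+1%:R^-1 <= f].
  move=> b0 f; have /andP[h1 h2] := floor_itv (N.+1%:R * b).
  have f0 : 0 <= (Num.floor (N.+1%:R * b))%:~R :> R.
    by rewrite ler0z floor_ge0 mulr_ge0 // ltW.
  have fN : f * N.+1%:R = (Num.floor (N.+1%:R * b))%:~R by rewrite /f divfK // gt_eqF.
  move: h1 h2; rewrite intrD mulr1z -fN => h1 h2.
  split; first by rewrite /f divr_ge0 // ltW.
    by rewrite -(ler_pM2r N0); move: h1; lra.
  rewrite -(ler_pM2r N0) mulrBl mulVf ?gt_eqF //; move: h2; lra.
rewrite /round0; case: (leP 0 a) => a0.
  have [] := pos a a0; move: (_ / _) => f h1 h2 h3.
  rewrite (ger0_norm h1) (ger0_norm a0); split=> //.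
  move: (N.+1%:R^-1) h3 => c h3; rewrite ler0_norm; lra.
have na : 0 <= - a by lra.
have [] := pos (- a) na; rewrite mulrN intrN mulNr; move: (_ / _) => f h1 h2 h3.
rewrite normrN ger0_norm // ltr0_norm //; split=> //.
by move: (N.+1%:R^-1) h3 => c h3; rewrite ger0_norm; lra.
Qed.

Lemma ratmx_round m k N (f : 'I_m -> 'I_k -> R) i j :
  ratmx m k (\matrix_(i, j) round0 N (f i j), N) i j = (round0 N (f i j))%:~R / N.+1%:R.
Proof. by rewrite !mxE mulrC. Qed.

Definition rational_ball : set 'cV[R]_d :=
  [set u | inner u u <= 1 /\ exists Z, u = ratmx d 1 Z].

Lemma coord_le1 v i : inner v v <= 1 -> `|v i 0| <= 1.
Proof.
move=> v1; rewrite -(@ler_pXn2r _ 2) ?nnegrE // real_normK ?num_real // expr1n.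
exact: le_trans (coord_sqr_le d v i) v1.
Qed.

Lemma rational_ball_dense M v e : inner v v <= 1 -> 0 < e ->
  exists2 u, rational_ball u & `|inner v (M *m v) - inner u (M *m u)| <= e.
Proof.
move=> v1 e0; pose A := \sum_i \sum_j `|M i j|.
have A0 : 0 <= A by apply: sumr_ge0 => i _; exact: sumr_ge0.
have A1 : 0 < 2 * A + 1 by lra.
pose N := Num.truncn ((2 * A + 1) / e).
have hN : N.+1%:R^-1 * (2 * A) <= e.
  have h1 : (2 * A + 1) / e < N.+1%:R by exact: truncnS_gt.
  have n0 : 0 < N.+1%:R :> R by rewrite ltr0n.
  rewrite -(ler_pM2l n0) mulrA divff ?gt_eqF // mul1r.
  by move: h1; rewrite ltr_pdivrMr //; lra.
pose u : 'cV[R]_d := ratmx d 1 (\matrix_(i, j) round0 N (v i j), N).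
have uE i : u i 0 = (round0 N (v i 0))%:~R / N.+1%:R by rewrite /u ratmx_round.
have ule i : `|u i 0| <= `|v i 0| by rewrite uE; case: (round0P N (v i 0)).
have uv i : `|u i 0 - v i 0| <= N.+1%:R^-1 by rewrite uE; case: (round0P N (v i 0)).
exists u.
  split; last by exists (\matrix_(i, j) round0 N (v i j), N).
  apply: le_trans v1; apply: ler_sum => i _; rewrite -!expr2.
  by rewrite -[leLHS]real_normK ?num_real // -[leRHS]real_normK ?num_real // lerXn2r ?nnegrE.
rewrite !inner_mulmx -sumrB; apply: le_trans (ler_norm_sum _ _ _) _.
apply: le_trans hN; rewrite mulrA /A mulr_sumr; apply: ler_sum => i _.
rewrite -sumrB; apply: le_trans (ler_norm_sum _ _ _) _.
rewrite mulr_sumr; apply: ler_sum => j _.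
set c := N.+1%:R^-1 in uv *.
have vi := coord_le1 v i v1; have ui : `|u i 0| <= 1 := le_trans (ule i) vi.
have vj := coord_le1 v j v1.
have -> : v i 0 * M i j * v j 0 - u i 0 * M i j * u j 0 =
  M i j * (- (v j 0 * (u i 0 - v i 0)) - u i 0 * (u j 0 - v j 0)) by ring.
rewrite normrM mulrC; apply: ler_wpM2r => //.
apply: le_trans (ler_normB _ _) _; rewrite normrN !normrM.
have h1 : `|v j 0| * `|u i 0 - v i 0| <= 1 * c by apply: ler_pM.
have h2 : `|u i 0| * `|u j 0 - v j 0| <= 1 * c by apply: ler_pM.
lra.
Qed.

Lemma form_le_dense M c : (forall u, rational_ball u -> `|inner u (M *m u)| <= c) ->
  forall v, inner v v <= 1 -> `|inner v (M *m v)| <= c.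
Proof.
move=> h v v1; apply/ler_addgt0Pr => e e0.
have [u Du hu] := rational_ball_dense M v e v1 e0.
have := h u Du; have := ler_distD 0 (inner v (M *m v)) (inner u (M *m u)).
have : `|inner v (M *m v)| <= `|inner v (M *m v) - inner u (M *m u)| + `|inner u (M *m u)|.
  by rewrite -[X in `|X| <= _](subrK (inner u (M *m u))) ler_normD.
lra.
Qed.

(** Rounding the entries to precision [c] moves the form by at most [c * d * inner v v]; adding
    [c * d] times the identity restores positivity and keeps the entries rational. *)
Lemma rational_psd_dense S e : psd S -> 0 < e ->
  exists Z : 'M[int]_(d, d) * nat, psd (ratmx d d Z) /\
    forall v, inner v v <= 1 -> `|inner v ((ratmx d d Z - S) *m v)| <= e.
Proof.
move=> [ST S0] e0; pose N := Num.truncn (2 * d%:R / e).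
pose c : R := N.+1%:R^-1.
have c0 : 0 <= c by rewrite invr_ge0.
have hN : c * (2 * d%:R) <= e.
  have h1 : 2 * d%:R / e < N.+1%:R by exact: truncnS_gt.
  have n0 : 0 < N.+1%:R :> R by rewrite ltr0n.
  have cN : c * N.+1%:R = 1 by rewrite /c mulVf // gt_eqF.
  rewrite ltr_pdivrMr // in h1.
  have -> : e = c * (N.+1%:R * e) by rewrite mulrA cN mul1r.
  by apply: ler_wpM2l => //; exact: ltW.
pose A0 : 'M[R]_d := \matrix_(i, j) ((round0 N (S i j))%:~R / N.+1%:R).
pose Z : 'M[int]_d := \matrix_(i, j) (round0 N (S i j)) + (d%:Z)%:M.
have ZE : ratmx d d (Z, N) = A0 + (c * d%:R)%:M.
  apply/matrixP => i j; rewrite /ratmx /= !mxE intrD mulrDr [_^-1 * _]mulrC; congr (_ + _).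
  by case: (i == j); rewrite ?mulr1n ?mulr0n ?mulr0 // -[RHS]mulrC.
have sumv v : (\sum_i \sum_j `|v i 0| * `|v j 0|) <= d%:R * inner v v.
  apply: (@le_trans _ _ (\sum_(i < d) \sum_(j < d) (v i 0 ^+ 2 + v j 0 ^+ 2) / 2)).
    apply: ler_sum => i _; apply: ler_sum => j _.
    rewrite -[v i 0 ^+ 2]real_normK ?num_real // -[v j 0 ^+ 2]real_normK ?num_real //.
    have := sqr_ge0 (`|v i 0| - `|v j 0|); lra.
  have E : inner v v = \sum_i v i 0 ^+ 2 by apply: eq_bigr => i _; rewrite expr2.
  rewrite le_eqVlt; apply/orP; left; apply/eqP.
  under eq_bigr do rewrite -mulr_suml big_split /= sumr_const card_ord -E.
  rewrite -mulr_suml big_split /= sumr_const card_ord.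
  under eq_bigr do rewrite -[_ *+ _]mulr_natl.
  by rewrite -mulr_sumr -E -[_ *+ _]mulr_natl; field.
have diff v : `|inner v ((A0 - S) *m v)| <= c * (d%:R * inner v v).
  rewrite inner_mulmx; apply: le_trans (ler_norm_sum _ _ _) _.
  apply: (@le_trans _ _ (c * \sum_i \sum_j `|v i 0| * `|v j 0|)); last by rewrite ler_wpM2l.
  rewrite mulr_sumr; apply: ler_sum => i _; apply: le_trans (ler_norm_sum _ _ _) _.
  rewrite mulr_sumr; apply: ler_sum => j _; rewrite !normrM.
  have : `|(A0 - S) i j| <= c by rewrite !mxE; case: (round0P N (S i j)).
  move=> h; have := ler_wpM2l (mulr_ge0 (normr_ge0 (v i 0)) (normr_ge0 (v j 0))) h; lra.
have formE v : inner v (ratmx d d (Z, N) *m v) =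
    inner v (S *m v) + inner v ((A0 - S) *m v) + c * d%:R * inner v v.
  rewrite ZE mulmxBl mulmxDl mul_scalar_mx !(innerDr, innerNr, innerZr); ring.
exists (Z, N); split.
  split.
    rewrite ZE raddfD /= tr_scalar_mx; congr (_ + _).
    by apply/matrixP => i j; rewrite !mxE -[in LHS]ST mxE.
  move=> v; rewrite formE; have := S0 v; have /ler_normlP[h _] := diff v.
  rewrite mulrA in h; lra.
move=> v v1; rewrite mulmxBl innerBr formE.
have -> : inner v (S *m v) + inner v ((A0 - S) *m v) + c * d%:R * inner v v - inner v (S *m v)
  = inner v ((A0 - S) *m v) + c * d%:R * inner v v by ring.
apply: le_trans hN; apply: le_trans (ler_normD _ _) _; have := diff v.
have cd0 : 0 <= c * d%:R by rewrite mulr_ge0.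
rewrite [X in _ + X <= _]ger0_norm; last by rewrite mulr_ge0 // inner_ge0.
have : c * d%:R * inner v v <= c * d%:R by rewrite ler_piMr.
rewrite mulrA; lra.
Qed.

End Rational.

(** * Moments of the marginals *)

Section Moments.
Context {R : realType} {d : nat} {d0 : measure_display} {Omega0 : measurableType d0}.
Context (P0 : probability Omega0 R) (X0 : {RV P0 >-> 'cV[R]_d}).
Let Q := distribution P0 X0.
Let Sigma := second_moment X0.

Let measurable_fun_X0 dY (Y : measurableType dY) (f : 'cV[R]_d -> Y) :
  measurable_fun setT f -> measurable_fun setT (fun w => f (X0 w)).
Proof. by move=> mf; apply: (measurableT_comp mf). Qed.

Lemma integral_law (f : 'cV[R]_d -> \bar R) : measurable_fun setT f -> (forall x, 0 <= f x)%E ->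
  (\int[Q]_x f x = \int[P0]_w f (X0 w))%E.
Proof. by move=> mf f0; rewrite /Q ge0_integral_distribution. Qed.

Lemma measurable_enorm : measurable_fun setT (fun x : 'cV[R]_d => enorm x).
Proof.
have m : measurable_fun setT (@Num.sqrt R) by apply: continuous_measurable_fun; exact: sqrt_continuous.
exact: (measurableT_comp m measurable_inner2).
Qed.

Definition norm_moment_finite (p : R) : Prop :=
  (\int[Q]_x (enorm x `^ p)%:E < +oo)%E.

Lemma measurable_enorm_powR p : measurable_fun setT (fun x : 'cV[R]_d => (enorm x `^ p)%:E).
Proof.
apply/measurable_EFinP.
exact: (measurableT_comp (measurable_powR p) measurable_enorm).
Qed.

Lemma norm_moment_law p : ('E_P0[fun w => (enorm (X0 w) `^ p)%R] < +oo)%E -> norm_moment_finite p.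
Proof.
rewrite unlock /norm_moment_finite integral_law //; first exact: measurable_enorm_powR.
by move=> x; rewrite lee_fin powR_ge0.
Qed.

Lemma norm_moment_le p p' : 4 <= p' <= p -> norm_moment_finite p -> norm_moment_finite p'.
Proof.
move=> /andP[p4 pp'] hp.
apply: (@le_lt_trans _ _ (\int[Q]_x (1 + (enorm x `^ p)%:E))%E).
  apply: ge0_le_integral => //.
  - by move=> x _; rewrite lee_fin powR_ge0.
  - exact: measurable_enorm_powR.
  - by apply: emeasurable_funD => //; exact: measurable_enorm_powR.
  move=> x _; rewrite -EFinD lee_fin; have a0 := enorm_ge0 x.
  have [a1|a1] := leP (enorm x) 1.
    have : enorm x `^ p' <= 1.
      have p'0 : 0 <= p' by lra.
      rewrite [leRHS](_ : 1 = 1 `^ p'); last by rewrite powR1.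
      by apply: ge0_ler_powR; rewrite ?nnegrE.
    have := powR_ge0 (enorm x) p; lra.
  apply: (@le_trans _ _ (enorm x `^ p)); last by rewrite lerDr.
  by rewrite ler_powR // ltW.
rewrite ge0_integralD //; first last.
- exact: measurable_enorm_powR.
- by move=> x _; rewrite lee_fin powR_ge0.
rewrite integral_cst // mul1e [X in (X + _)%E](_ : _ = 1%E); last exact: probability_setT.
by rewrite lte_add_pinfty // ltry.
Qed.

Lemma fourth_moment_law p : 4 <= p -> norm_moment_finite p -> fourth_moment_finite Q.
Proof.
move=> p4 hp; have : norm_moment_finite 4 by apply: (norm_moment_le p) => //; rewrite lexx.
rewrite /norm_moment_finite /fourth_moment_finite.
rewrite (eq_integral (fun x : 'cV[R]_d => (inner x x ^+ 2)%:E)) // => x _.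
by rewrite powR_mulrn ?enorm_ge0 // -enorm_sqr -exprM.
Qed.

Hypothesis Q4 : fourth_moment_finite Q.

Lemma second_moment_form v : Ex Q (fun x => inner x v ^+ 2) = inner v (Sigma *m v).
Proof.
have gij i j : mgrowth (fun x : 'cV[R]_d => x i 0 * x j 0).
  have g k : mgrowth (fun x : 'cV[R]_d => x k 0 ^+ 2).
    under eq_fun do rewrite -inner_delta.
    exact: mgrowth_inner2.
  by apply: mgrowth_mul => //; exact: measurable_coord.
have -> : (fun x : 'cV[R]_d => inner x v ^+ 2) =
    (fun x => \sum_i \sum_j (v i 0 * v j 0) * (x i 0 * x j 0)).
  apply/funext => x; rewrite expr2 /inner mulr_suml; apply: eq_bigr => i _.
  by rewrite mulr_sumr; apply: eq_bigr => j _; ring.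
rewrite Ex_sum //; last by move=> i; apply: mgrowth_sum => j; exact: mgrowthZ.
rewrite inner_mulmx; apply: eq_bigr => i _.
rewrite Ex_sum //; last by move=> j; exact: mgrowthZ.
apply: eq_bigr => j _; rewrite ExZ // mxE.
have -> : Ex Q (fun x => x i 0 * x j 0) = fine ('E_P0[fun w => X0 w i 0 * X0 w j 0]).
  rewrite unlock /Ex /Rintegral; congr fine.
  have mg : measurable_fun setT (fun x : 'cV[R]_d => (x i 0 * x j 0)%:E).
    by apply/measurable_EFinP; case: (gij i j).
  have := mgrowth_integrable Q Q4 _ (gij i j) => /integrableP[_ int].
  rewrite integral_distribution //.
  apply/integrableP; split; first exact: (measurable_fun_X0 _ _ _ mg).
  apply: le_lt_trans int; rewrite [leRHS](integral_law (fun x => `|(x i 0 * x j 0)%:E|%E)) //.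
  exact: measurableT_comp.
ring.
Qed.

Lemma second_moment_psd : psd Sigma.
Proof.
split.
  apply/matrixP => i j; rewrite !mxE; congr (fine ('E_P0[_])).
  by apply/funext => w; rewrite mulrC.
by move=> v; rewrite -second_moment_form; apply: Ex_ge0 => x; exact: sqr_ge0.
Qed.

Lemma form_cauchy_schwarz (M : 'M[R]_d) u v : psd M -> inner v (M *m v) = 1 ->
  inner u (M *m v) ^+ 2 <= inner u (M *m u).
Proof.
move=> [MT M0] v1; set c := inner u (M *m v).
have := M0 (u - c *: v).
rewrite mulmxBr -scalemxAr !(innerDl, innerDr, innerNl, innerNr, innerZl, innerZr).
rewrite v1 (inner_mulmx_sym v M u MT) -/c; lra.
Qed.

Let measurable_marginal q v :
  measurable_fun setT (fun x : 'cV[R]_d => (`|inner x v| `^ q)%:E).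
Proof.
apply/measurable_EFinP; apply: (measurableT_comp (measurable_powR q)).
by apply: measurableT_comp => //; exact: measurable_inner.
Qed.

Lemma marginal_eq0 u : inner u (Sigma *m u) = 0 ->
  {ae Q, forall x, inner x u = 0}.
Proof.
move=> u0; have g2 := mgrowth_inner2 u.
have m2 : measurable_fun setT (fun x : 'cV[R]_d => (inner x u ^+ 2)%:E).
  by apply/measurable_EFinP; case: g2.
have : (\int[Q]_(x in setT) `|(inner x u ^+ 2)%:E| = 0)%E.
  under eq_integral do rewrite abse_EFin ger0_norm ?sqr_ge0 //.
  by rewrite Ex_EFin // second_moment_form u0.
move/(ae_eq_integral_abs _ measurableT m2); apply: filterS => x /(_ I) /= [].
by move/eqP; rewrite sqrf_eq0 => /eqP.
Qed.

(** The directions normalised by a singular [Sigma] form an unbounded set. A generalised inverse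
    replaces [v] by some [u] of bounded norm with the same image under [Sigma], and then
    [inner x v = inner x u] almost surely. *)
Lemma marginal_moment_bounded q : 0 < q -> norm_moment_finite q ->
  exists C : R, forall v, inner v (Sigma *m v) = 1 ->
    (\int[Q]_x (`|inner x v| `^ q)%:E <= C%:E)%E.
Proof.
move=> q0 hq; have [ST S0] := second_moment_psd.
pose G := (pinvmx Sigma)^T.
pose b := (\sum_i inner (row i G)^T (row i G)^T) * opnorm Sigma.
have b0 : 0 <= b.
  by rewrite mulr_ge0 ?opnorm_ge0 //; apply: sumr_ge0 => i _; exact: inner_ge0.
have I0 : (0 <= \int[Q]_x (enorm x `^ q)%:E)%E.
  by apply: integral_ge0 => x _; rewrite lee_fin powR_ge0.
exists (Num.sqrt b `^ q * fine (\int[Q]_x (enorm x `^ q)%:E)%E) => v v1.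
pose u := G *m (Sigma *m v).
have Su : Sigma *m u = Sigma *m v.
  have : v^T *m Sigma *m pinvmx Sigma *m Sigma = v^T *m Sigma by rewrite mulmxKpV // submxMl.
  rewrite /u /G; move: (pinvmx Sigma) => Pi key; apply: trmx_inj.
  by rewrite !trmx_mul trmxK ST.
have u_le : inner u u <= b.
  have h1 : inner u u <= (\sum_i inner (row i G)^T (row i G)^T) * inner (Sigma *m v) (Sigma *m v).
    rewrite mulr_suml; apply: ler_sum => i _.
    have -> : u i 0 = inner (row i G)^T (Sigma *m v).
      by rewrite mxE; apply: eq_bigr => j _; rewrite !mxE.
    by rewrite -expr2 inner_sqr_le.
  apply: le_trans h1 _; rewrite /b ler_wpM2l //.
    by apply: sumr_ge0 => i _; exact: inner_ge0.
  set a := Sigma *m v.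
  have := form_cauchy_schwarz Sigma a v second_moment_psd v1.
  have := form_le_opnorm Sigma a; rewrite -/a => h2 h3.
  have [->|a0] := eqVneq (inner a a) 0; first exact: opnorm_ge0.
  have ap : 0 < inner a a by rewrite lt_def a0 inner_ge0.
  by rewrite -(ler_pM2r ap) -expr2; apply: le_trans h3 h2.
have ae : {ae Q, forall x, inner x (v - u) = 0}.
  apply: marginal_eq0; rewrite mulmxBr Su subrr.
  by rewrite inner0r.
have -> : (\int[Q]_x (`|inner x v| `^ q)%:E = \int[Q]_x (`|inner x u| `^ q)%:E)%E.
  apply: ge0_ae_eq_integral => //.
  move: ae; apply: filterS => x xvu _ /=; congr (`|_| `^ _)%:E.
  by apply/eqP; rewrite -subr_eq0 -innerBr xvu.
apply: (@le_trans _ _ (\int[Q]_x ((Num.sqrt b `^ q)%:E * (enorm x `^ q)%:E))%E).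
  apply: ge0_le_integral => //.
  - apply: emeasurable_funM => //; exact: measurable_enorm_powR.
  move=> x _; rewrite -EFinM lee_fin -powRM ?sqrtr_ge0 ?enorm_ge0 //.
  apply: ge0_ler_powR; rewrite ?nnegrE ?mulr_ge0 ?sqrtr_ge0 ?(ltW q0) //.
  rewrite -(@ler_pXn2r _ 2) ?nnegrE ?mulr_ge0 ?sqrtr_ge0 //.
  rewrite real_normK ?num_real // exprMn enorm_sqr sqr_sqrtr //.
  apply: le_trans (inner_sqr_le _ _) _; rewrite mulrC ler_wpM2r ?inner_ge0 //.
have mq := measurable_enorm_powR q.
have q_ge0 x : [set: 'cV[R]_d] x -> (0 <= (enorm x `^ q)%:E)%E by rewrite lee_fin powR_ge0.
rewrite ge0_integralZl // ?lee_fin ?powR_ge0 //.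
by rewrite EFinM fineK // ge0_fin_numE.
Qed.

Let kappa := moment_constant X0.

Lemma marginal_moment_le q v : 0 < q -> norm_moment_finite q -> inner v (Sigma *m v) = 1 ->
  0 <= kappa q /\ (\int[Q]_x (`|inner x v| `^ q)%:E <= (kappa q `^ q)%:E)%E.
Proof.
move=> q0 hq v1; have [C hC] := marginal_moment_bounded q q0 hq.
have NE u : ('N[P0]_(q%:E)[(fun w => (inner (X0 w) u)%:E)] =
    (\int[Q]_x (`|inner x u| `^ q)%:E) `^ q^-1)%E.
  by rewrite unlock; congr (_ `^ _)%E; rewrite integral_law.
set S := [set 'N[P0]_(q%:E)[(fun w => (inner (X0 w) u)%:E)]%E
    | u in [set u : 'cV[R]_d | inner u (Sigma *m u) = 1]].
have I0 u : (0 <= \int[Q]_x (`|inner x u| `^ q)%:E)%E.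
  by apply: integral_ge0 => x _; rewrite lee_fin powR_ge0.
have vS : (('N[P0]_(q%:E)[(fun w => (inner (X0 w) v)%:E)])%E <= ereal_sup S)%E.
  by apply: ereal_sup_ubound; exists v.
have sup0 : (0 <= ereal_sup S)%E by apply: le_trans vS; exact: Lnorm_ge0.
have C0 : 0 <= C by rewrite -lee_fin; apply: le_trans (hC v v1).
have supC : (ereal_sup S <= (C `^ q^-1)%:E)%E.
  apply: ge_ereal_sup => _ [u u1 <-]; rewrite NE -poweR_EFin.
  apply: gt0_ler_poweR; last exact: hC.
  - by rewrite invr_ge0 ltW.
  - by rewrite in_itv /= I0 leey.
  - by rewrite in_itv /= lee_fin C0 leey.
have supfin : ereal_sup S \is a fin_num.
  by rewrite ge0_fin_numE //; apply: le_lt_trans supC _; rewrite ltry.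
have kE : ereal_sup S = (kappa q)%:E by rewrite /kappa /moment_constant fineK.
have k0 : 0 <= kappa q by rewrite -lee_fin -kE.
split=> //.
have := vS; rewrite NE kE => h.
have -> : (\int[Q]_x (`|inner x v| `^ q)%:E = ((\int[Q]_x (`|inner x v| `^ q)%:E) `^ q^-1) `^ q)%E.
  by rewrite -poweRrM mulVf ?gt_eqF // poweRe1.
rewrite -poweR_EFin; apply: gt0_ler_poweR; last exact: h.
- exact: ltW.
- by rewrite in_itv /= poweR_ge0 leey.
- by rewrite in_itv /= lee_fin k0 leey.
Qed.

(** The right-hand side is [y^2 (y^2 / b)^(p/2 - 1)], whose second factor is at least 1 wherever
    [y^2 > b]. *)
Lemma excess_le_powR (p y b : R) : 2 <= p -> 0 <= y -> 0 < b ->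
  Num.max (y ^+ 2 - b) 0 <= y `^ p * b `^ (- (p / 2 - 1)).
Proof.
move=> p2 y0 b0; have R0 : 0 <= y `^ p * b `^ (- (p / 2 - 1)) by rewrite mulr_ge0 ?powR_ge0.
rewrite ge_max R0 andbT; have [yb|yb] := leP (y ^+ 2) b; first lra.
have y2 : 0 < y ^+ 2 := lt_trans b0 yb.
have yp : 0 < y by rewrite lt_def y0 andbT; apply: contraTneq y2 => ->; rewrite expr0n ltxx.
have -> : y `^ p = y ^+ 2 * (y ^+ 2) `^ (p / 2 - 1).
  rewrite -!powR_mulrn // -powRrM -powRD; last by rewrite (gt_eqF yp) implybT.
  by congr (_ `^ _); field.
apply: (@le_trans _ _ (y ^+ 2 * 1)); first by rewrite mulr1; lra.
rewrite -mulrA ler_wpM2l ?(ltW y2) // powRN ler_pdivlMr ?powR_gt0 // mul1r.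
apply: ge0_ler_powR; rewrite ?nnegrE ?(ltW b0) ?(ltW y2) ?(ltW yb) //; lra.
Qed.

Let m2 v := inner v (Sigma *m v).

Let m2E v : Ex Q (fun x => inner x v ^+ 2) = m2 v.
Proof. exact: second_moment_form. Qed.

Let m2_ge0 v : 0 <= m2 v. Proof. by case: second_moment_psd => _; apply. Qed.

Let m2Z a v : m2 (a *: v) = a ^+ 2 * m2 v.
Proof. by rewrite /m2 -scalemxAr innerZl innerZr mulrA -expr2. Qed.

Let normalized v : 0 < m2 v -> exists2 w, m2 w = 1 & v = Num.sqrt (m2 v) *: w.
Proof.
move=> v0; exists ((Num.sqrt (m2 v))^-1 *: v).
  by rewrite m2Z exprVn sqr_sqrtr ?(ltW v0) // mulVf // gt_eqF.
by rewrite scalerA divff ?scale1r // sqrtr_eq0 -ltNge.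
Qed.

Lemma marginal_fourth_le v : norm_moment_finite 4 ->
  Ex Q (fun x => inner x v ^+ 4) <= kappa 4 ^+ 4 * Ex Q (fun x => inner x v ^+ 2) ^+ 2.
Proof.
move=> h4; rewrite m2E.
have [v0|v0] := eqVneq (m2 v) 0.
  rewrite v0 expr0n mulr0 -lee_fin -Ex_EFin //; last exact: mgrowth_inner4.
  have -> : (\int[Q]_(x in setT) (inner x v ^+ 4)%:E = \int[Q]_(x in setT) (fun=> 0%E) x)%E;
    last by rewrite integral0.
  apply: (@ge0_ae_eq_integral _ _ _ Q setT (fun x => (inner x v ^+ 4)%:E)) => //.
  - by apply/measurable_EFinP; case: (mgrowth_inner4 v).
  - by move=> x _; rewrite lee_fin (_ : 4 = 2 * 2)%N // exprM sqr_ge0.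
  have := marginal_eq0 v v0; apply: filterS => x xv _ /=.
  by rewrite xv expr0n.
have vp : 0 < m2 v by rewrite lt_def v0 m2_ge0.
have [w w1 vE] := normalized v vp.
have [k0 hk] := marginal_moment_le 4 w (ltr0n _ 4) h4 w1.
have -> : (fun x : 'cV[R]_d => inner x v ^+ 4) = (fun x => m2 v ^+ 2 * inner x w ^+ 4).
  apply/funext => x; rewrite {1}vE innerZr exprMn; congr (_ * _).
  by rewrite (_ : 4 = 2 * 2)%N // exprM sqr_sqrtr // ltW.
rewrite ExZ //; last exact: mgrowth_inner4.
rewrite mulrC ler_wpM2r ?sqr_ge0 // -powR_mulrn // -lee_fin -Ex_EFin //; last exact: mgrowth_inner4.
apply: le_trans hk; rewrite le_eqVlt; apply/orP; left; apply/eqP.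
apply: eq_integral => x _; rewrite powR_mulrn // (_ : 4 = 2 * 2)%N // !exprM.
by rewrite real_normK ?num_real.
Qed.

(** The level is chosen so that [eta] times it equals the bound: deleting a fraction [eta] of
    indices below the level costs as much as the mass above it. The factor [c] admits rescaled
    directions whose variance is at most [tau]. *)
Lemma marginal_excess_le p v c tau eta : 4 <= p -> norm_moment_finite p ->
  0 < kappa p -> 0 < tau -> 0 < eta -> 0 <= c -> c * Ex Q (fun x => inner x v ^+ 2) <= tau ->
  Ex Q (fun x => Num.max (c * inner x v ^+ 2 - tau * kappa p ^+ 2 * eta `^ (- (2 / p))) 0)
    <= tau * kappa p ^+ 2 * eta `^ (1 - 2 / p).
Proof.
move=> p4 hp k0 tau0 eta0 c0; rewrite m2E => cv.
set B := tau * _ * eta `^ (- (2 / p)); set D := tau * _ * _.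
have B0 : 0 < B by rewrite !mulr_gt0 ?exprn_gt0 ?powR_gt0.
have D0 : 0 < D by rewrite !mulr_gt0 ?exprn_gt0 ?powR_gt0.
have gc : mgrowth (fun x => c * inner x v ^+ 2) by apply: mgrowthZ; exact: mgrowth_inner2.
have gm : mgrowth (fun x => Num.max (c * inner x v ^+ 2 - B) 0).
  apply: (mgrowth_le _ _ _ _ gc).
    by apply: measurable_maxr => //; apply: measurable_funB => //; case: gc.
  have t0 x : 0 <= c * inner x v ^+ 2 by rewrite mulr_ge0 // sqr_ge0.
  move=> x; rewrite ger0_norm ?le_max ?lexx ?orbT // ge_max t0 andbT; have := t0 x; lra.
have [v0|v0] := eqVneq (m2 v) 0.
  apply: (@le_trans _ _ (Ex Q (fun x => c * inner x v ^+ 2))).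
    apply: Ex_le => // x; rewrite ge_max mulr_ge0 ?sqr_ge0 // andbT; lra.
  rewrite ExZ //; last exact: mgrowth_inner2.
  by rewrite m2E v0 mulr0 ltW.
have vp : 0 < m2 v by rewrite lt_def v0 m2_ge0.
have [w w1 vE] := normalized v vp.
have p0 : 0 < p by lra.
have [_ hk] := marginal_moment_le p w p0 hp w1.
pose e := tau * kappa p ^+ 2 * eta `^ (1 - 2 / p) / kappa p `^ p.
have kp0 : 0 < kappa p `^ p by rewrite powR_gt0.
have e0 : 0 <= e by rewrite divr_ge0 // ltW.
rewrite -lee_fin -Ex_EFin //.
apply: (@le_trans _ _ (\int[Q]_x (e%:E * (`|inner x w| `^ p)%:E))%E); last first.
  rewrite ge0_integralZl //.
  apply: (@le_trans _ _ (e%:E * (kappa p `^ p)%:E)%E); first by apply: lee_wpmul2l.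
  by rewrite -EFinM lee_fin /e divfK // gt_eqF.
apply: ge0_le_integral => //.
- by move=> x _; rewrite lee_fin le_max lexx orbT.
- by apply/measurable_EFinP; case: gm.
- by apply: emeasurable_funM => //; exact: measurable_marginal.
move=> x _; rewrite -EFinM lee_fin.
set z := `|inner x w|; have z0 : 0 <= z by exact: normr_ge0.
have zE : c * inner x v ^+ 2 <= tau * z ^+ 2.
  rewrite {1}vE innerZr exprMn sqr_sqrtr ?(ltW vp) // mulrA real_normK ?num_real //.
  by rewrite ler_wpM2r // sqr_ge0.
have bp : 0 < eta `^ (- (2 / p)) by rewrite powR_gt0.
have p2 : 2 <= p by lra.
have := excess_le_powR p (z / kappa p) (eta `^ (- (2 / p))) p2 (divr_ge0 z0 (ltW k0)) bp.
rewrite -powRrM (_ : - (2 / p) * - (p / 2 - 1) = 1 - 2 / p); last by field; rewrite gt_eqF.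
rewrite powRM ?invr_ge0 ?(ltW k0) // => h.
have kinv : (kappa p)^-1 `^ p = (kappa p `^ p)^-1.
  by rewrite -powR_inv1 ?(ltW k0) // -powRrM mulN1r powRN.
rewrite kinv in h.
have -> : e * z `^ p = tau * kappa p ^+ 2 * (z `^ p * (kappa p `^ p)^-1 * eta `^ (1 - 2 / p)).
  by rewrite /e; ring.
apply: (@le_trans _ _ (tau * kappa p ^+ 2 * Num.max ((z / kappa p) ^+ 2 - eta `^ (- (2 / p))) 0)); last first.
  by apply: ler_wpM2l h; rewrite mulr_ge0 ?sqr_ge0 // ltW.
have tk : 0 < tau * kappa p ^+ 2 by rewrite mulr_gt0 // exprn_gt0.
rewrite ge_max mulr_ge0 ?(ltW tk) ?le_max ?lexx ?orbT // andbT.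
apply: (@le_trans _ _ (tau * kappa p ^+ 2 * ((z / kappa p) ^+ 2 - eta `^ (- (2 / p))))); last first.
  by rewrite ler_wpM2l ?(ltW tk) // le_max lexx.
rewrite mulrBr -/B lerD2r; apply: le_trans zE _.
rewrite [leRHS](_ : _ = tau * z ^+ 2) //.
by field; rewrite gt_eqF.
Qed.

Hypothesis Sigma0 : Sigma != 0.

Let unit_direction : exists w, m2 w = 1.
Proof.
have [v v1 hv] := form_near_opnorm Sigma second_moment_psd Sigma0.
have v0 : 0 < m2 v by apply: lt_le_trans hv; rewrite mulr_gt0 ?opnorm_gt0.
by have [w w1 _] := normalized v v0; exists w.
Qed.

(** Otherwise the [p]-th moment vanishes in a direction of unit variance, and
    [y^2 <= 1/2 + 2^(p/2 - 1) |y|^p] integrates to [1 <= 1/2]. *)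
Lemma moment_constant_gt0 p : 4 <= p -> norm_moment_finite p -> 0 < kappa p.
Proof.
move=> p4 hp; have [w w1] := unit_direction; have p0 : 0 < p by lra.
have [k0 hk] := marginal_moment_le p w p0 hp w1.
rewrite lt_def k0 andbT; apply/eqP => kz.
have g2 := mgrowth_inner2 w.
pose a : R := 2^-1 `^ (- (p / 2 - 1)).
have : (\int[Q]_x (inner x w ^+ 2)%:E <= \int[Q]_x (2^-1%:E + a%:E * (`|inner x w| `^ p)%:E))%E.
  apply: ge0_le_integral => //.
  - by move=> x _; rewrite lee_fin sqr_ge0.
  - by apply/measurable_EFinP; case: g2.
  - by apply: emeasurable_funD => //; apply: emeasurable_funM => //; exact: measurable_marginal.
  move=> x _; rewrite -EFinM -EFinD lee_fin.
  have half0 : 0 < 2^-1 :> R by rewrite invr_gt0.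
  have p2 : 2 <= p by lra.
  have := excess_le_powR p `|inner x w| 2^-1 p2 (normr_ge0 _) half0.
  rewrite real_normK ?num_real // -/a.
  have : inner x w ^+ 2 - 2^-1 <= Num.max (inner x w ^+ 2 - 2^-1) 0 by rewrite le_max lexx.
  set M := Num.max _ _; rewrite [a * _]mulrC; lra.
rewrite Ex_EFin // m2E w1 ge0_integralD //; first last.
- by apply: emeasurable_funM => //; exact: measurable_marginal.
- by move=> x _; rewrite -EFinM lee_fin mulr_ge0 ?powR_ge0.
rewrite ge0_integralZl ?lee_fin ?powR_ge0 //.
have z0 : (\int[Q]_x (`|inner x w| `^ p)%:E = 0)%E.
  apply/eqP; rewrite eq_le; apply/andP; split.
    by apply: le_trans hk _; rewrite kz powR0 // gt_eqF.
  by apply: integral_ge0 => x _; rewrite lee_fin powR_ge0.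
rewrite z0 mule0 adde0 integral_cst // [X in (_ * X)%E](_ : _ = 1%E); last exact: probability_setT.
by rewrite mule1 lee_fin; lra.
Qed.

Lemma moment_constant4_ge1 : norm_moment_finite 4 -> 1 <= kappa 4 ^+ 4.
Proof.
move=> h4; have [w w1] := unit_direction.
have := marginal_fourth_le w h4; rewrite m2E w1 expr1n mulr1.
have g2 := mgrowth_inner2 w; have g4 := mgrowth_inner4 w.
have : Ex Q (fun x => inner x w ^+ 2) <= Ex Q (fun x => 2^-1 + 2^-1 * inner x w ^+ 4).
  apply: Ex_le => //; first by apply: mgrowthD; [exact: mgrowth_cst | exact: mgrowthZ].
  by move=> x; have := sqr_ge0 (inner x w ^+ 2 - 1); rewrite sqrrB -exprM /=; lra.
rewrite m2E w1 ExD //; [|exact: mgrowth_cst|exact: mgrowthZ].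
rewrite Ex_cst ExZ //; lra.
Qed.

End Moments.

(** * Moments of the Euclidean norm from those of the marginals *)

Section NormMoments.
Context {R : realType} {d : nat} (Q : probability 'cV[R]_d R).
Hypothesis Q4 : fourth_moment_finite Q.

Lemma Ex_cauchy_schwarz (g h : 'cV[R]_d -> R) : measurable_fun setT g -> measurable_fun setT h ->
  mgrowth (fun x => g x ^+ 2) -> mgrowth (fun x => h x ^+ 2) ->
  Ex Q (fun x => g x * h x) ^+ 2 <= Ex Q (fun x => g x ^+ 2) * Ex Q (fun x => h x ^+ 2).
Proof.
move=> mg mh g2 h2; have gh := mgrowth_mul g h g2 h2 mg mh.
have key t : 0 <= Ex Q (fun x => g x ^+ 2) - 2 * t * Ex Q (fun x => g x * h x)
     + t ^+ 2 * Ex Q (fun x => h x ^+ 2).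
  have gt := mgrowthZ (2 * t) _ gh; have ht := mgrowthZ (t ^+ 2) _ h2.
  rewrite -!ExZ // -ExB // -ExD //; last exact: mgrowthB.
  apply: Ex_ge0 => x; rewrite [leRHS](_ : _ = (g x - t * h x) ^+ 2) ?sqr_ge0 //; ring.
have : 0 <= Ex Q (fun x => g x ^+ 2) by apply: Ex_ge0 => x; exact: sqr_ge0.
have : 0 <= Ex Q (fun x => h x ^+ 2) by apply: Ex_ge0 => x; exact: sqr_ge0.
move: (Ex Q (fun x => g x ^+ 2)) (Ex Q (fun x => g x * h x)) (Ex Q (fun x => h x ^+ 2)) key.
move=> a b c key c0 a0.
have [cE|cn] := eqVneq c 0.
  have [->|bn] := eqVneq b 0; first by rewrite expr0n mulr_ge0.
  have := key ((a + 1) / (2 * b)); rewrite cE mulr0 addr0.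
  have -> : a - 2 * ((a + 1) / (2 * b)) * b = - 1 by field.
  by rewrite lerNr oppr0 ler10.
have cp : 0 < c by rewrite lt_def cn.
have := key (b / c); have -> : a - 2 * (b / c) * b + (b / c) ^+ 2 * c = (a * c - b ^+ 2) / c by field.
by rewrite pmulr_lge0 ?invr_gt0 // subr_ge0.
Qed.

Lemma mgrowth_coord2 j : mgrowth (fun x : 'cV[R]_d => x j 0 ^+ 2).
Proof. by under eq_fun do rewrite -inner_delta; exact: mgrowth_inner2. Qed.

Lemma Ex_norm2 : Ex Q (fun x => inner x x) = \sum_j Ex Q (fun x => x j 0 ^+ 2).
Proof.
rewrite -(Ex_sum Q Q4 _ (fun j (x : 'cV[R]_d) => x j 0 ^+ 2)); last exact: mgrowth_coord2.
by congr (Ex Q); apply/funext => x; apply: eq_bigr => j _; rewrite expr2.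
Qed.

(** The squared norm squared expands over pairs of coordinates. By Cauchy-Schwarz each pair
    contributes at most [K] times the product of two variances, and these products sum to the
    squared trace. *)
Lemma Ex_norm4_le K : 0 <= K ->
  (forall v, Ex Q (fun x => inner x v ^+ 4) <= K * Ex Q (fun x => inner x v ^+ 2) ^+ 2) ->
  Ex Q (fun x => inner x x ^+ 2) <= K * Ex Q (fun x => inner x x) ^+ 2.
Proof.
move=> K0 h4.
pose m j := Ex Q (fun x => x j 0 ^+ 2).
have m0 j : 0 <= m j by apply: Ex_ge0 => x; exact: sqr_ge0.
have g4 j : mgrowth (fun x : 'cV[R]_d => (x j 0 ^+ 2) ^+ 2).
  by under eq_fun do rewrite -inner_delta -exprM; exact: mgrowth_inner4.
have c2 j : measurable_fun setT (fun x : 'cV[R]_d => x j 0 ^+ 2) by case: (mgrowth_coord2 j).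
have g22 i j : mgrowth (fun x : 'cV[R]_d => x i 0 ^+ 2 * x j 0 ^+ 2) by apply: mgrowth_mul.
have x4 j : Ex Q (fun x => (x j 0 ^+ 2) ^+ 2) <= K * m j ^+ 2.
  have := h4 (delta_mx j 0).
  have -> : (fun x : 'cV[R]_d => inner x (delta_mx j 0) ^+ 4) = (fun x => (x j 0 ^+ 2) ^+ 2).
    by apply/funext => x; rewrite inner_delta -exprM.
  by under [X in K * Ex _ X ^+ 2]eq_fun do rewrite inner_delta.
have -> : (fun x : 'cV[R]_d => inner x x ^+ 2) =
    (fun x => \sum_i \sum_j x i 0 ^+ 2 * x j 0 ^+ 2).
  apply/funext => x; rewrite expr2 /inner mulr_suml; apply: eq_bigr => i _.
  by rewrite mulr_sumr; apply: eq_bigr => j _; rewrite -!expr2.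
rewrite Ex_norm2 expr2 Ex_sum //; last by move=> i; exact: mgrowth_sum.
rewrite mulr_suml mulr_sumr; apply: ler_sum => i _; rewrite Ex_sum // mulr_sumr mulr_sumr.
apply: ler_sum => j _; rewrite -/(m i) -/(m j).
rewrite -(@ler_pXn2r _ 2) ?nnegrE ?mulr_ge0 //; last by apply: Ex_ge0 => x; rewrite mulr_ge0 ?sqr_ge0.
apply: le_trans (Ex_cauchy_schwarz _ _ (c2 i) (c2 j) (g4 i) (g4 j)) _.
apply: (@le_trans _ _ ((K * m i ^+ 2) * (K * m j ^+ 2))).
  by apply: ler_pM => //; apply: Ex_ge0 => x; exact: sqr_ge0.
by rewrite [leRHS](_ : _ = K * m i ^+ 2 * (K * m j ^+ 2)) //; ring.
Qed.

(* The excess of a sum is dominated by the weighted excesses of the coordinates;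
   the weights are proportional to slightly enlarged coordinate variances. *)
Lemma norm_excess_le s beta B D : 0 < s -> 0 < beta -> Ex Q (fun x => inner x x) <= beta * s ->
  0 <= B -> 0 <= D ->
  (forall v c, 0 <= c -> c * Ex Q (fun x => inner x v ^+ 2) <= 64 * s ->
     Ex Q (fun x => Num.max (c * inner x v ^+ 2 - B) 0) <= D) ->
  Ex Q (fun x => Num.max (16 * (inner x x / beta) - B) 0) <= D.
Proof.
move=> s0 b0 tr B0 D0 h.
pose m j := Ex Q (fun x => x j 0 ^+ 2).
have m0 j : 0 <= m j by apply: Ex_ge0 => x; exact: sqr_ge0.
have bs0 : 0 < beta * s by rewrite mulr_gt0.
pose e := beta * s / (d%:R + 1); have d0 : 0 <= d%:R :> R by rewrite ler0n.
have e0 : 0 < e by rewrite divr_gt0 // ltr_wpDl.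
pose w j := (m j + e) / (2 * (beta * s)).
have w0 j : 0 < w j by rewrite divr_gt0 ?mulr_gt0 // ltr_wpDl.
have w1 : \sum_j w j <= 1.
  rewrite -mulr_suml big_split /= -/(m _) -Ex_norm2 sumr_const card_ord.
  rewrite ler_pdivrMr ?mulr_gt0 // mul1r -[e *+ d]mulr_natr.
  have : e * d%:R <= beta * s by rewrite /e mulrAC ler_pdivrMr ?ltr_wpDl // ler_pM2l //; lra.
  move: tr; move: (e * _) (Ex _ _) (beta * s) => u v z; lra.
have g j c : mgrowth (fun x : 'cV[R]_d => Num.max (c * x j 0 ^+ 2 - B) 0).
  apply: (mgrowth_le _ (fun x => `|c| * x j 0 ^+ 2 + B)).
  - by apply: measurable_maxr => //; apply: measurable_funB => //; apply: measurable_funM => //; case: (mgrowth_coord2 j).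
  - move=> x; have x0 := sqr_ge0 (x j 0).
    rewrite ger0_norm ?le_max ?lexx ?orbT // ge_max; apply/andP; split; last first.
      by rewrite addr_ge0 // mulr_ge0.
    apply: (@le_trans _ _ (`|c| * x j 0 ^+ 2)); last by rewrite lerDl.
    by rewrite -[leRHS]subr0 lerB // ler_wpM2r // ler_norm.
  - by apply: mgrowthD; [apply: mgrowthZ; exact: mgrowth_coord2 | exact: mgrowth_cst].
pose c j := 16 / (beta * w j).
have c0 j : 0 <= c j by rewrite divr_ge0 // mulr_ge0 ?(ltW b0) ?(ltW (w0 j)).
apply: (@le_trans _ _ (Ex Q (fun x => \sum_j w j * Num.max (c j * x j 0 ^+ 2 - B) 0))).
  apply: Ex_le => //.
  - apply: (mgrowth_le _ (fun x => 16 / beta * inner x x)).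
    + apply: measurable_maxr => //; apply: measurable_funB => //; apply: measurable_funM => //.
      by apply: measurable_funM => //; exact: measurable_inner2.
    + move=> x; have x0 : 0 <= inner x x / beta by rewrite divr_ge0 ?inner_ge0 // ltW.
      rewrite ger0_norm ?le_max ?lexx ?orbT // ge_max.
      by rewrite -mulrA [beta^-1 * _]mulrC mulr_ge0 // andbT; lra.
    + by apply: mgrowthZ; exact: mgrowth_norm2.
  - by apply: mgrowth_sum => j; exact: mgrowthZ.
  move=> x; rewrite ge_max; apply/andP; split; last first.
    by apply: sumr_ge0 => j _; rewrite mulr_ge0 ?(ltW (w0 j)) // le_max lexx orbT.
  apply: (@le_trans _ _ (\sum_j w j * (c j * x j 0 ^+ 2 - B))); last first.
    by apply: ler_sum => j _; rewrite ler_wpM2l ?(ltW (w0 j)) // le_max lexx.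
  have -> : \sum_j w j * (c j * x j 0 ^+ 2 - B) = 16 * (inner x x / beta) - (\sum_j w j) * B.
    rewrite [X in _ - X]mulr_suml /inner mulr_suml mulr_sumr -sumrB; apply: eq_bigr => j _.
    by rewrite /c; field; rewrite !gt_eqF.
  by rewrite lerB // -[leRHS]mul1r ler_wpM2r.
rewrite Ex_sum //; last by move=> j; exact: mgrowthZ.
apply: (@le_trans _ _ (\sum_j w j * D)); last by rewrite -mulr_suml -[leRHS]mul1r ler_wpM2r.
apply: ler_sum => j _; rewrite ExZ // ler_wpM2l ?(ltW (w0 j)) //.
have := h (delta_mx j 0) (c j) (c0 j).
under [X in _ * Ex _ X <= _]eq_fun do rewrite inner_delta.
under [X in Ex _ X <= D]eq_fun do rewrite inner_delta.
apply; rewrite -/(m j) /c /w.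
have me : 0 < m j + e by rewrite ltr_wpDl.
have -> : 16 / (beta * ((m j + e) / (2 * (beta * s)))) * m j = 32 * s * m j / (m j + e).
  by field; rewrite !gt_eqF.
rewrite ler_pdivrMr //; have := m0 j; move: (m j) e0 => z e0 z0; nra.
Qed.

End NormMoments.

Section Trace.
Context {R : realType} {d : nat} {d0 : measure_display} {Omega0 : measurableType d0}.
Context (P0 : probability Omega0 R) (X0 : {RV P0 >-> 'cV[R]_d}).
Let Q := distribution P0 X0.
Let Sigma := second_moment X0.
Hypothesis Q4 : fourth_moment_finite Q.

Lemma Ex_norm2_trace : Ex Q (fun x => inner x x) = \tr Sigma.
Proof.
rewrite Ex_norm2 //; apply: eq_bigr => j _.
under eq_fun do rewrite -inner_delta.
by rewrite second_moment_form // innerC inner_delta -colE mxE.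
Qed.

Lemma second_moment_le v : Ex Q (fun x => inner x v ^+ 2) <= opnorm Sigma * inner v v.
Proof. by rewrite second_moment_form //; exact: form_le_opnorm. Qed.

End Trace.

(** * A measurable selection *)

Section CountableMeasurability.
Context {dT : measure_display} {T : measurableType dT}.
Implicit Type I : countType.

Lemma measurable_exists I (F : I -> T -> Prop) :
  (forall i, measurable [set y | F i y]) -> measurable [set y | exists i, F i y].
Proof.
move=> mF; rewrite (_ : mkset _ = \bigcup_i [set y | F i y]).
  by apply: countable_bigcupT_measurable.
by apply/seteqP; split=> y /= [i]; [exists i | exists i].
Qed.

Lemma measurable_forall I (F : I -> T -> Prop) :
  (forall i, measurable [set y | F i y]) -> measurable [set y | forall i, F i y].
Proof.
move=> mF; rewrite (_ : mkset _ = ~` [set y | exists i, ~ F i y]).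
  by apply: measurableC; apply: measurable_exists => i; exact: measurableC (mF i).
apply/seteqP; split=> y /= h; first by case=> i; apply.
by move=> i; apply: contrapT => nF; apply: h; exists i.
Qed.

Lemma measurable_and (F G : T -> Prop) : measurable [set y | F y] -> measurable [set y | G y] ->
  measurable [set y | F y /\ G y].
Proof. exact: measurableI. Qed.

Lemma measurable_cst_prop (p : Prop) : measurable [set _ : T | p].
Proof.
have [hp|hp] := pselect p.
  by rewrite (_ : mkset _ = setT) //; apply/seteqP; split=> y.
by rewrite (_ : mkset _ = set0) //; apply/seteqP; split=> y.
Qed.

Lemma measurable_imply (p : Prop) (F : T -> Prop) :
  (p -> measurable [set y | F y]) -> measurable [set y | p -> F y].
Proof.
move=> mF; have [hp|hp] := pselect p.
  rewrite (_ : mkset _ = [set y | F y]); first exact: mF.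
  by apply/seteqP; split=> y /=; auto.
by rewrite (_ : mkset _ = setT) //; apply/seteqP; split=> y //= _ /hp.
Qed.

Lemma measurable_le_set (R : realType) (f g : T -> R) :
  measurable_fun setT f -> measurable_fun setT g -> measurable [set y | f y <= g y].
Proof.
move=> mf mg; rewrite (_ : mkset _ = setT `&` (fun y => g y - f y) @^-1` `[0, +oo[%classic).
  by apply: measurable_funB => //; exact: measurable_itv.
by apply/seteqP; split=> y /=; rewrite in_itv /= andbT subr_ge0 => // -[].
Qed.

(* Choosing the first admissible index makes every preimage measurable, since
   the selected function has countable range. *)
Lemma countable_selection I (G : I -> set T) (S : Type) (A : I -> S) (a0 : S) :
  (forall i, measurable (G i)) ->
  exists E : T -> S, (forall B : set S, measurable (E @^-1` B)) /\
    forall y, (exists2 i, G i y & E y = A i) \/ (forall i, ~ G i y) /\ E y = a0.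
Proof.
move=> mG.
pose H k y := if unpickle k is Some i then G i y else False.
pose F k := if unpickle k is Some i then A i else a0.
pose first k y := H k y /\ forall j : nat, (j < k)%N -> ~ H j y.
have mH k : measurable [set y | H k y].
  rewrite /H; case: (unpickle k) => [i|]; first exact: mG.
  exact: measurable_cst_prop.
have mfirst k : measurable [set y | first k y].
  apply: measurable_and => //; apply: measurable_forall => j.
  by apply: measurable_imply => _; exact: measurableC (mH j).
have first_inj y k k' : first k y -> first k' y -> k = k'.
  move=> [Hk mk] [Hk' mk']; apply/eqP; rewrite eqn_leq; apply/andP; split.
    by rewrite leqNgt; apply/negP => /mk.
  by rewrite leqNgt; apply/negP => /mk'.
have first_ex y : (exists i, G i y) -> exists k, first k y.
  move=> [i Gi]; have h : exists k, `[< H k y >].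
    by exists (pickle i); apply/asboolP; rewrite /H pickleK.
  exists (ex_minn h); case: ex_minnP => k /asboolP Hk mk; split=> // j jk Hj.
  by have := mk j; rewrite leqNgt jk; move=> /(_ _)/negP; apply => //; exact/asboolP.
have /choice[E hE] : forall y, exists a : S, (exists2 k, first k y & a = F k) \/
    (forall i, ~ G i y) /\ a = a0.
  move=> y; have [ex|nex] := pselect (exists i, G i y).
    by have [k hk] := first_ex y ex; exists (F k); left; exists k.
  by exists a0; right; split=> // i Gi; apply: nex; exists i.
exists E; split; last first.
  move=> y; case: (hE y) => [[k [Hk _] ->]|]; [left|by right].
  by move: Hk; rewrite /H /F; case: (unpickle k) => // i Gi; exists i.
move=> B; rewrite (_ : _ @^-1` _ = [set y | exists k, first k y /\ B (F k)] `|`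
    ([set y | forall i, ~ G i y] `&` [set _ | B a0])).
  apply: measurableU.
    by apply: measurable_exists => k; apply: measurable_and => //; exact: measurable_cst_prop.
  apply: measurableI; last exact: measurable_cst_prop.
  by apply: measurable_forall => i; exact: measurableC (mG i).
apply/seteqP; split=> y /=.
  case: (hE y) => [[k hk ->] Bk|[nG ->] Ba]; first by left; exists k.
  by right.
case=> [[k [hk Bk]]|[nG Ba]]; case: (hE y) => [[k' hk' ->]|[nG' ->]] //.
- by rewrite (first_inj _ _ _ hk' hk).
- move: hk => [Hk _]; move: Hk; rewrite /H; case: (unpickle k) => // i Gi.
  by case: (nG' i).
- move: hk' => [Hk _]; move: Hk; rewrite /H; case: (unpickle k') => // i Gi.
  by case: (nG i).
Qed.

End CountableMeasurability.

(** * The estimator: a least passing budget and a nearly best rational fit *)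

Section Estimator.
Context {R : realType} {d n : nat} (kap : nat) (eta l : R).
Local Notation data := (n.-tuple 'cV[R]_d).
Local Notation code := ('M[int]_(d, d) * nat)%type.
Local Notation vcode := ('M[int]_(d, 1) * nat)%type.
Let rv (U : vcode) : 'cV[R]_d := ratmx d 1 U.
Let rm (Z : code) : 'M[R]_d := ratmx d d Z.
Let form m (y : data) v := trim_form (kap * m) (tnth y) v / n%:R.
Let gap m y (Z : code) (U : vcode) := `|form m y (rv U) - inner (rv U) (rm Z *m rv U)|.
Let in_ball (U : vcode) := inner (rv U) (rv U) <= 1.

Let ball_rv U : in_ball U -> rational_ball (rv U).
Proof. by move=> h; split=> //; exists U. Qed.

Let ballP v : rational_ball v -> exists2 U, in_ball U & v = rv U.
Proof. by move=> [v1 [U vE]]; exists U => //; rewrite /in_ball /rv -vE. Qed.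

Let measurable_data j : measurable_fun setT (fun y : data => tnth y j).
Proof. exact: measurable_tnth. Qed.

Let measurable_form m v : measurable_fun setT (fun y : data => trim_form (kap * m) (tnth y) v).
Proof.
apply: measurable_trim => i; apply: measurable_funX.
exact: (measurableT_comp (measurable_inner v) (measurable_data i)).
Qed.

Let measurable_norm m : measurable_fun setT (fun y : data => trim_norm (5 * m) (tnth y)).
Proof.
by apply: measurable_trim => i; exact: (measurableT_comp measurable_inner2 (measurable_data i)).
Qed.

Let measurable_passes m : measurable [set y : data | passes kap rational_ball (tnth y) m].
Proof.
rewrite (_ : mkset _ =
    [set y : data | exists U : vcode, in_ball U /\ passes_at kap m (tnth y) (rv U)]).
  apply: measurable_exists => U; apply: measurable_and; first exact: measurable_cst_prop.
  by apply: measurable_le_set => //; apply: measurable_funM.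
apply/seteqP; split=> y /=.
  by move=> [v /ballP[U U1 ->] p]; exists U.
by move=> [U [U1 p]]; exists (rv U) => //; exact: ball_rv.
Qed.

(* [Z] nearly minimises [sup gap]; the slack relative to the size of the trimmed
   form itself makes a near-minimiser exist even when the infimum is zero. *)
Let near_minimizer m (y : data) (Z : code) : Prop :=
  forall Z' : code, psd (rm Z') -> forall U, in_ball U -> exists W, in_ball W /\ exists W', in_ball W' /\
    gap m y Z U <= 2 * gap m y Z' W + form m y (rv W') / n%:R.

Let selects (c : nat * code) (y : data) : Prop :=
  [/\ (c.1 < n)%N, admissible (n := n) eta l c.1, psd (rm c.2) & passes kap rational_ball (tnth y) c.1] /\
  (forall m', (m' < c.1)%N -> admissible (n := n) eta l m' -> ~ passes kap rational_ball (tnth y) m') /\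
  near_minimizer c.1 y c.2.

Let measurable_selects c : measurable [set y | selects c y].
Proof.
apply: measurable_and; last apply: measurable_and.
- rewrite (_ : mkset _ = [set _ | [/\ (c.1 < n)%N, admissible (n := n) eta l c.1 & psd (rm c.2)]]
     `&` [set y | passes kap rational_ball (tnth y) c.1]).
    by apply: measurableI => //; exact: measurable_cst_prop.
  by apply/seteqP; split=> y /=; [case | case=> -[]].
- apply: measurable_forall => m'; apply: measurable_imply => _; apply: measurable_imply => _.
  exact: measurableC (measurable_passes m').
apply: measurable_forall => Z'; apply: measurable_imply => _.
apply: measurable_forall => U; apply: measurable_imply => _.
apply: measurable_exists => W; apply: measurable_and; first exact: measurable_cst_prop.
apply: measurable_exists => W'; apply: measurable_and; first exact: measurable_cst_prop.
have mf m v : measurable_fun setT (form m ^~ v) by apply: measurable_funM.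
have mg Z U' : measurable_fun setT (fun y => gap c.1 y Z U').
  by apply: measurableT_comp => //; exact: measurable_funB.
by apply: measurable_le_set => //; apply: measurable_funD; apply: measurable_funM.
Qed.

Let zero_in_ball : in_ball (0, 0%N).
Proof.
have r0 : rv (0, 0%N) = 0 by apply/matrixP => i j; rewrite !mxE mulr0.
by rewrite /in_ball r0 inner0l ler01.
Qed.

(** If some trimmed form on the ball is positive, the infimum over [Z] and the supremum over
    directions are each attained up to a quarter of the slack; if all vanish, the zero matrix has no
    gap. *)
Let near_minimizer_exists m y : (0 < n)%N -> exists Z, psd (rm Z) /\ near_minimizer m y Z.
Proof.
move=> n0; have nR : 0 < n%:R :> R by rewrite ltr0n.
have form0 v : 0 <= form m y v by rewrite divr_ge0 // trim_form_ge0.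
pose bnd : R := (\sum_i inner (tnth y i) (tnth y i)) / n%:R.
have form_le U : in_ball U -> form m y (rv U) <= bnd.
  move=> U1; rewrite ler_wpM2r ?invr_ge0 //.
  apply: le_trans (trim_le _ _ [set: 'I_n]%SET _) _; first by rewrite finset.setCT cards0.
  under eq_bigl do rewrite inE; apply: ler_sum => i _.
  apply: le_trans (inner_sqr_le _ _) _; rewrite ler_piMr ?inner_ge0 //.
have gap_le Z U : psd (rm Z) -> in_ball U -> gap m y Z U <= bnd + opnorm (rm Z).
  move=> [_ Z0] U1; apply: le_trans (ler_normB _ _) _.
  rewrite !ger0_norm //; apply: lerD; first exact: form_le.
  by apply: le_trans (form_le_opnorm _ _) _; rewrite ler_piMr ?opnorm_ge0.
pose gaps Z := [set gap m y Z U | U in [set U | in_ball U]].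
have gaps_sup Z : psd (rm Z) -> has_sup (gaps Z).
  move=> hZ; split; first by exists (gap m y Z (0, 0%N)); exists (0, 0%N).
  by exists (bnd + opnorm (rm Z)) => _ [U U1 <-]; exact: gap_le.
have gap_sup Z U : psd (rm Z) -> in_ball U -> gap m y Z U <= sup (gaps Z).
  by move=> hZ U1; apply: (ub_le_sup (proj2 (gaps_sup Z hZ))); exists U.
pose discs := [set sup (gaps Z) | Z in [set Z | psd (rm Z)]].
have psd0 : psd (rm (0, 0%N)).
  have -> : rm (0, 0%N) = 0 by apply/matrixP => i j; rewrite !mxE mulr0.
  by split=> [|v]; [rewrite trmx0 | rewrite mul0mx inner0r].
have discs_lb : lbound discs 0.
  by move=> _ [Z hZ <-]; apply: le_trans (gap_sup Z (0, 0%N) hZ zero_in_ball); exact: normr_ge0.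
have discs_inf : has_inf discs.
  by split; [exists (sup (gaps (0, 0%N))); exists (0, 0%N) | exists 0].
have inf0 : 0 <= inf discs by apply: lb_le_inf => //; case: discs_inf.
have inf_le Z : psd (rm Z) -> inf discs <= sup (gaps Z).
  by move=> hZ; apply: (ge_inf (proj2 discs_inf)); exists Z.
have [U0|allz] := pselect (exists2 W, in_ball W & 0 < form m y (rv W)).
  have [W W1 Wp] := U0; have Wn : 0 < form m y (rv W) / n%:R by rewrite divr_gt0.
  have W2 : 0 < form m y (rv W) / n%:R / 4 by rewrite divr_gt0.
  have [_ [Z hZ <-] Zlt] := inf_adherent W2 discs_inf.
  exists Z; split=> // Z' hZ' U U1.
  have [_ [W' W'1 <-] W'gt] := sup_adherent W2 (gaps_sup Z' hZ').
  exists W'; split=> //; exists W; split=> //.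
  have := gap_sup Z U hZ U1; have := inf_le Z' hZ'; have := normr_ge0 (form m y (rv W') - inner (rv W') (rm Z' *m rv W')).
  rewrite -/(gap m y Z' W') => g0; move: W'gt Zlt.
  move: (sup (gaps Z)) (sup (gaps Z')) (inf discs) inf0 (gap m y Z' W') g0 (form m y (rv W) / n%:R) Wn.
  move=> a b c c0 g g0 f f0; lra.
exists (0, 0%N); split=> // Z' hZ' U U1.
exists (0, 0%N); split=> //; exists (0, 0%N); split=> //.
have -> : gap m y (0, 0%N) U = 0.
  have fU : form m y (rv U) = 0.
    apply/eqP; rewrite eq_le form0 andbT leNgt; apply/negP => fp.
    by apply: allz; exists U.
  rewrite /gap fU sub0r normrN (_ : rm (0, 0%N) = 0); last by apply/matrixP => i j; rewrite !mxE mulr0.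
  by rewrite mul0mx inner0r normr0.
by apply: addr_ge0; [apply: mulr_ge0 => //; exact: normr_ge0 | exact: divr_ge0].
Qed.

(** A rational [Z'] within [e] of [S] has gap at most [2 * e], so the chosen [Z] has gap at most
    [4 * e + B / n]; comparing the trimmed form with [S] adds one more [e]. *)
Let near_minimizer_error m y Z (S : 'M[R]_d) e B : (0 < n)%N -> psd (rm Z) -> near_minimizer m y Z ->
  psd S -> 0 < e ->
  (forall v, inner v v <= 1 ->
     `|trim_form (kap * m) (tnth y) v - n%:R * inner v (S *m v)| <= n%:R * e) ->
  (forall v, inner v v <= 1 -> trim_form (kap * m) (tnth y) v <= n%:R * B) ->
  opnorm (rm Z - S) <= 5 * e + B / n%:R.
Proof.
move=> n0 [ZT Z0] hZ [ST S0] e0 hS hB; have nR : 0 < n%:R :> R by rewrite ltr0n.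
have hS' v : inner v v <= 1 -> `|form m y v - inner v (S *m v)| <= e.
  move=> v1; rewrite -(ler_pM2l nR) -[X in X * `|_|](gtr0_norm nR) -normrM.
  apply: le_trans (hS v v1); rewrite /form mulrBr mulrCA divff ?gt_eqF // mulr1 //.
have hB' v : inner v v <= 1 -> form m y v <= B.
  by move=> v1; rewrite ler_pdivrMr // mulrC; exact: hB.
have [Z' [hZ' near]] := rational_psd_dense S e (conj ST S0) e0.
have B0 : 0 <= B.
  apply: le_trans (hB' 0 _); last by rewrite inner0l ler01.
  by rewrite divr_ge0 // trim_form_ge0.
apply: opnorm_le_form => [||v v1].
- by rewrite linearB /= ZT ST.
- by rewrite addr_ge0 ?divr_ge0 // mulr_ge0 // ltW.
apply: form_le_dense v1 => u /ballP[U U1 ->].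
have [W [W1 [W' [W'1]]]] := hZ Z' hZ' U U1.
have fW : form m y (rv W') / n%:R <= B / n%:R.
  by apply: ler_wpM2r; [rewrite invr_ge0 | exact: hB'].
have gW : gap m y Z' W <= 2 * e.
  have := near (rv W) W1; rewrite mulmxBl innerBr => nW.
  have := hS' (rv W) W1; rewrite /gap /rm.
  move: nW; move: (form _ _ _) (inner _ (S *m _)) (inner _ _) => a b c h1 h2.
  rewrite (_ : a - c = (a - b) - (c - b)); last by ring.
  apply: le_trans (ler_normB _ _) _; lra.
move=> gU; rewrite mulmxBl innerBr.
have := hS' (rv U) U1; move: gU; rewrite {1}/gap.
move: (form m y (rv U)) (inner (rv U) (S *m _)) (inner (rv U) _) => a b c gU h.
rewrite (_ : c - b = (a - b) - (a - c)); last by ring.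
apply: le_trans (ler_normB _ _) _.
have gU' : `|a - c| <= 4 * e + B / n%:R.
  by apply: le_trans gU _; move: gW fW; move: (gap _ _ _ _) (form _ _ _ / _) (B / _) => g1 g2 g3; lra.
lra.
Qed.

Lemma estimator_exists : exists Est : data -> 'M[R]_d,
  [/\ forall A : set 'M[R]_d, measurable (Est @^-1` A), forall y, psd (Est y) &
   forall y, (exists m, [/\ (m < n)%N, admissible (n := n) eta l m, passes kap rational_ball (tnth y) m,
       forall m', (m' < m)%N -> admissible (n := n) eta l m' -> ~ passes kap rational_ball (tnth y) m' &
       forall S e B, psd S -> 0 < e ->
         (forall v, inner v v <= 1 ->
            `|trim_form (kap * m) (tnth y) v - n%:R * inner v (S *m v)| <= n%:R * e) ->
         (forall v, inner v v <= 1 -> trim_form (kap * m) (tnth y) v <= n%:R * B) ->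
         opnorm (Est y - S) <= 5 * e + B / n%:R]) \/
     (forall m, (m < n)%N -> admissible (n := n) eta l m -> ~ passes kap rational_ball (tnth y) m) /\
     Est y = 0].
Proof.
have [Est [mE hE]] := countable_selection _ (fun c => [set y | selects c y]) _
  (fun c : nat * code => rm c.2) 0 measurable_selects.
exists Est; split=> // y.
  case: (hE y) => [[c [[_ _ hZ _] _] ->] //|[_ ->]].
  by split=> [|v]; [rewrite trmx0 | rewrite mul0mx inner0r].
case: (hE y) => [[[m Z] /= [[mn am hZ pm] [minm nearm]] ->]|[nosel ->]].
  left; exists m; split=> // S e B hS e0 h1 h2.
  by apply: near_minimizer_error nearm _ _ _ _ => //; exact: leq_ltn_trans mn.
right; split=> // m mn am pm.
have ex : exists m0, `[< [/\ (m0 < n)%N, admissible (n := n) eta l m0 & passes kap rational_ball (tnth y) m0] >].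
  by exists m; exact/asboolP.
case: (ex_minnP ex) => m0 /asboolP[m0n am0 pm0] min0.
have [Z [hZ nearZ]] := near_minimizer_exists m0 y (leq_ltn_trans (leq0n m0) m0n).
apply: (nosel (m0, Z)); split=> //; split=> // m' /= m'm am' pm'.
have : (m0 <= m')%N by apply: min0; apply/asboolP; split=> //; exact: ltn_trans m0n.
by rewrite leqNgt m'm.
Qed.

End Estimator.

(** * The favourable event *)

Lemma geometric_tail (R : realType) (l : R) N :
  \sum_(m < N) (if l <= m%:R then expR (- m%:R) else 0) <= 2 * expR (- l).
Proof.
have e2 : 2 * expR (- 1) <= 1 :> R.
  have := expR_ge1Dx (1 : R); have p := expR_gt0 (1 : R).
  by rewrite expRN -ler_pdivlMr ?invr_gt0 // div1r invrK; lra.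
(* The induction needs the tail still to come on the left-hand side. *)
suff : \sum_(m < N) (if l <= m%:R then expR (- m%:R) else 0) +
    2 * expR (- Num.max N%:R l) <= 2 * expR (- l).
  have := expR_ge0 (- Num.max N%:R l); lra.
elim: N => [|N IH].
  rewrite big_ord0 add0r ler_wpM2l // ler_expR lerN2 le_max lexx orbT //.
rewrite big_ord_recr /=; apply: le_trans IH; rewrite -addrA lerD2l.
have h : 2 * expR (- N.+1%:R) <= expR (- N%:R) :> R.
  have -> : expR (- N.+1%:R) = expR (- 1) * expR (- N%:R) :> R.
    by rewrite -expRD; congr expR; rewrite -natr1; ring.
  by rewrite mulrA ler_piMl // expR_ge0.
case: (leP l N%:R) => lN.
  have -> : Num.max N.+1%:R l = N.+1%:R.
    by apply/max_idPl; apply: le_trans lN _; rewrite ler_nat.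
  by move: h; move: (expR _) (expR _) => a b; lra.
by rewrite add0r ler_wpM2l // ler_expR lerN2 le_max lexx orbT.
Qed.

Section Events.
Context {R : realType} {d : nat}.
Context {dT : measure_display} {T : measurableType dT}.
Context (P : probability T R) (Q : probability 'cV[R]_d R) (n : nat).
Context (X : 'I_n -> {RV P >-> 'cV[R]_d}).
Hypothesis Q4 : fourth_moment_finite Q.
Hypothesis iidX : iid_law P Q n X.
Local Notation Ex := (Ex Q).
Context (s K : R).
Hypotheses (n0 : (0 < n)%N) (s0 : 0 < s) (K1 : 1 <= K).
Hypothesis second_le : forall v, Ex (fun x => inner x v ^+ 2) <= s * inner v v.
Let tr := Ex (fun x => inner x x).
Hypothesis tr0 : 0 < tr.
Hypothesis norm4_le : Ex (fun x => inner x x ^+ 2) <= K * tr ^+ 2.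

Let measurable_min_norm (c B : R) :
  measurable_fun setT (fun x : 'cV[R]_d => Num.min (inner x x / c) B).
Proof.
by apply: measurable_minr => //; apply: measurable_funM => //; exact: measurable_inner2.
Qed.

Let min_norm01 (c B : R) (x : 'cV[R]_d) : 0 < c -> 0 < B -> 0 <= Num.min (inner x x / c) B / B <= 1.
Proof.
move=> c0 B0; rewrite divr_ge0 ?le_min ?divr_ge0 ?inner_ge0 ?(ltW B0) ?(ltW c0) //=.
by rewrite ler_pdivrMr // mul1r ge_min lexx orbT.
Qed.

Let mgrowth_min_norm (c B : R) : 0 < c -> 0 < B ->
  mgrowth (fun x : 'cV[R]_d => Num.min (inner x x / c) B).
Proof.
move=> c0 B0; apply: (mgrowth_bounded _ B) => // x.
by rewrite ger0_norm ?ge_min ?lexx ?orbT // le_min divr_ge0 ?inner_ge0 ?ltW.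
Qed.

Lemma norm_upper_event l B : 0 < B -> whp P (expR (- l)) [set w |
  \sum_j Num.min (inner (X j w) (X j w)) B <= 3 * (n%:R * tr) + l * B].
Proof.
move=> B0; pose f (x : 'cV[R]_d) := Num.min (inner x x / 1) B / B.
have mf : measurable_fun setT f by apply: measurable_funM.
have f01 x : 0 <= f x <= 1 by exact: min_norm01.
apply: whp_sub (chernoff_upper P Q n X Q4 iidX f l mf f01) => w /= h.
have Ef : Ex f <= tr / B.
  rewrite -(divr1 tr).
  apply: (@le_trans _ _ (Ex (fun x => B^-1 * inner x x))); last first.
    by rewrite ExZ //; [rewrite mulrC divr1 | exact: mgrowth_norm2].
  apply: Ex_le => //.
  - by apply: (mgrowth_bounded _ 1) => // x; have /andP[a b] := f01 x; rewrite ger0_norm.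
  - by apply: mgrowthZ; exact: mgrowth_norm2.
  by move=> x; rewrite /f divr1 mulrC ler_wpM2l ?invr_ge0 ?(ltW B0) // ge_min lexx.
have -> : \sum_j Num.min (inner (X j w) (X j w)) B = B * \sum_j f (X j w).
  rewrite mulr_sumr; apply: eq_bigr => j _.
  by rewrite /f divr1 mulrCA divff ?mulr1 // gt_eqF.
apply: (@le_trans _ _ (B * (3 * n%:R * (tr / B) + l))).
  rewrite ler_pM2l //; apply: le_trans h _; rewrite lerD2r ler_wpM2l // mulr_ge0 //.
by rewrite [leLHS](_ : _ = 3 * (n%:R * tr) + l * B) //; field; rewrite gt_eqF.
Qed.

Lemma norm_lower_event l : whp P (expR (- l)) [set w |
  n%:R * tr / 2 <= 2 * (\sum_j Num.min (inner (X j w) (X j w)) (2 * K * tr)) + 4 * (l * K * tr)].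
Proof.
have K0 : 0 < K by apply: lt_le_trans K1.
set B := 2 * K * tr; have B0 : 0 < B by rewrite /B !mulr_gt0.
pose f (x : 'cV[R]_d) := Num.min (inner x x / 1) B / B.
have mf : measurable_fun setT f by apply: measurable_funM.
have f01 x : 0 <= f x <= 1 by exact: min_norm01.
apply: whp_sub (chernoff_lower P Q n X Q4 iidX f l mf f01) => w /= h.
have gf : mgrowth f.
  by apply: (mgrowth_bounded _ 1) => // x; have /andP[a b] := f01 x; rewrite ger0_norm.
have Ef : tr / 2 <= B * Ex f.
  (* Pointwise [r <= min r B + r^2 / (4 B)] with [r = inner x x]; for [B = 2 K tr] the last term has
     mean at most [tr / 8]. *)
  have : tr <= Ex (fun x => B * f x + (4 * B)^-1 * inner x x ^+ 2).
    apply: Ex_le => //; first exact: mgrowth_norm2.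
      by apply: mgrowthD; [exact: mgrowthZ | apply: mgrowthZ; exact: mgrowth_norm4].
    move=> x; rewrite /f divr1 mulrCA divff ?gt_eqF // mulr1.
    case: (leP (inner x x) B) => xB; first by rewrite lerDl mulr_ge0 ?sqr_ge0 ?invr_ge0 ?mulr_ge0 // ltW.
    rewrite -subr_ge0 [leRHS](_ : _ = (inner x x - 2 * B) ^+ 2 / (4 * B)); last by field; rewrite gt_eqF.
    by rewrite divr_ge0 ?sqr_ge0 // mulr_ge0 // ltW.
  rewrite ExD //; [|exact: mgrowthZ|by apply: mgrowthZ; exact: mgrowth_norm4].
  rewrite !ExZ //; last exact: mgrowth_norm4.
  have : (4 * B)^-1 * Ex (fun x => inner x x ^+ 2) <= tr / 8.
    apply: (@le_trans _ _ ((4 * B)^-1 * (K * tr ^+ 2))).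
      by rewrite ler_wpM2l // invr_ge0 mulr_ge0 // ltW.
    by rewrite /B [leLHS](_ : _ = tr / 8) //; field; rewrite !gt_eqF.
  have := tr0; move: (_^-1 * _) (B * _) tr => a b c; lra.
have -> : \sum_j Num.min (inner (X j w) (X j w)) B = B * \sum_j f (X j w).
  rewrite mulr_sumr; apply: eq_bigr => j _.
  by rewrite /f divr1 mulrCA divff ?mulr1 // gt_eqF.
have -> : 4 * (l * K * tr) = B * (2 * l) by rewrite /B; ring.
apply: (@le_trans _ _ (n%:R * (B * Ex f))); first by rewrite -mulrA ler_wpM2l.
have := ler_wpM2l (ltW B0) h; move: (Ex f) (\sum_j _) => a b; lra.
Qed.

(* At the level [B] chosen here the truncated forms and the truncated trace are
   both comparable to [B * m]. *)
Lemma level_event (m : nat) : (0 < m)%N -> exists B phi : R,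
  [/\ 0 < B, 60 * (B * m%:R) <= n%:R * phi <= 120 * (B * m%:R) &
  whp P (3 * expR (- m%:R)) [set w |
    (forall v, inner v v <= 1 -> \sum_j Num.min (inner (X j w) v ^+ 2) B <=
       96 * n%:R * phi + B * (2 * m%:R + 18 * m%:R)) /\
    n%:R * (phi - s) <= 2 * (\sum_j Num.min (inner (X j w) (X j w) / m%:R) B) + 2 * m%:R * B]].
Proof.
move=> m0; have mR : 0 < m%:R :> R by rewrite ltr0n.
have nR : 0 < n%:R :> R by rewrite ltr0n.
pose phi B := s + Ex (fun x => Num.min (inner x x / m%:R) B).
have [B [B0 h1 h2]] : exists B, [/\ 0 < B, 60 * m%:R / n%:R * B <= phi B &
    phi B <= 2 * (60 * m%:R / n%:R * B)].
  apply: (exists_balanced_level R phi s (s + tr / m%:R)) => //.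
  - by rewrite divr_gt0 ?mulr_gt0.
  - move=> B B0; rewrite lerDl lerD2l; apply/andP; split.
      by apply: Ex_ge0 => x; rewrite le_min divr_ge0 ?inner_ge0 ?(ltW mR) // ltW.
    apply: (@le_trans _ _ (Ex (fun x => m%:R^-1 * inner x x))).
      apply: Ex_le => //; first exact: mgrowth_min_norm.
        by apply: mgrowthZ; exact: mgrowth_norm2.
      by move=> x; rewrite mulrC ge_min lexx.
    by rewrite ExZ; [rewrite mulrC | | exact: mgrowth_norm2].
  - move=> B B' B0 BB'; rewrite lerD2l.
    apply: Ex_le => //; [exact: mgrowth_min_norm | apply: mgrowth_min_norm => // |].
      exact: lt_le_trans BB'.
    by move=> x; apply: le_min2.
exists B, (phi B); split=> //.
  apply/andP; split.
    have := ler_wpM2l (ltW nR) h1.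
    by rewrite (_ : _ * (60 * m%:R / n%:R * B) = 60 * (B * m%:R)) //; field; rewrite gt_eqF.
  have := ler_wpM2l (ltW nR) h2.
  by rewrite (_ : _ * (2 * (60 * m%:R / n%:R * B)) = 120 * (B * m%:R)) //; field; rewrite gt_eqF.
pose f (x : 'cV[R]_d) := Num.min (inner x x / m%:R) B / B.
have mf : measurable_fun setT f by apply: measurable_funM.
have f01 x : 0 <= f x <= 1 by exact: min_norm01.
have ev1 := truncated_uniform P Q n X Q4 iidX s s0 second_le m%:R m%:R B mR B0.
have ev2 := chernoff_lower P Q n X Q4 iidX f m%:R mf f01.
apply: whp_le (_ : expR (- m%:R) + expR (- m%:R) + expR (- m%:R) <= _) _; first by lra.
apply: whp_sub (whp_setI _ _ _ _ _ ev1 ev2) => w [/= g1 g2]; split; first exact: g1.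
have -> : phi B - s = B * Ex f.
  rewrite /phi addrC addKr -ExZ //; last first.
    by apply: (mgrowth_bounded _ 1) => // x; have /andP[a b] := f01 x; rewrite ger0_norm.
  by congr Ex; apply/funext => x; rewrite /f mulrCA divff ?mulr1 // gt_eqF.
have -> : \sum_j Num.min (inner (X j w) (X j w) / m%:R) B = B * \sum_j f (X j w).
  by rewrite mulr_sumr; apply: eq_bigr => j _; rewrite /f mulrCA divff ?mulr1 // gt_eqF.
have := ler_wpM2l (ltW B0) g2; move: (Ex f) (\sum_j _) => a b; lra.
Qed.

(** The level [B] depends only on the law and on [m], so a union bound over budgets suffices, and
    failure probabilities of order [expR (- m)] are summable; [6 = 3 * 2], the 2 coming from the
    geometric tail. *)
Lemma levels_event l : 1 <= l -> whp P (6 * expR (- l)) [set w | forall m, (m < n)%N -> l <= m%:R ->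
  exists B phi : R, [/\ 0 < B, 60 * (B * m%:R) <= n%:R * phi <= 120 * (B * m%:R),
    (forall v, inner v v <= 1 -> \sum_j Num.min (inner (X j w) v ^+ 2) B <=
       96 * n%:R * phi + B * (2 * m%:R + 18 * m%:R)) &
    n%:R * (phi - s) <= 2 * (\sum_j Num.min (inner (X j w) (X j w) / m%:R) B) + 2 * m%:R * B]].
Proof.
move=> l1.
apply: whp_le (_ : \sum_(m < n) 3 * (if l <= m%:R then expR (- m%:R) else 0) <= _) _.
  by rewrite -mulr_sumr; have := geometric_tail R l n; lra.
apply: (whp_forall P n (fun m => 3 * (if l <= m%:R then expR (- m%:R) else 0))
  (fun m => [set w | l <= m%:R -> exists B phi : R, [/\ _, _, _ & _]])) => m.
case: (leP l m%:R) => lm; last first.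
  by rewrite mulr0; apply: whp_sub (whpT P) => w _ /=.
have m0 : (0 < m)%N by rewrite -(ltr_nat R); apply: lt_le_trans lm; apply: lt_le_trans l1.
have [B [phi [B0 Bphi ev]]] := level_event m m0.
by apply: whp_sub ev => w [h1 h2] _; exists B, phi.
Qed.

End Events.

(** * Choice of the numerical constants *)

Section Calibration.
Context {R : realType}.

(** [ct] and [cr] are the constants of [two_sided_uniform], and [78 * 1000] is [3 * cr], the number
    of deletions per unit of budget that removes the ill-sized points. *)
Definition calibrated (kap : nat) (cb ct cr : R) : Prop :=
  [/\ 256 * 100 <= cb, ct = 70 + 50 * (130 * 200), cr = 130 * 200 &
      78 * 1000 + 1 <= kap%:R :> R].

Lemma calibrated_exists : exists kap cb ct cr, calibrated kap cb ct cr.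
Proof.
exists (Num.truncn (78 * 1000 + 1 : R)).+1, (256 * 100), (70 + 50 * (130 * 200)), (130 * 200).
by split=> //; apply: ltW; exact: truncnS_gt.
Qed.

Context (kap : nat) (cb ct cr : R).
Hypothesis cal : calibrated kap cb ct cr.

Lemma calibrated_ge0 : [/\ 0 <= cb, 0 <= ct & 0 <= cr].
Proof. by case: cal => h1 h2 h3 _; split; lra. Qed.

Lemma calibrated_kap : 3 * cr + 1 <= kap%:R.
Proof. by case: cal => _ _ -> h; lra. Qed.

Lemma calibrated_C_lower : 0 < C_lower kap cb ct.
Proof.
have [cb0 ct0 _] := calibrated_ge0.
have : 0 <= (kap%:R + 1) * (2 * cb) by rewrite mulr_ge0 ?addr_ge0 // mulr_ge0.
by rewrite /C_lower; move: (_ * (2 * cb)) => a a0; lra.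
Qed.

Lemma calibrated_c_regime : 0 < c_regime kap cb ct.
Proof.
have := calibrated_C_lower; rewrite /c_regime; move: (C_lower _ _ _) => C C0.
by rewrite invr_gt0 mulr_gt0 ?ltr0n.
Qed.

Lemma calibrated_C_select : 1 <= C_select kap cb ct.
Proof.
have [h1 h2 _ _] := cal; have [cb0 ct0 _] := calibrated_ge0.
have [+ _] := C_select_ge kap cb ct h1 ct0; apply: le_trans.
have : 0 <= (kap%:R + 1) * (2 * cb) by rewrite mulr_ge0 ?addr_ge0 // mulr_ge0.
by rewrite /C_lower; move: (_ * (2 * cb)) => a a0; lra.
Qed.

End Calibration.

(** * Assembling the error bound *)

Section ErrorBound.
Context {R : realType} {d n : nat} (kap : nat) (cb ct cr : R).
Hypothesis cal : calibrated kap cb ct cr.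
Context {d0 d1 : measure_display} {Omega0 : measurableType d0} {Omega : measurableType d1}.
Context (P0 : probability Omega0 R) (X0 : {RV P0 >-> 'cV[R]_d}).
Context (P : probability Omega R) (X Y : 'I_n -> {RV P >-> 'cV[R]_d}).
Context (p alpha eta : R).
Let Q := distribution P0 X0.
Let Sigma := second_moment X0.
Let kappa := moment_constant X0.
Hypotheses (p4 : 4 <= p) (hp : norm_moment_finite P0 X0 p) (Sigma0 : Sigma != 0).
Hypothesis iidX : iid_copies X0 X.
Hypotheses (eta0 : 0 <= eta) (alpha01 : 0 < alpha < 1) (n0 : (0 < n)%N).
Hypothesis contamination : {ae P, forall w, #|[set i | Y i w != X i w]%SET|%:R <= eta * n%:R}.

Let s := opnorm Sigma.
Let tr := \tr Sigma.
Let K := kappa 4 ^+ 4.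
(** The added 4 pays for 17 failures of probability [expR (- l)]: their total is at most [17 / 32]
    of [alpha], since [expR 4 >= 16]. *)
Let l := ln (2 / alpha) + 4.
Let b := tr / s + l.
Let eps := s * Num.sqrt (K * (b / n%:R)).
(** The truncation level that balances [n * lambda^2 * (K * s^2)] with [b]. *)
Let lambda := b / (n%:R * eps).
Let delta q := 64 * s * kappa q ^+ 2 * eta `^ (1 - 2 / q).

Hypothesis eta_small : K * eta <= c_regime kap cb ct ^+ 2.
Hypothesis n_large : b <= n%:R.

Let hp4 : norm_moment_finite P0 X0 4.
Proof. by apply: (norm_moment_le P0 X0 p) => //; rewrite lexx. Qed.

Let Q4 : fourth_moment_finite Q. Proof. exact: fourth_moment_law p4 hp. Qed.

Let SigmaP : psd Sigma. Proof. exact: second_moment_psd. Qed.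

Let s0 : 0 < s. Proof. exact: opnorm_gt0. Qed.

Let trE : Ex Q (fun x => inner x x) = tr. Proof. exact: Ex_norm2_trace. Qed.

Let second_le v : Ex Q (fun x => inner x v ^+ 2) <= s * inner v v.
Proof. exact: second_moment_le. Qed.

Let fourth_le v : Ex Q (fun x => inner x v ^+ 4) <= K * Ex Q (fun x => inner x v ^+ 2) ^+ 2.
Proof. exact: marginal_fourth_le. Qed.

Let K1 : 1 <= K. Proof. exact: moment_constant4_ge1. Qed.

Let K0 : 0 <= K. Proof. exact: le_trans K1. Qed.

Let norm4_le : Ex Q (fun x => inner x x ^+ 2) <= K * Ex Q (fun x => inner x x) ^+ 2.
Proof. exact: Ex_norm4_le. Qed.

Let Dhalf : exists2 v, rational_ball v & s / 2 <= inner v (Sigma *m v).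
Proof.
have [v v1 hv] := form_near_opnorm Sigma SigmaP Sigma0.
have e0 : 0 < s / 4 by rewrite divr_gt0.
have [u Du hu] := rational_ball_dense Sigma v (s / 4) v1 e0.
exists u => //; move: hu => /ler_normlP[_]; move: hv; rewrite -/s; lra.
Qed.

Let tr0 : 0 < tr.
Proof.
rewrite -trE; have [v [v1 _] hv] := Dhalf.
apply: lt_le_trans (_ : s / 2 <= _); first by rewrite divr_gt0.
apply: le_trans hv _; rewrite -second_moment_form //; apply: Ex_le => //.
- exact: mgrowth_inner2.
- exact: mgrowth_norm2.
by move=> x; apply: le_trans (inner_sqr_le _ _) _; rewrite ler_piMr ?inner_ge0.
Qed.

Let nR : 0 < n%:R :> R. Proof. by rewrite ltr0n. Qed.

Let ln0 : 0 < ln (2 / alpha).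
Proof.
have /andP[a0 a1] := alpha01; apply: ln_gt0; rewrite ltr_pdivlMr // mul1r.
by apply: lt_trans a1 _; rewrite ltr1n.
Qed.

Let l1 : 1 <= l. Proof. by rewrite /l; have := ln0; lra. Qed.

Let r0 : 0 < tr / s. Proof. exact: divr_gt0. Qed.

Let lb : l <= b. Proof. by rewrite /b lerDr ltW. Qed.

Let b1 : 1 <= b. Proof. exact: le_trans lb. Qed.

Let b0 : 0 < b := lt_le_trans ltr01 b1.

Let trb : tr <= b * s.
Proof. by rewrite -ler_pdivrMr // lerDl (le_trans ler01). Qed.

Let rad0 : 0 < K * (b / n%:R).
Proof. by rewrite mulr_gt0 ?divr_gt0 // (lt_le_trans ltr01). Qed.

Let eps0 : 0 < eps. Proof. by rewrite mulr_gt0 // sqrtr_gt0. Qed.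

Let eps2 : eps ^+ 2 = s ^+ 2 * (K * (b / n%:R)).
Proof. by rewrite exprMn sqr_sqrtr // ltW. Qed.

Let epsE : eps ^+ 2 * n%:R = s ^+ 2 * (K * b).
Proof. by rewrite eps2; field; rewrite gt_eqF. Qed.

Let lam0 : 0 < lambda. Proof. by rewrite divr_gt0 // mulr_gt0. Qed.

Let lam_eps : b = n%:R * (lambda * eps).
Proof. by rewrite /lambda; field; rewrite !gt_eqF. Qed.

Let lams : lambda * s <= 1.
Proof.
have e2 : 0 < n%:R * eps by rewrite mulr_gt0.
rewrite /lambda mulrAC ler_pdivrMr // mul1r.
rewrite -(@ler_pXn2r _ 2) ?nnegrE ?mulr_ge0 ?(ltW b0) ?(ltW s0) ?(ltW nR) ?(ltW eps0) //.
have -> : (n%:R * eps) ^+ 2 = n%:R * (eps ^+ 2 * n%:R) by ring.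
rewrite epsE exprMn.
have -> : n%:R * (s ^+ 2 * (K * b)) = (b * s ^+ 2) * (n%:R * K) by ring.
have -> : b ^+ 2 * s ^+ 2 = (b * s ^+ 2) * b by ring.
rewrite ler_pM2l ?mulr_gt0 ?exprn_gt0 //; apply: le_trans n_large _.
by rewrite ler_peMr.
Qed.

Let lamK : n%:R * (lambda ^+ 2 * (K * s ^+ 2)) <= b.
Proof.
rewrite le_eqVlt; apply/orP; left; apply/eqP.
have -> : n%:R * (lambda ^+ 2 * (K * s ^+ 2)) = lambda ^+ 2 * (s ^+ 2 * (K * b)) * n%:R / b.
  by field; rewrite gt_eqF.
rewrite -epsE.
have -> : lambda ^+ 2 * (eps ^+ 2 * n%:R) * n%:R / b = (n%:R * (lambda * eps)) ^+ 2 / b.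
  by field; rewrite gt_eqF.
by rewrite -lam_eps; field; rewrite gt_eqF.
Qed.

Let delta_ge0 q : 0 <= delta q.
Proof. by rewrite mulr_ge0 ?powR_ge0 // mulr_ge0 ?sqr_ge0 // mulr_ge0 // ltW. Qed.

Let tail_event q : 4 <= q -> norm_moment_finite P0 X0 q ->
  exists B', [/\ 0 <= B', eta * B' <= delta q & whp P (2 * expR (- l)) [set w |
    forall v, inner v v <= 1 ->
    \sum_(j < n) Num.max (Num.min (inner (X j w) v ^+ 2) lambda^-1 - B') 0 <=
      9 * n%:R * delta q + lambda^-1 * (5 * b)]].
Proof.
move=> q4 hq; have li0 : 0 < lambda^-1 by rewrite invr_gt0.
(* Without contamination the level coming from the moments would be infinite; [lambda^-1] replaces
   it, above which the capped data have no excess. *)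
have [eta_eq0|etan] := eqVneq eta 0.
  exists lambda^-1; split; [exact: ltW | by rewrite eta_eq0 mul0r |].
  apply: whp_le (_ : 0 <= _) _; first by rewrite mulr_ge0 ?expR_ge0.
  apply: whp_sub (whpT P) => w _ v v1; rewrite big1.
    apply: addr_ge0; apply: mulr_ge0 => //; first exact: ltW.
    by rewrite mulr_ge0 // ltW.
  by move=> j _; apply/max_idPr; rewrite subr_le0 ge_min lexx orbT.
have etap : 0 < eta by rewrite lt_def etan.
have kq0 : 0 < kappa q by exact: moment_constant_gt0.
pose B' := 64 * s * kappa q ^+ 2 * eta `^ (- (2 / q)).
have B'0 : 0 <= B' by rewrite mulr_ge0 ?powR_ge0 // mulr_ge0 ?sqr_ge0 // mulr_ge0 // ltW.
have s64 : 0 < 64 * s by rewrite mulr_gt0.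
have excess v c : 0 <= c -> c * Ex Q (fun x => inner x v ^+ 2) <= 64 * s ->
    Ex Q (fun x => Num.max (c * inner x v ^+ 2 - B') 0) <= delta q.
  by move=> c0 cv; exact: (marginal_excess_le P0 X0 Q4 q v c (64 * s) eta q4 hq kq0 s64 etap c0 cv).
exists B'; split=> //.
  rewrite /B' /delta (_ : 1 - 2 / q = 1 + - (2 / q)) // powRD; last by rewrite etan implybT.
  by rewrite powRr1 // le_eqVlt; apply/orP; left; apply/eqP; ring.
apply: whp_le (_ : expR (- l) + expR (- l) <= _) _; first by lra.
have ev := tail_uniform P Q n X Q4 iidX s s0 second_le b l lambda^-1 B' (delta q) b0.
apply: whp_sub (ev _ li0 B'0 (delta_ge0 q) _ _); last 3 first.
- by rewrite trE.
- by move=> th hth; apply: excess => //; lra.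
- by apply: (norm_excess_le Q Q4 s) => //; rewrite trE.
move=> w h v v1; apply: le_trans (h v v1) _; rewrite lerD2l ler_wpM2l ?(ltW li0) //.
by have := lb; lra.
Qed.

Let failure_le : 17 * expR (- l) <= alpha.
Proof.
have /andP[a0 a1] := alpha01.
have e4 : 16 <= expR 4 :> R.
  have -> : expR 4 = expR 1 ^+ 4 :> R by rewrite -expRM_natl; congr expR; lra.
  rewrite (_ : 16 = 2 ^+ 4) ?lerXn2r ?nnegrE ?expR_ge0 //; last by rewrite -natrX.
  by have := expR_ge1Dx (1 : R); lra.
rewrite /l opprD expRD !expRN lnK ?posrE ?divr_gt0 // invf_div.
have e0 : 0 < expR 4 :> R by exact: expR_gt0.
have : (expR 4)^-1 <= 16^-1 :> R by rewrite lef_pV2 ?posrE.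
move: ((expR 4)^-1) (invr_ge0 (expR 4 : R)) => c h hc.
have : alpha / 2 * c <= alpha / 2 * 16^-1 by rewrite ler_wpM2l // divr_ge0 // ltW.
lra.
Qed.

Context (Est : n.-tuple 'cV[R]_d -> 'M[R]_d).
Hypothesis EstP : forall y,
  (exists m, [/\ (m < n)%N, admissible (n := n) eta l m, passes kap rational_ball (tnth y) m,
     forall m', (m' < m)%N -> admissible (n := n) eta l m' -> ~ passes kap rational_ball (tnth y) m' &
     forall S e B, psd S -> 0 < e ->
       (forall v, inner v v <= 1 ->
          `|trim_form (kap * m) (tnth y) v - n%:R * inner v (S *m v)| <= n%:R * e) ->
       (forall v, inner v v <= 1 -> trim_form (kap * m) (tnth y) v <= n%:R * B) ->
       opnorm (Est y - S) <= 5 * e + B / n%:R]) \/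
   (forall m, (m < n)%N -> admissible (n := n) eta l m -> ~ passes kap rational_ball (tnth y) m) /\
   Est y = 0.

Let Cs := C_select kap cb ct.

Lemma error_event : whp P alpha [set w | opnorm (Est [tuple Y i w | i < n] - Sigma)
  <= (6 * Cs + 1) * (eps + delta p)].
Proof.
have [Bp [Bp0 Bpeta evp]] := tail_event p p4 hp.
have [B4 [B40 B4eta ev4]] := tail_event 4 (lexx 4) hp4.
pose M := n%:R * tr / (good_budget (n := n) cb s tr eta l)%:R.
have gb0 : 0 < (good_budget (n := n) cb s tr eta l)%:R :> R by rewrite ltr0n.
have M0 : 0 < M by rewrite divr_gt0 ?mulr_gt0.
have trQ0 : 0 < Ex Q (fun x => inner x x) by rewrite trE.
have evc : whp P 0 [set w | (differ (X ^~ w) (Y ^~ w))%:R <= eta * n%:R].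
  have [A [mA PA sA]] := contamination; exists (~` A); first exact: measurableC.
  by rewrite setCK PA; split=> // w nA; apply: contrapT => h; apply: nA; exact: sA.
have trb' : Ex Q (fun x => inner x x) <= b * s by rewrite trE.
have ev2 := two_sided_uniform P Q n X Q4 iidX s K s0 K0 second_le fourth_le norm4_le
  b l lambda b1 lb trb' n0 lam0 lams lamK.
have evu := norm_upper_event P Q n X Q4 iidX l M M0.
have evl := norm_lower_event P Q n X Q4 iidX K K1 trQ0 norm4_le l.
have evm := levels_event P Q n X Q4 iidX s n0 s0 second_le l l1.
apply: whp_le failure_le _.
(* The 17 failures: 5 for the two-sided estimate, 2 for each tail, 1 for each trace estimate, 6 for
   the levels; the contamination bound holds almost surely. *)
apply: whp_le (_ : 5 * expR (- l) + (2 * expR (- l) + (2 * expR (- l) + (expR (- l) +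
  (expR (- l) + (6 * expR (- l) + 0))))) <= _) _; first by lra.
apply: whp_sub (whp_setI _ _ _ _ _ ev2 (whp_setI _ _ _ _ _ evp (whp_setI _ _ _ _ _ ev4
  (whp_setI _ _ _ _ _ evu (whp_setI _ _ _ _ _ evl (whp_setI _ _ _ _ _ evm evc)))))).
move=> w [two [tailp [tail4 [upper [lower [levels contam]]]]]] /=.
pose x i := X i w; pose y i := Y i w.
have tE : tnth [tuple Y i w | i < n] = y by apply/funext => i; rewrite tnth_mktuple.
pose q v := inner v (Sigma *m v).
have [_ ct0 cr0] := calibrated_ge0 _ _ _ _ cal.
have kap_ge := calibrated_kap _ _ _ _ cal.
have Dle (v : 'cV[R]_d) : rational_ball v -> inner v v <= 1 by case.
have qs v : inner v v <= 1 -> 0 <= q v <= s.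
  move=> v1; have [_ S0] := SigmaP; rewrite S0 /=.
  by apply: le_trans (form_le_opnorm _ _) _; rewrite ler_piMr // ltW.
have d4small : delta 4 ^+ 2 <= 64 ^+ 2 * (s ^+ 2 * (K * eta)).
  rewrite le_eqVlt; apply/orP; left; apply/eqP; rewrite /delta /K.
  have -> : eta `^ (1 - 2 / 4) = Num.sqrt eta.
    by rewrite -powR12_sqrt //; congr (_ `^ _); field.
  have sqE := sqr_sqrtr eta0; rewrite -{2}sqE; move: (Num.sqrt eta) (kappa 4) => u k; ring.
have two' v : inner v v <= 1 ->
    \sum_(j < n) remainder4 b lambda v (x j) <= cr * b /\
    `| lambda * (\sum_(j < n) (well_sized b lambda v (x j))%:R * inner (x j) v ^+ 2)
     - n%:R * (lambda * q v) | <= ct * b.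
  have [_ -> -> _] := cal; move=> v1; rewrite /q -second_moment_form //; exact: two.
have passing m : admissible (n := n) eta l m -> (m < n)%N -> passes kap rational_ball y m ->
    forall v, inner v v <= 1 -> trim_form (kap * m) y v <= 385 * (n%:R * s).
  move=> am mn [v0 [v01 _] pv].
  have lm : l <= m%:R by apply: le_trans am; rewrite lerDr mulr_ge0.
  have [B [phi [B0 Bphi h1 h2]]] := levels m mn lm.
  have hm : (differ x y <= m)%N.
    rewrite -(ler_nat R); apply: le_trans contam _; apply: le_trans am.
    by rewrite lerDl (le_trans ler01).
  have m0 : (0 < m)%N by rewrite -(ltr_nat R); apply: lt_le_trans lm; apply: lt_le_trans l1.
  have [_ _ _ kap_large] := cal.
  exact: (passes_bound kap kap_large x y m (differ x y) B s phi v0 (leqnn _) hm m0 B0 h1 h2 Bphi v01 pv).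
have norm_upper : \sum_j Num.min (inner (x j) (x j)) M <= 4 * (n%:R * tr).
  apply: le_trans upper _; rewrite trE.
  suff : l * M <= n%:R * tr by lra.
  rewrite /M mulrA ler_pdivrMr // mulrC ler_pM2l ?mulr_gt0 //.
  have [cb_large _ _ _] := cal.
  have := good_budget_admissible (n := n) cb cb_large s tr eta l s0 tr0 eta0 l1.
  by apply: le_trans; rewrite lerDr mulr_ge0.
have norm_lower : n%:R * tr / 2 <=
    2 * (\sum_j Num.min (inner (x j) (x j)) (2 * K * tr)) + 4 * (l * K * tr).
  by move: lower; rewrite trE.
have Cs1 : 1 <= Cs := calibrated_C_select _ _ _ _ cal.
have ed0 : 0 < eps + delta p by rewrite ltr_pwDl.
(* Absorbs the part of the slack [B / n] of the nearly minimal fit that comes from [s]. *)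
have seps : s / n%:R <= eps.
  rewrite -(@ler_pXn2r _ 2) ?nnegrE ?divr_ge0 ?(ltW s0) ?(ltW eps0) //.
  rewrite eps2 exprMn ler_pM2l ?exprn_gt0 // mulrA expr2 ler_pM2r ?invr_gt0 //.
  apply: (@le_trans _ _ 1); first by rewrite invf_le1 // ler1n.
  by apply: mulr_ege1.
set e := Cs * (eps + delta p).
have e0 : 0 < e by rewrite mulr_gt0 // (lt_le_trans ltr01).
have -> : (6 * Cs + 1) * (eps + delta p) = 6 * e + (eps + delta p) by rewrite /e; ring.
have dp0 := delta_ge0 p.
case: (EstP [tuple Y i w | i < n]); rewrite tE.
  move=> [m [mn am pm minm err]].
  have serr (v : 'cV[R]_d) (v1 : inner v v <= 1) := selected_error kap cb ct cr (let: And4 h _ _ _ := cal in h)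
    ct0 cr0 kap_ge rational_ball x y q s tr K eta l lambda eps B4 Bp (delta 4) (delta p) (differ x y)
    n0 s0 tr0 K1 eta0 l1 lam0 eps0 lam_eps epsE Dle Dhalf qs (leqnn _) contam eta_small
    B40 Bp0 (delta_ge0 4) (delta_ge0 p) B4eta Bpeta d4small passing two' tail4 tailp
    norm_upper norm_lower m v am mn pm minm v1.
  have up v : inner v v <= 1 -> trim_form (kap * m) y v <= n%:R * (s + e).
    move=> v1; have /ler_normlP[_ h1] := serr v v1; have /andP[_ h2] := qs v v1.
    have h3 : n%:R * q v <= n%:R * s by rewrite ler_wpM2l.
    by move: h1 h3; rewrite -/Cs -/e mulrDr; lra.
  apply: le_trans (err Sigma e (s + e) SigmaP e0 serr up) _.
  have : e / n%:R <= e by rewrite ler_pdivrMr // ler_peMr ?(ltW e0) // ler1n.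
  by rewrite mulrDl; move: seps dp0; lra.
move=> [nopass ->].
have none := none_selected kap cb ct cr (let: And4 h _ _ _ := cal in h) ct0
    rational_ball x y q s tr K eta l lambda eps B4 (delta 4) (differ x y)
    n0 s0 tr0 K1 eta0 l1 lam0 eps0 lam_eps epsE Dle Dhalf (leqnn _) contam eta_small
    B40 (delta_ge0 4) B4eta d4small two' tail4 norm_upper nopass.
have h0 : opnorm (0 - Sigma) <= s.
  have [ST S0] := SigmaP; apply: opnorm_le_form; first by rewrite sub0r linearN /= ST.
    exact: ltW.
  by move=> v v1; rewrite sub0r mulNmx innerNr normrN ger0_norm //; case/andP: (qs v v1).
apply: le_trans h0 _; apply: le_trans none _; rewrite -/Cs.
have : Cs * eps <= e by rewrite /e ler_wpM2l ?lerDl // (le_trans ler01).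
by move: e0 eps0 dp0; lra.
Qed.

End ErrorBound.

(** * Passage to the stated constant and probability *)

Lemma whp_probability {R : realType} {dT : measure_display} {T : measurableType dT}
    (P : probability T R) (e : R) (S : set T) :
  measurable S -> whp P e S -> ((1 - e)%:E <= P S)%E.
Proof.
move=> mS [H mH [HS PH]]; apply: (@le_trans _ _ (P H)); last by apply: le_measure; rewrite ?inE.
have := probability_setC P mH; rewrite -[P H]fineK ?fin_num_measure // => PHE.
by move: PH; rewrite PHE -EFinB !lee_fin; lra.
Qed.

Lemma ln2_ge_half (R : realType) : 2^-1 <= ln 2 :> R.
Proof.
rewrite -[leLHS]expRK ler_ln ?posrE ?expR_gt0 //.
have := expR_ge1Dx (- 2^-1 : R); rewrite expRN => h.
by rewrite -[leRHS]invrK -[leLHS]invrK lef_pV2 ?posrE ?invr_gt0 ?expR_gt0 //; lra.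
Qed.

Theorem theorem1p3 (R : realType) :
  exists2 C : R, 0 < C &
  forall (d n : nat) (alpha eta : R),
    0 < alpha < 1 -> 0 <= eta < 1 / 2 ->
  exists2 Estar : {mfun n.-tuple 'cV[R]_d >-> 'M[R]_d},
    (forall y, psd (Estar y)) &
  forall (d0 : measure_display) (Omega0 : measurableType d0)
    (P0 : probability Omega0 R) (X0 : {RV P0 >-> 'cV[R]_d})
    (d1 : measure_display) (Omega : measurableType d1)
    (P : probability Omega R) (X Y : 'I_n -> {RV P >-> 'cV[R]_d}) (p : R),
    let Sigma := second_moment X0 in
    let kappa := moment_constant X0 in
    4 <= p ->
    ('E_P0[fun w => (enorm (X0 w) `^ p)%R] < +oo)%E ->
    (forall i, 'E_P0[fun w => (X0 w i 0)%R] = 0)%E ->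
    Sigma != 0 ->
    iid_copies X0 X ->
    {ae P, forall w, #|[set i | Y i w != X i w]%SET|%:R <= eta * n%:R} ->
    eta <= 1 / (C * kappa 4 ^+ 4) ->
    C * (effective_rank Sigma + ln (2 / alpha)) <= n%:R ->
    ((1 - alpha)%:E <=
     P [set w | (opnorm (Estar [tuple Y i w | i < n] - Sigma) <=
        C * kappa 4 ^+ 2 * opnorm Sigma *
          (Num.sqrt (effective_rank Sigma / n%:R)
           + Num.sqrt (ln (2 / alpha) / n%:R))
        + C * kappa p ^+ 2 * opnorm Sigma * eta `^ (1 - 2 / p))%R])%E.
Proof.
have [kap [cb [ct [cr cal]]]] := @calibrated_exists R.
have Cs0 : 0 < C_select kap cb ct by apply: lt_le_trans ltr01 (calibrated_C_select _ _ _ _ cal).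
have c0 := calibrated_c_regime _ _ _ _ cal.
set Cs := C_select _ _ _ in Cs0; set c := c_regime _ _ _ in c0.
have ci0 : 0 < (c ^+ 2)^-1 by rewrite invr_gt0 exprn_gt0.
(* The 9 yields [n >= r + ln (2 / alpha) + 4], because [ln (2 / alpha) >= 1/2] makes 4 at most 8
   times the logarithm; the second term is the error constant, with the 64 of [delta]; the third is
   for the condition on [eta]. *)
pose C := 9 + 64 * (6 * Cs + 1) + (c ^+ 2)^-1.
have C9 : 9 <= C by rewrite /C; lra.
have C64 : 64 * (6 * Cs + 1) <= C by rewrite /C; lra.
have Cc : (c ^+ 2)^-1 <= C by rewrite /C; lra.
have C0 : 0 < C by apply: lt_le_trans C9.
clearbody C.
exists C => // d n alpha eta alpha01 /andP[eta0 _].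
pose l : R := ln (2 / alpha) + 4.
have [Est [mE psdE EstP]] := @estimator_exists R d n kap eta l.
have mEst : measurable_fun setT Est by move=> _ B _; rewrite setTI; exact: mE.
exists (mfun_Sub (mem_set mEst)) => // d0 Omega0 P0 X0 d1 Omega P X Y p Sigma kappa p4 hp _ Sigma0
  iidX contamination eta_small n_large.
have hp' := norm_moment_law P0 X0 p hp.
have hp4 : norm_moment_finite P0 X0 4 by apply: (norm_moment_le P0 X0 p) => //; rewrite lexx.
have Q4 := fourth_moment_law P0 X0 p p4 hp'.
have s0 : 0 < opnorm Sigma by exact: opnorm_gt0.
have K1 : 1 <= kappa 4 ^+ 4 by exact: moment_constant4_ge1.
have r0 : 0 <= effective_rank Sigma.
  rewrite divr_ge0 ?opnorm_ge0 // -Ex_norm2_trace //; apply: Ex_ge0 => x; exact: inner_ge0.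
have L0 : 2^-1 <= ln (2 / alpha).
  have /andP[a0 a1] := alpha01; apply: le_trans (ln2_ge_half R) _.
  by rewrite ler_ln ?posrE ?divr_gt0 // ler_pdivlMr // ler_piMr // ltW.
have ln0 : 0 <= ln (2 / alpha) by lra.
have rL : 9 * (effective_rank Sigma + ln (2 / alpha)) <= n%:R.
  by apply: le_trans n_large; rewrite ler_wpM2r // addr_ge0 //; lra.
have nR : 0 < n%:R :> R by lra.
have n0 : (0 < n)%N by rewrite -(ltr_nat R).
have n_large' : \tr Sigma / opnorm Sigma + (ln (2 / alpha) + 4) <= n%:R.
  by rewrite -/(effective_rank Sigma); lra.
have eta_small' : kappa 4 ^+ 4 * eta <= c_regime kap cb ct ^+ 2.
  rewrite -/c; have K0 : 0 < kappa 4 ^+ 4 by exact: lt_le_trans K1.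
  apply: (@le_trans _ _ C^-1).
    rewrite mulrC -ler_pdivlMr //; apply: le_trans eta_small _.
    by rewrite div1r invfM.
  by rewrite -[leRHS]invrK lef_pV2 ?posrE.
have ev := error_event kap cb ct cr cal P0 X0 P X Y p alpha eta
  p4 hp' Sigma0 iidX eta0 alpha01 n0 contamination eta_small' n_large' Est EstP.
apply: whp_probability.
  (* The event is measurable because the preimage under [Est] of any set of matrices is. *)
  rewrite (_ : mkset _ = (fun w => [tuple Y i w | i < n]) @^-1` (Est @^-1` [set M |
     opnorm (M - Sigma) <= C * kappa 4 ^+ 2 * opnorm Sigma *
          (Num.sqrt (effective_rank Sigma / n%:R) + Num.sqrt (ln (2 / alpha) / n%:R))
        + C * kappa p ^+ 2 * opnorm Sigma * eta `^ (1 - 2 / p)])) //.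
  have mY : measurable_fun setT (fun w => [tuple Y i w | i < n]).
    apply/measurable_fun_tnthP => i; rewrite (_ : _ \o _ = Y i) //.
    by apply/funext => w /=; rewrite tnth_mktuple.
  by rewrite -[X in measurable X]setTI; apply: mY.
apply: whp_sub ev => w /= h; apply: le_trans h _; rewrite -/Cs -/Sigma -/kappa.
set a := Num.sqrt (_ / _); set a' := Num.sqrt (_ / _).
have a0 : 0 <= a by exact: sqrtr_ge0.
have a'0 : 0 <= a' by exact: sqrtr_ge0.
(* The factor 3 is the root of 9: the additive 4 in the deviation term is again absorbed by the
   logarithm. *)
have sqrt_le : Num.sqrt (kappa 4 ^+ 4 *
     ((\tr Sigma / opnorm Sigma + (ln (2 / alpha) + 4)) / n%:R)) <= kappa 4 ^+ 2 * (3 * (a + a')).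
  have k2 := sqr_ge0 (kappa 4).
  rewrite -(ger0_norm (mulr_ge0 k2 _)) ?mulr_ge0 ?addr_ge0 // -sqrtr_sqr ler_wsqrtr //.
  rewrite exprMn -exprM ler_wpM2l // ?(le_trans ler01 K1) //.
  apply: (@le_trans _ _ (9 * (a ^+ 2 + a' ^+ 2))); last first.
    have : 0 <= a * a' by exact: mulr_ge0.
    lra.
  have n1 := ltW nR; rewrite !sqr_sqrtr ?(divr_ge0 r0 n1) ?(divr_ge0 ln0 n1) //.
  by rewrite -mulrDl mulrA ler_pM2r ?invr_gt0 // -/(effective_rank Sigma); lra.
rewrite mulrDr; apply: lerD.
  apply: (@le_trans _ _ ((6 * Cs + 1) * (opnorm Sigma * (kappa 4 ^+ 2 * (3 * (a + a')))))).
    by rewrite ler_pM2l ?ler_pM2l //; lra.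
  have -> : (6 * Cs + 1) * (opnorm Sigma * (kappa 4 ^+ 2 * (3 * (a + a')))) =
    3 * (6 * Cs + 1) * (kappa 4 ^+ 2 * opnorm Sigma * (a + a')) by ring.
  have -> : C * kappa 4 ^+ 2 * opnorm Sigma * (a + a') =
    C * (kappa 4 ^+ 2 * opnorm Sigma * (a + a')) by ring.
  rewrite ler_wpM2r //.
    by rewrite mulr_ge0 ?addr_ge0 // mulr_ge0 ?sqr_ge0 // ltW.
  lra.
have -> : (6 * Cs + 1) * (64 * opnorm Sigma * kappa p ^+ 2 * eta `^ (1 - 2 / p)) =
  64 * (6 * Cs + 1) * (kappa p ^+ 2 * opnorm Sigma * eta `^ (1 - 2 / p)) by ring.
have -> : C * kappa p ^+ 2 * opnorm Sigma * eta `^ (1 - 2 / p) =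
  C * (kappa p ^+ 2 * opnorm Sigma * eta `^ (1 - 2 / p)) by ring.
by rewrite ler_wpM2r // mulr_ge0 ?powR_ge0 // mulr_ge0 ?sqr_ge0 // ltW.
Qed.
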